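(* Let $\Bbbk$ be an algebraically closed field with $\operatorname{char}\Bbbk\neq2$, and let $\widetilde{\mathcal D}$ and $\mathtt D$ be as in the context. (i) The algebra $\widetilde{\mathcal D}$ admits an exhaustive ascending filtration $(\widetilde{\mathcal D}_n)_{n\in\mathbb N_0}$ such that the associated graded algebra satisfies $\operatorname{gr}\widetilde{\mathcal D}\simeq\Bbbk[X_1,\dots,X_5,T^{\pm1}]\otimes\Lambda(Y_1,\dots,Y_4)$. (ii) The algebras $\mathtt D$ and $\widetilde{\mathcal D}$ are noetherian. (iii) If $\operatorname{char}\Bbbk=p>2$, then $\widetilde{\mathcal D}$ is a PI-algebra.
   Context: $\widetilde{\mathcal D}$ is the Hopf superalgebra generated by odd elements $x_1,x_2,u_1,u_2$ and even elements $g^{\pm1},\zeta$ with relations (writing $x_{21}=x_2x_1+x_1x_2$, $u_{21}=u_1u_2+u_2u_1$): $x_1^2=0$, $x_2x_{21}=x_{21}x_2+x_1x_{21}$, $u_1^2=0$, $u_2u_{21}=u_{21}u_2+u_1u_{21}$, $u_i\zeta=\zeta u_i+u_i$, $\zeta x_i=x_i\zeta+x_i$ ($i=1,2$), $g^{\pm1}g^{\mp1}=1$, $\zeta g=g\zeta$, $gx_1=x_1g$, $gx_2=x_2g-x_1g$, $u_1g=gu_1$, $u_2g=gu_2-gu_1$, $u_1x_1=-x_1u_1$, $u_1x_2=-x_2u_1+(1-g)$, $u_2x_1=-x_1u_2+(1-g)+x_1u_1$, $u_2x_2=-x_2u_2+g\zeta+x_2u_1$. $\mathtt D$ (the double of the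 bosonization of the super Jordan plane by the infinite cyclic group) is, as an algebra, the smash product $\widetilde{\mathcal D}\#\Bbbk C_2$, where the generator $\epsilon$ of $C_2$ (the group of order 2) acts on $\widetilde{\mathcal D}$ by the parity automorphism: $\epsilon a=(-1)^{|a|}a\epsilon$ for homogeneous $a$. $\Lambda$ denotes the exterior algebra on the indicated generators. *)

(* Defs.v *)
From HB Require Import structures.
From mathcomp Require Import all_boot all_fingroup all_algebra generic_quotient.
From mathcomp Require Import finmap boolp.
From mathcomp.multinomials Require Import monalg.

Set Implicit Arguments.
Unset Strict Implicit.
Unset Printing Implicit Defensive.

Import GRing.Theory.
Local Open Scope ring_scope.
Local Open Scope quotient_scope.

Section Ideal.
Variables (k : fieldType) (A : algType k).

Record ideal := Ideal {
  ideal_mem :> A -> Prop;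
  ideal0 : ideal_mem 0;
  idealD : forall a b, ideal_mem a -> ideal_mem b -> ideal_mem (a + b);
  idealMl : forall a b, ideal_mem b -> ideal_mem (a * b);
  idealMr : forall a b, ideal_mem a -> ideal_mem (a * b) }.

Section Generated.
Variable S : A -> Prop.

Definition gen_mem (a : A) : Prop :=
  forall I : ideal, (forall s, S s -> I s) -> I a.

Fact gen_mem0 : gen_mem 0. Proof. by move=> I _; apply: ideal0. Qed.
Fact gen_memD a b : gen_mem a -> gen_mem b -> gen_mem (a + b).
Proof. by move=> ha hb I hI; apply: idealD; [apply: ha | apply: hb]. Qed.
Fact gen_memMl a b : gen_mem b -> gen_mem (a * b).
Proof. by move=> hb I hI; apply: idealMl; apply: hb. Qed.
Fact gen_memMr a b : gen_mem a -> gen_mem (a * b).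
Proof. by move=> ha I hI; apply: idealMr; apply: ha. Qed.

Definition gen_ideal : ideal := Ideal gen_mem0 gen_memD gen_memMl gen_memMr.

Lemma mem_gen_ideal s : S s -> gen_ideal s.
Proof. by move=> Ss I; apply. Qed.

Lemma gen_idealW (I : ideal) a :
  (forall s, S s -> I s) -> gen_ideal a -> I a.
Proof. by move=> hI; apply. Qed.

End Generated.

Variable I : ideal.

Lemma idealN a : I a -> I (- a).
Proof. by rewrite -mulN1r; apply: idealMl. Qed.

Definition ideal_pred (a : A) : bool := `[< I a >].

Fact ideal_pred_zmod_closed : zmod_closed ideal_pred.
Proof.
split=> [|a b]; first exact/asboolP/ideal0.
by move=> /asboolP ha /asboolP hb; apply/asboolP/idealD => //; apply: idealN.
Qed.

HB.instance Definition _ :=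
  GRing.isZmodClosed.Build A ideal_pred ideal_pred_zmod_closed.

Definition quotAlg := Quotient.quot (GRing.ZmodClosed.clone A ideal_pred _).

HB.instance Definition _ := EqQuotient.on quotAlg.
HB.instance Definition _ := GRing.Zmodule.on quotAlg.

Definition quotAlg_pi (a : A) : quotAlg := \pi_quotAlg a.

Lemma quotAlg_eq a b : quotAlg_pi a = quotAlg_pi b <-> I (a - b).
Proof.
split=> [/eqP|h]; last apply/eqP; rewrite /quotAlg_pi piE.
  by move/asboolP.
exact/asboolP.
Qed.

Lemma quotAlg_ind (P : quotAlg -> Prop) :
  (forall a, P (quotAlg_pi a)) -> forall x, P x.
Proof. by move=> h x; rewrite -[x]reprK; apply: h. Qed.

Lemma quotAlg_repr a : I (a - repr (quotAlg_pi a)).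
Proof. by apply/quotAlg_eq; rewrite /quotAlg_pi reprK. Qed.

Lemma quotAlg_piD a b : quotAlg_pi (a + b) = quotAlg_pi a + quotAlg_pi b.
Proof. by rewrite /quotAlg_pi !piE. Qed.

Lemma quotAlg_piN a : quotAlg_pi (- a) = - quotAlg_pi a.
Proof. by rewrite /quotAlg_pi !piE. Qed.

Definition quotAlg_one : quotAlg := quotAlg_pi 1.
Definition quotAlg_mul (x y : quotAlg) : quotAlg := quotAlg_pi (repr x * repr y).
Definition quotAlg_scale (c : k) (x : quotAlg) : quotAlg :=
  quotAlg_pi (c *: repr x).

Lemma quotAlg_mulE a b :
  quotAlg_mul (quotAlg_pi a) (quotAlg_pi b) = quotAlg_pi (a * b).
Proof.
apply/esym/quotAlg_eq.
rewrite -[_ - _](subrKA (a * repr (quotAlg_pi b))) -mulrBr -mulrBl.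
by apply: idealD; [apply: idealMl | apply: idealMr]; apply: quotAlg_repr.
Qed.

Lemma quotAlg_scaleE c a : quotAlg_scale c (quotAlg_pi a) = quotAlg_pi (c *: a).
Proof.
apply/esym/quotAlg_eq; rewrite -scalerBr -[_ - _]mul1r scalerAl.
exact/idealMl/quotAlg_repr.
Qed.

Local Ltac by_repr :=
  repeat (let x := fresh in elim/quotAlg_ind => x);
  rewrite ?(quotAlg_mulE, quotAlg_scaleE, =^~ quotAlg_piD).

Fact quotAlg_mulA : associative quotAlg_mul.
Proof. by by_repr; rewrite mulrA. Qed.
Fact quotAlg_mul1 : left_id quotAlg_one quotAlg_mul.
Proof. by by_repr; rewrite mul1r. Qed.
Fact quotAlg_mulr1 : right_id quotAlg_one quotAlg_mul.
Proof. by by_repr; rewrite mulr1. Qed.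
Fact quotAlg_mulDl : left_distributive quotAlg_mul +%R.
Proof. by by_repr; rewrite mulrDl. Qed.
Fact quotAlg_mulDr : right_distributive quotAlg_mul +%R.
Proof. by by_repr; rewrite mulrDr. Qed.

HB.instance Definition _ := GRing.Zmodule_isPzRing.Build quotAlg
  quotAlg_mulA quotAlg_mul1 quotAlg_mulr1 quotAlg_mulDl quotAlg_mulDr.

Fact quotAlg_scaleA c d x :
  quotAlg_scale c (quotAlg_scale d x) = quotAlg_scale (c * d) x.
Proof. by move: x; by_repr; rewrite scalerA. Qed.
Fact quotAlg_scale1 : left_id 1 quotAlg_scale.
Proof. by by_repr; rewrite scale1r. Qed.
Fact quotAlg_scaleDr : right_distributive quotAlg_scale +%R.
Proof. by move=> c; by_repr; rewrite scalerDr. Qed.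
Fact quotAlg_scaleDl x : {morph quotAlg_scale^~ x : c d / c + d}.
Proof. by move=> c d; move: x; by_repr; rewrite scalerDl. Qed.

HB.instance Definition _ := GRing.Zmodule_isLmodule.Build k quotAlg
  quotAlg_scaleA quotAlg_scale1 quotAlg_scaleDr quotAlg_scaleDl.

Lemma quotAlg_piM a b : quotAlg_pi (a * b) = quotAlg_pi a * quotAlg_pi b.
Proof. exact/esym/quotAlg_mulE. Qed.

Lemma quotAlg_pi1 : quotAlg_pi 1 = 1. Proof. by []. Qed.

Lemma quotAlg_piZ c a : quotAlg_pi (c *: a) = c *: quotAlg_pi a.
Proof. exact/esym/quotAlg_scaleE. Qed.

Fact quotAlg_pi_linear : linear quotAlg_pi.
Proof. by move=> c a b; rewrite quotAlg_piD quotAlg_piZ. Qed.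

Fact quotAlg_pi_monoid_morphism : monoid_morphism quotAlg_pi.
Proof. by split=> // a b; apply: quotAlg_piM. Qed.

HB.instance Definition _ :=
  GRing.isLinear.Build k A quotAlg *:%R quotAlg_pi quotAlg_pi_linear.
HB.instance Definition _ :=
  GRing.isMonoidMorphism.Build A quotAlg quotAlg_pi quotAlg_pi_monoid_morphism.

Lemma quotAlg_scaleAl (c : k) (x y : quotAlg) : c *: (x * y) = (c *: x) * y.
Proof.
elim/quotAlg_ind: x => a; elim/quotAlg_ind: y => b.
by rewrite -quotAlg_piM -!quotAlg_piZ -quotAlg_piM scalerAl.
Qed.

Lemma quotAlg_scaleAr (c : k) (x y : quotAlg) : c *: (x * y) = x * (c *: y).
Proof.
elim/quotAlg_ind: x => a; elim/quotAlg_ind: y => b.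
by rewrite -quotAlg_piM -!quotAlg_piZ -quotAlg_piM scalerAr.
Qed.

Lemma quotAlg_neq0 : ~ I 1 -> 1 != 0 :> quotAlg.
Proof.
move=> I1; apply/eqP => /esym e; apply: I1; rewrite -[1]subr0.
by apply/quotAlg_eq; rewrite quotAlg_pi1 -e -[0 in RHS]subr0 quotAlg_piD
  quotAlg_piN subrr.
Qed.

End Ideal.

Section Kernel.
Variables (k : fieldType) (A : algType k) (B : pzRingType).
Variable f : {rmorphism A -> B}.

Fact kernel0 : f 0 = 0. Proof. exact: rmorph0. Qed.
Fact kernelD a b : f a = 0 -> f b = 0 -> f (a + b) = 0.
Proof. by move=> ha hb; rewrite rmorphD ha hb addr0. Qed.
Fact kernelMl a b : f b = 0 -> f (a * b) = 0.
Proof. by move=> hb; rewrite rmorphM hb mulr0. Qed.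
Fact kernelMr a b : f a = 0 -> f (a * b) = 0.
Proof. by move=> ha; rewrite rmorphM ha mul0r. Qed.

Definition kernel : ideal A := Ideal kernel0 kernelD kernelMl kernelMr.

End Kernel.

Lemma gen_ideal_proper (k : fieldType) (A : algType k) (B : nzRingType)
    (f : {rmorphism A -> B}) (S : A -> Prop) :
  (forall s, S s -> f s = 0) -> ~ gen_ideal S 1.
Proof.
move=> fS /(gen_idealW (I := kernel f) fS) /= /eqP.
by rewrite rmorph1 oner_eq0.
Qed.

Lemma malg_scaleAr (K : monomType) (R : comNzRingType) (c : R)
    (f g : {malg R[K]}) : c *: (f * g) = f * (c *: g).
Proof.
have cf : c%:MP * f = f * c%:MP.
  rewrite [LHS]fgmulUg [RHS]fgmulgU.
  by apply: eq_bigr => w _; rewrite mul1m mulm1 mulrC.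
by rewrite -mul_malgC mulrA cf -mulrA mul_malgC.
Qed.

Lemma malgU_scale (K : monomType) (R : comNzRingType) (c : R) (w : K) :
  << c *g w >> = c *: << w >> :> {malg R[K]}.
Proof. by apply/malgP => u; rewrite mcoeffZ !mcoeffU mulrnAr mulr1. Qed.

Definition freeAlg (k : fieldType) (X : choiceType) := {malg k[{fmonom X}]}.

Section FreeAlg.
Variables (k : fieldType) (X : choiceType).

HB.instance Definition _ := GRing.Lalgebra.on (freeAlg k X).

Fact freeAlg_scaleAr (c : k) (f g : freeAlg k X) : c *: (f * g) = f * (c *: g).
Proof. exact: malg_scaleAr. Qed.

HB.instance Definition _ :=
  GRing.Lalgebra_isAlgebra.Build k (freeAlg k X) freeAlg_scaleAr.

Definition fgen (x : X) : freeAlg k X := << fmu x >>.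

Section Eval.
Variables (A : algType k) (rho : X -> A).

Definition feval_mon (w : {fmonom X}) : A := \prod_(x <- (w : seq X)) rho x.

Definition feval (f : freeAlg k X) : A :=
  \sum_(w <- msupp f) f@_w *: feval_mon w.

Lemma fevalEw (d : {fset {fmonom X}}) f : (msupp f `<=` d)%fset ->
  feval f = \sum_(w <- d) f@_w *: feval_mon w.
Proof.
move=> le; rewrite [LHS](big_fset_incl _ le) => //= w _ /mcoeff_outdom ->.
by rewrite scale0r.
Qed.

Lemma fevalU c w : feval << c *g w >> = c *: feval_mon w.
Proof. by rewrite (fevalEw msuppU_le) big_seq_fset1 mcoeffUU. Qed.

Lemma feval_gen x : feval (fgen x) = rho x.
Proof. by rewrite fevalU scale1r /feval_mon /fmu fmE /= big_seq1. Qed.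

Lemma feval_monM u v : feval_mon (mmul u v) = feval_mon u * feval_mon v.
Proof. by rewrite /feval_mon fmM big_cat. Qed.

Fact feval_is_linear : linear feval.
Proof.
move=> c f g.
pose d := (msupp f `|` msupp g)%fset.
have hf : (msupp f `<=` d)%fset by apply: fsubsetUl.
have hg : (msupp g `<=` d)%fset by apply: fsubsetUr.
have hh : (msupp (c *: f + g) `<=` d)%fset.
  apply: fsubset_trans (msuppD_le _ _) _; apply: fsetSU; exact: msuppZ_le.
rewrite (fevalEw hf) (fevalEw hg) (fevalEw hh) scaler_sumr -big_split /=.
by apply: eq_bigr => w _; rewrite mcoeffD mcoeffZ scalerDl scalerA.
Qed.

HB.instance Definition _ :=
  GRing.isLinear.Build k (freeAlg k X) A *:%R feval feval_is_linear.

Fact feval_is_monoid_morphism : monoid_morphism feval.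
Proof.
split=> [|f g].
  by rewrite [1]/(<< mone >>) fevalU scale1r /feval_mon fm1 big_nil.
rewrite [f * g]malgME [feval f in RHS]/feval mulr_suml raddf_sum.
apply: eq_bigr => u _; rewrite [feval g in RHS]/feval mulr_sumr raddf_sum.
apply: eq_bigr => v _ /=.
by rewrite fevalU feval_monM -scalerAl -scalerAr scalerA.
Qed.

HB.instance Definition _ :=
  GRing.isMonoidMorphism.Build (freeAlg k X) A feval feval_is_monoid_morphism.

End Eval.

Lemma fmonomU c w : << c *g w >> = c *: << w >> :> freeAlg k X.
Proof. exact: malgU_scale. Qed.

Lemma fmonom_cat s t :
  << FMonom (s ++ t) >> = << FMonom s >> * << FMonom t >> :> freeAlg k X.
Proof.
rewrite [RHS]fgmulUU mulr1; congr << _ >>.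
by rewrite /mmul /= /fmmul fmE.
Qed.

Lemma feval_uniq (A : algType k) (h : {lrmorphism freeAlg k X -> A}) f :
  h f = feval (h \o fgen) f.
Proof.
rewrite {1}[f]monalgE raddf_sum; apply: eq_bigr => w _ /=.
rewrite fmonomU linearZ /=; congr (_ *: _).
case: w => w; rewrite /feval_mon /=; elim: w => [|x w IHw].
  rewrite big_nil -(rmorph1 h); congr (h << _ >>).
  by rewrite /mone /= /fmone fmE.
rewrite big_cons -IHw -rmorphM -[x :: w]cat1s fmonom_cat /=.
by rewrite /fgen /fmu fmE.
Qed.

Lemma feval_ext (A : algType k) (h1 h2 : {lrmorphism freeAlg k X -> A}) :
  (forall x, h1 (fgen x) = h2 (fgen x)) -> h1 =1 h2.
Proof.
move=> h12 f; rewrite (feval_uniq h1) (feval_uniq h2).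
apply: eq_bigr => w _; congr (_ *: _); apply: eq_bigr => x _; exact: h12.
Qed.

Definition relIdeal (R : freeAlg k X -> freeAlg k X -> Prop) :
    ideal (freeAlg k X) :=
  gen_ideal (fun f => exists a b, R a b /\ f = a - b).

Lemma relIdeal_proper (A : algType k) (rho : X -> A)
    (R : freeAlg k X -> freeAlg k X -> Prop) :
  (forall a b, R a b -> feval rho a = feval rho b) -> ~ relIdeal R 1.
Proof.
move=> hR; apply: (gen_ideal_proper (f := feval rho)) => _ [a [b [Rab ->]]].
by rewrite rmorphB /= (hR a b) // subrr.
Qed.

End FreeAlg.

Section Lift.
Variables (k : fieldType) (A B : algType k) (I : ideal A).
Variables (f : {lrmorphism A -> B}) (fI : forall a, I a -> f a = 0).

Definition quotAlg_lift of (forall a, I a -> f a = 0) :=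
  fun x : quotAlg I => f (repr x).

Lemma quotAlg_liftE a : quotAlg_lift fI (quotAlg_pi I a) = f a.
Proof.
apply/esym/eqP; rewrite /quotAlg_lift -subr_eq0 -rmorphB.
exact/eqP/fI/quotAlg_repr.
Qed.

Fact quotAlg_lift_linear : linear (quotAlg_lift fI).
Proof.
move=> c x y; elim/quotAlg_ind: x => a; elim/quotAlg_ind: y => b.
by rewrite -quotAlg_piZ -quotAlg_piD !quotAlg_liftE linearP.
Qed.

Fact quotAlg_lift_monoid_morphism : monoid_morphism (quotAlg_lift fI).
Proof.
split=> [|x y]; first by rewrite -quotAlg_pi1 quotAlg_liftE rmorph1.
elim/quotAlg_ind: x => a; elim/quotAlg_ind: y => b.
by rewrite -quotAlg_piM !quotAlg_liftE rmorphM.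
Qed.

End Lift.

Variant Dgen := Dx1 | Dx2 | Du1 | Du2 | Dg | Dginv | Dzeta.

Definition Dgen_code (x : Dgen) : 'I_7 :=
  match x with
  | Dx1 => inord 0 | Dx2 => inord 1 | Du1 => inord 2 | Du2 => inord 3
  | Dg => inord 4 | Dginv => inord 5 | Dzeta => inord 6
  end.

Definition Dgen_decode (i : 'I_7) : Dgen :=
  nth Dzeta [:: Dx1; Dx2; Du1; Du2; Dg; Dginv; Dzeta] i.

Fact Dgen_codeK : cancel Dgen_code Dgen_decode.
Proof. by case; rewrite /Dgen_decode /= inordK. Qed.

HB.instance Definition _ := Countable.copy Dgen (can_type Dgen_codeK).

Definition Dodd (x : Dgen) : bool :=
  match x with Dx1 | Dx2 | Du1 | Du2 => true | Dg | Dginv | Dzeta => false end.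

Section Drel.
Variables (A : nzRingType) (gen : Dgen -> A).

Local Notation x1 := (gen Dx1).
Local Notation x2 := (gen Dx2).
Local Notation u1 := (gen Du1).
Local Notation u2 := (gen Du2).
Local Notation g := (gen Dg).
Local Notation ginv := (gen Dginv).
Local Notation zeta := (gen Dzeta).
Local Notation x21 := (x2 * x1 + x1 * x2).
Local Notation u21 := (u1 * u2 + u2 * u1).

Inductive Drel : A -> A -> Prop :=
| Drel_x1x1 : Drel (x1 * x1) 0
| Drel_x2x21 : Drel (x2 * x21) (x21 * x2 + x1 * x21)
| Drel_u1u1 : Drel (u1 * u1) 0
| Drel_u2u21 : Drel (u2 * u21) (u21 * u2 + u1 * u21)
| Drel_u1zeta : Drel (u1 * zeta) (zeta * u1 + u1)
| Drel_u2zeta : Drel (u2 * zeta) (zeta * u2 + u2)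
| Drel_zetax1 : Drel (zeta * x1) (x1 * zeta + x1)
| Drel_zetax2 : Drel (zeta * x2) (x2 * zeta + x2)
| Drel_gginv : Drel (g * ginv) 1
| Drel_ginvg : Drel (ginv * g) 1
| Drel_zetag : Drel (zeta * g) (g * zeta)
| Drel_gx1 : Drel (g * x1) (x1 * g)
| Drel_gx2 : Drel (g * x2) (x2 * g - x1 * g)
| Drel_u1g : Drel (u1 * g) (g * u1)
| Drel_u2g : Drel (u2 * g) (g * u2 - g * u1)
| Drel_u1x1 : Drel (u1 * x1) (- (x1 * u1))
| Drel_u1x2 : Drel (u1 * x2) (- (x2 * u1) + (1 - g))
| Drel_u2x1 : Drel (u2 * x1) (- (x1 * u2) + (1 - g) + x1 * u1)
| Drel_u2x2 : Drel (u2 * x2) (- (x2 * u2) + g * zeta + x2 * u1).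

Variable B : nzRingType.

Lemma Drel_counit (f : {rmorphism A -> B}) a b :
    (forall i, f (gen i) = match i with Dg | Dginv => 1 | _ => 0 end) ->
  Drel a b -> f a = f b.
Proof.
move=> fE.
by case; rewrite !(rmorphM, rmorphD, rmorphN, rmorph0, rmorph1) /= !fE
  ?(mulr0, mul0r, mulr1, subrr, oppr0, addr0).
Qed.

Section Parity.
Variables f s : {rmorphism A -> B}.
Hypothesis s_gen : forall i, s (gen i) = (-1) ^+ Dodd i * f (gen i).

Let homog (e : bool) (a : A) := s a = (-1) ^+ e * f a.

Let homog0 e : homog e 0.
Proof. by rewrite /homog !rmorph0 mulr0. Qed.

Let homog1 : homog false 1.
Proof. by rewrite /homog !rmorph1 mul1r. Qed.

Let homogN e a : homog e a -> homog e (- a).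
Proof. by rewrite /homog !rmorphN => ->; rewrite mulrN. Qed.

Let homogD e a b : homog e a -> homog e b -> homog e (a + b).
Proof. by rewrite /homog !rmorphD => -> ->; rewrite mulrDr. Qed.

Let homogM e1 e2 e a b :
  homog e1 a -> homog e2 b -> e1 (+) e2 = e -> homog e (a * b).
Proof.
rewrite /homog !rmorphM => -> -> <-; rewrite signr_addb.
by rewrite -!mulrA [f a * (_ * _)]mulrA commr_sign -mulrA.
Qed.

Let homog_gen i : homog (Dodd i) (gen i).
Proof. exact: s_gen. Qed.

Let homogMgen i j e :
  Dodd i (+) Dodd j = e -> homog e (gen i * gen j).
Proof. by apply: homogM; apply: homog_gen. Qed.

Lemma Drel_parity a b : Drel a b -> f a = f b -> s a = s b.
Proof.
move=> Rab fab; suff [e [ha hb]] : exists e, homog e a /\ homog e b.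
  by rewrite ha hb fab.
case: Rab; [
    exists false | exists true | exists false | exists true | exists true
  | exists true | exists true | exists true | exists false | exists false
  | exists false | exists true | exists true | exists true | exists true
  | exists false | exists false | exists false | exists false]; split;
  repeat first [exact: homog0 | exact: homog1 | exact: homog_gen
    | exact: homogMgen | apply: homogD | apply: homogN
    | apply: (homogM (e2 := false) (homog_gen _)) => //
    | apply: (homogM (e1 := false) _ (homog_gen _)) => //].
Qed.

End Parity.

End Drel.

Section Dtilde.
Variable k : fieldType.

Definition Dideal : ideal (freeAlg k Dgen) := relIdeal (Drel (@fgen k Dgen)).

Definition Dtilde := quotAlg Dideal.

HB.instance Definition _ := EqQuotient.on Dtilde.
HB.instance Definition _ := GRing.PzRing.on Dtilde.
HB.instance Definition _ := GRing.Lmodule.on Dtilde.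

Definition Dcounit_gen (x : Dgen) : k^o :=
  match x with Dg | Dginv => 1 | _ => 0 end.

Fact Dtilde_neq0 : 1 != 0 :> Dtilde.
Proof.
apply/quotAlg_neq0/(relIdeal_proper (rho := Dcounit_gen)) => a b.
by apply: (Drel_counit (f := feval Dcounit_gen)) => x; rewrite /= feval_gen.
Qed.

HB.instance Definition _ :=
  GRing.PzSemiRing_isNonZero.Build Dtilde Dtilde_neq0.
HB.instance Definition _ :=
  GRing.Lmodule_isLalgebra.Build k Dtilde (@quotAlg_scaleAl _ _ Dideal).
HB.instance Definition _ :=
  GRing.Lalgebra_isAlgebra.Build k Dtilde (@quotAlg_scaleAr _ _ Dideal).

Definition Dpi (a : freeAlg k Dgen) : Dtilde := quotAlg_pi Dideal a.

HB.instance Definition _ :=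
  GRing.isLinear.Build k (freeAlg k Dgen) Dtilde *:%R Dpi
    (quotAlg_pi_linear Dideal).
HB.instance Definition _ :=
  GRing.isMonoidMorphism.Build (freeAlg k Dgen) Dtilde Dpi
    (quotAlg_pi_monoid_morphism Dideal).

Lemma Dpi_rel a b : Drel (@fgen k Dgen) a b -> Dpi a = Dpi b.
Proof. by move=> Rab; apply/quotAlg_eq/mem_gen_ideal; exists a, b. Qed.

Definition Dparity_gen (x : Dgen) : Dtilde := (-1) ^+ Dodd x * Dpi (fgen k x).

Fact Dparity_ideal a : Dideal a -> feval Dparity_gen a = 0.
Proof.
apply: (gen_idealW (I := kernel (feval Dparity_gen))) => _ [b [c [Rbc ->]]] /=.
rewrite rmorphB /=; apply/eqP; rewrite subr_eq0; apply/eqP.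
apply: (Drel_parity (f := Dpi) (s := feval Dparity_gen) _ Rbc (Dpi_rel Rbc)).
by move=> x; rewrite /= feval_gen.
Qed.

(* The automorphism a |-> (-1)^|a| a, defined by its values on generators *)
Definition Dparity (a : Dtilde) : Dtilde := quotAlg_lift Dparity_ideal a.

HB.instance Definition _ :=
  GRing.isLinear.Build k Dtilde Dtilde *:%R Dparity
    (quotAlg_lift_linear Dparity_ideal).
HB.instance Definition _ :=
  GRing.isMonoidMorphism.Build Dtilde Dtilde Dparity
    (quotAlg_lift_monoid_morphism Dparity_ideal).

Lemma Dparity_pi a : Dparity (Dpi a) = feval Dparity_gen a.
Proof. exact: quotAlg_liftE. Qed.

Lemma Dparity_gen_pi x :
  Dparity (Dpi (fgen k x)) = (-1) ^+ Dodd x * Dpi (fgen k x).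
Proof. by rewrite Dparity_pi feval_gen. Qed.

Lemma DparityK : involutive Dparity.
Proof.
elim/quotAlg_ind => a; rewrite -/(Dpi a).
apply: (feval_ext (h1 := Dparity \o Dparity \o Dpi) (h2 := Dpi)) => x /=.
apply: etrans (congr1 Dparity (Dparity_gen_pi x)) _.
apply: etrans (rmorphM Dparity _ _) _; rewrite rmorph_sign.
by apply: etrans (congr1 _ (Dparity_gen_pi x)) _; apply: signrMK.
Qed.

End Dtilde.

Record algAction (gT : finGroupType) (k : fieldType) (A : algType k) := AlgAction {
  algact :> gT -> {lrmorphism A -> A};
  algact1 : forall a, algact 1%g a = a;
  algactM : forall x y a, algact (x * y)%g a = algact x (algact y a) }.

(* The element \sum_x (f x) # x of A # k[gT] is the function f;
   (a # x) (b # y) = a * x(b) # x y *)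
Definition smash (gT : finGroupType) (k : fieldType) (A : algType k)
    (rho : algAction gT A) := {ffun gT -> A}.

Section Smash.
Variables (gT : finGroupType) (k : fieldType) (A : algType k).
Variable rho : algAction gT A.

HB.instance Definition _ := GRing.Lmodule.copy (smash rho) {ffun gT -> A}.

Implicit Types f h : smash rho.

Definition smash_one : smash rho := [ffun x => (x == 1%g)%:R].

Definition smash_mul f h : smash rho :=
  [ffun x => \sum_(y : gT) f y * rho y (h (y^-1 * x)%g)].

Fact smash_mulA : associative smash_mul.
Proof.
move=> f h l; apply/ffunP => x; rewrite !ffunE.
under [RHS]eq_bigr => y _ do rewrite ffunE mulr_suml.
rewrite exchange_big; apply: eq_bigr => y _ /=.
rewrite ffunE rmorph_sum mulr_sumr [RHS](reindex_inj (mulgI y)) /=.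
apply: eq_bigr => z _.
by rewrite rmorphM mulrA mulKg algactM invMg mulgA.
Qed.

Fact smash_mul1 : left_id smash_one smash_mul.
Proof.
move=> f; apply/ffunP => x; rewrite ffunE (bigD1 1%g) //= big1 => [|y /negPf y1].
  by rewrite ffunE eqxx mul1r algact1 invg1 mul1g addr0.
by rewrite ffunE y1 mul0r.
Qed.

Fact smash_mulr1 : right_id smash_one smash_mul.
Proof.
move=> f; apply/ffunP => x; rewrite ffunE (bigD1 x) //= big1 => [|y yx].
  by rewrite ffunE mulVg eqxx rmorph1 mulr1 addr0.
rewrite ffunE -(inj_eq (mulgI y)) mulKVg mulg1 eq_sym (negPf yx).
by rewrite rmorph0 mulr0.
Qed.

Fact smash_mulDl : left_distributive smash_mul +%R.
Proof.
move=> f h l; apply/ffunP => x; rewrite !ffunE -big_split.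
by apply: eq_bigr => y _; rewrite ffunE mulrDl.
Qed.

Fact smash_mulDr : right_distributive smash_mul +%R.
Proof.
move=> f h l; apply/ffunP => x; rewrite !ffunE -big_split.
by apply: eq_bigr => y _; rewrite ffunE rmorphD mulrDr.
Qed.

Fact smash_neq0 : smash_one != 0.
Proof.
apply/eqP => /ffunP /(_ 1%g) /eqP; rewrite !ffunE eqxx.
by rewrite oner_eq0.
Qed.

HB.instance Definition _ := GRing.Zmodule_isNzRing.Build (smash rho)
  smash_mulA smash_mul1 smash_mulr1 smash_mulDl smash_mulDr smash_neq0.

Fact smash_scaleAl c f h : c *: (f * h) = (c *: f) * h.
Proof.
apply/ffunP => x; rewrite !ffunE scaler_sumr.
by apply: eq_bigr => y _; rewrite ffunE scalerAl.
Qed.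

Fact smash_scaleAr c f h : c *: (f * h) = f * (c *: h).
Proof.
apply/ffunP => x; rewrite !ffunE scaler_sumr.
by apply: eq_bigr => y _; rewrite ffunE linearZ scalerAr.
Qed.

HB.instance Definition _ :=
  GRing.Lmodule_isLalgebra.Build k (smash rho) smash_scaleAl.
HB.instance Definition _ :=
  GRing.Lalgebra_isAlgebra.Build k (smash rho) smash_scaleAr.

End Smash.

Section Double.
Variable k : fieldType.

(* 'Z_2, with its additive group structure, is the group C_2 *)
Definition C2act (i : 'Z_2) : {lrmorphism Dtilde k -> Dtilde k} :=
  if i == 0 then GRing.LRMorphism.clone _ _ _ _ idfun _
  else GRing.LRMorphism.clone _ _ _ _ (@Dparity k) _.

Fact C2act1 a : C2act 1%g a = a.
Proof. by []. Qed.

Fact C2actM i j a : C2act (i * j)%g a = C2act i (C2act j a).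
Proof.
have C2P (x : 'Z_2) : x = 0 \/ x = 1.
  by case: x => [[|[|]]] //= ?; [left | right]; apply: val_inj.
by case: (C2P i) => ->; case: (C2P j) => ->; rewrite /C2act //= DparityK.
Qed.

Definition Dpar_action : algAction 'Z_2 (Dtilde k) := AlgAction C2act1 C2actM.

Definition Ddouble := smash Dpar_action.

HB.instance Definition _ := GRing.Algebra.on Ddouble.

End Double.

Record filtration (k : fieldType) (A : algType k) := Filtration {
  fil :> nat -> A -> Prop;
  fil0 : forall n, fil n 0;
  filP : forall n c a b, fil n a -> fil n b -> fil n (c *: a + b);
  filS : forall n a, fil n a -> fil n.+1 a;
  fil1 : fil 0%N 1;
  filM : forall m n a b, fil m a -> fil n b -> fil (m + n)%N (a * b) }.

Definition exhaustive (k : fieldType) (A : algType k) (F : filtration A) :=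
  forall a : A, exists n, F n a.

Section Graded.
Variables (k : fieldType) (A : algType k) (F : filtration A).

(* The Rees algebra, whose underlying space is the direct sum of the F_n;
   the n-th component of a polynomial is its n-th coefficient *)
Definition rees_pred (p : {poly A}) : bool := `[< forall n, F n p`_n >].

Let filN n a : F n a -> F n (- a).
Proof. by rewrite -scaleN1r -[_ *: a]addr0 => /filP; apply; apply: fil0. Qed.

Let filD n a b : F n a -> F n b -> F n (a + b).
Proof. by rewrite -[a in F n (a + _)]scale1r; apply: filP. Qed.

Let filZ n c a : F n a -> F n (c *: a).
Proof. by rewrite -[c *: a]addr0 => /filP; apply; apply: fil0. Qed.

Let fil_sum n (I : Type) (r : seq I) (P : pred I) (E : I -> A) :
  (forall i, P i -> F n (E i)) -> F n (\sum_(i <- r | P i) E i).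
Proof. by move=> h; apply: (big_ind (F n)); [exact: fil0 | exact: filD |]. Qed.

Fact rees_subring_closed : subring_closed rees_pred.
Proof.
split=> [|p q /asboolP hp /asboolP hq|p q /asboolP hp /asboolP hq].
- apply/asboolP => -[|n]; rewrite coef1; [exact: fil1 | exact: fil0].
- by apply/asboolP => n; rewrite coefB; apply: filD => //; apply: filN.
- apply/asboolP => n; rewrite coefM; apply: fil_sum => i _.
  by rewrite -{1}(subnKC (ltnSE (ltn_ord i))); apply: filM.
Qed.

HB.instance Definition _ :=
  GRing.isSubringClosed.Build {poly A} rees_pred rees_subring_closed.

Record rees := Rees { rees_val : {poly A}; _ : rees_pred rees_val }.

HB.instance Definition _ := [isSub for rees_val].
HB.instance Definition _ := [Choice of rees by <:].
HB.instance Definition _ := [SubChoice_isSubNzRing of rees by <:].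

Fact rees_scale_subproof (c : k) (p : rees) :
  rees_pred (c%:A *: rees_val p).
Proof.
case: p => p /= /asboolP hp; apply/asboolP => n.
by rewrite coefZ mulr_algl; apply: filZ.
Qed.

Definition rees_scale c p : rees := Rees (rees_scale_subproof c p).

Fact rees_scaleA c d p : rees_scale c (rees_scale d p) = rees_scale (c * d) p.
Proof. by apply: val_inj; rewrite /= scalerA mulr_algl scalerA. Qed.
Fact rees_scale1 : left_id 1 rees_scale.
Proof. by move=> p; apply: val_inj; rewrite /= scale1r scale1r. Qed.
Fact rees_scaleDr : right_distributive rees_scale +%R.
Proof. by move=> c p q; apply: val_inj; rewrite /= scalerDr. Qed.
Fact rees_scaleDl p : {morph rees_scale^~ p : c d / c + d}.
Proof. by move=> c d; apply: val_inj; rewrite /= scalerDl scalerDl. Qed.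

HB.instance Definition _ := GRing.Zmodule_isLmodule.Build k rees
  rees_scaleA rees_scale1 rees_scaleDr rees_scaleDl.

Fact rees_scaleAl (c : k) (p q : rees) : c *: (p * q) = (c *: p) * q.
Proof. by apply: val_inj; rewrite /= scalerAl. Qed.
Fact rees_scaleAr (c : k) (p q : rees) : c *: (p * q) = p * (c *: q).
Proof.
apply: val_inj => /=; apply/polyP => n; rewrite coefZ !coefM mulr_sumr.
by apply: eq_bigr => i _; rewrite coefZ !mulr_algl scalerAr.
Qed.

HB.instance Definition _ := GRing.Lmodule_isLalgebra.Build k rees rees_scaleAl.
HB.instance Definition _ := GRing.Lalgebra_isAlgebra.Build k rees rees_scaleAr.

(* F_(n-1), with F_(-1) = 0 *)
Definition fil_pred (n : nat) (a : A) : Prop :=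
  if n is m.+1 then F m a else a = 0.

(* The direct sum of the F_(n-1), as an ideal of the direct sum of the F_n *)
Definition gr_mem (p : rees) : Prop := forall n, fil_pred n (rees_val p)`_n.

Let fil_predD n a b : fil_pred n a -> fil_pred n b -> fil_pred n (a + b).
Proof. by case: n => [/= -> ->|n]; [rewrite addr0 | apply: filD]. Qed.

Let fil_pred_sum n (I : Type) (r : seq I) (P : pred I) (E : I -> A) :
  (forall i, P i -> fil_pred n (E i)) -> fil_pred n (\sum_(i <- r | P i) E i).
Proof.
move=> h; apply: (big_ind (fil_pred n)); [|exact: fil_predD|exact: h].
by case: n {h} => //= n; apply: fil0.
Qed.

Let fil_predMl m n a b : F m a -> fil_pred n b -> fil_pred (m + n) (a * b).
Proof.
case: n => [_ /= ->|n ha hb]; last by rewrite addnS; apply: filM.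
by rewrite mulr0; case: (m + 0)%N => //= n; apply: fil0.
Qed.

Let fil_predMr m n a b : fil_pred m a -> F n b -> fil_pred (m + n) (a * b).
Proof.
case: m => [/= -> _|m ha hb]; last by rewrite addSn; apply: filM.
by rewrite mul0r; case: n => //= n; apply: fil0.
Qed.

Fact gr_mem0 : gr_mem 0.
Proof. by move=> n; rewrite coef0; case: n => //= n; apply: fil0. Qed.
Fact gr_memD p q : gr_mem p -> gr_mem q -> gr_mem (p + q).
Proof. by move=> hp hq n; rewrite coefD; apply: fil_predD. Qed.
Fact gr_memMl p q : gr_mem q -> gr_mem (p * q).
Proof.
move=> hq n; have /asboolP hp := valP p; rewrite coefM; apply: fil_pred_sum => i _.
by rewrite -{1}(subnKC (ltnSE (ltn_ord i))); apply: fil_predMl.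
Qed.
Fact gr_memMr p q : gr_mem p -> gr_mem (p * q).
Proof.
move=> hp n; have /asboolP hq := valP q; rewrite coefM; apply: fil_pred_sum => i _.
by rewrite -{1}(subnKC (ltnSE (ltn_ord i))); apply: fil_predMr.
Qed.

Definition gr_ideal : ideal rees := Ideal gr_mem0 gr_memD gr_memMl gr_memMr.

(* The direct sum of the F_n / F_(n-1) *)
Definition gr := quotAlg gr_ideal.

HB.instance Definition _ := EqQuotient.on gr.
HB.instance Definition _ := GRing.PzRing.on gr.
HB.instance Definition _ := GRing.Lmodule.on gr.

Fact gr_neq0 : 1 != 0 :> gr.
Proof.
apply: quotAlg_neq0 => /(_ 0%N) /=; rewrite coef1 => /eqP.
by rewrite oner_eq0.
Qed.

HB.instance Definition _ := GRing.PzSemiRing_isNonZero.Build gr gr_neq0.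
HB.instance Definition _ :=
  GRing.Lmodule_isLalgebra.Build k gr (@quotAlg_scaleAl _ _ gr_ideal).
HB.instance Definition _ :=
  GRing.Lalgebra_isAlgebra.Build k gr (@quotAlg_scaleAr _ _ gr_ideal).

End Graded.

(* k[X_0, ..., X_(n-1), T, T'] / (T T' - 1), where T and T' are the last two of
   the n + 2 variables; here {mpoly _[_]} is the notation of monalg *)
Section Laurent.

Let rmorph_subM1 (R S : pzRingType) (f : {rmorphism R -> S}) a b :
  f a = 1 -> f b = 1 -> f (a * b - 1) = 0.
Proof. by move=> ha hb; rewrite rmorphB rmorphM ha hb rmorph1 mulr1 subrr. Qed.

Variables (k : fieldType) (n : nat).

Definition lvar (i : 'I_(n + 2)) : {mpoly k[n + 2]} := << ucm i >>.

Definition laurent_ideal : ideal {mpoly k[n + 2]} :=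
  gen_ideal (fun f =>
    f = lvar (rshift n ord0) * lvar (rshift n ord_max) - 1).

Definition laurent := quotAlg laurent_ideal.

HB.instance Definition _ := EqQuotient.on laurent.
HB.instance Definition _ := GRing.PzRing.on laurent.
HB.instance Definition _ := GRing.Lmodule.on laurent.

Let mon1 (m : 'X_{1..n + 2}) : k := 1.

Let mon1_mmorphism : mmorphism mon1.
Proof. by split=> // u v; rewrite /mon1 mulr1. Qed.

HB.instance Definition _ := isMultiplicative.Build _ _ mon1 mon1_mmorphism.

Fact laurent_neq0 : 1 != 0 :> laurent.
Proof.
apply/quotAlg_neq0/(gen_ideal_proper
  (f := mmap idfun mon1 : {rmorphism {mpoly k[n + 2]} -> k})) => _ ->.
have e i : mmap idfun mon1 (lvar i) = 1 by rewrite mmapU mulr1.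
exact: rmorph_subM1 (e _) (e _).
Qed.

HB.instance Definition _ := GRing.PzSemiRing_isNonZero.Build laurent laurent_neq0.
HB.instance Definition _ :=
  GRing.Lmodule_isLalgebra.Build k laurent (@quotAlg_scaleAl _ _ laurent_ideal).
HB.instance Definition _ :=
  GRing.Lalgebra_isAlgebra.Build k laurent (@quotAlg_scaleAr _ _ laurent_ideal).

End Laurent.

(* T(V) / (v^2 : v in V), where V has the basis Y_0, ..., Y_(n-1) *)
Section Exterior.
Variables (k : fieldType) (n : nat).

Definition ext_ideal : ideal (freeAlg k 'I_n) :=
  gen_ideal (fun f => exists c : 'I_n -> k, f = (\sum_i c i *: fgen k i) ^+ 2).

Definition exterior := quotAlg ext_ideal.

HB.instance Definition _ := EqQuotient.on exterior.
HB.instance Definition _ := GRing.PzRing.on exterior.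
HB.instance Definition _ := GRing.Lmodule.on exterior.

Fact exterior_neq0 : 1 != 0 :> exterior.
Proof.
apply/quotAlg_neq0/(gen_ideal_proper (f := feval (fun=> 0 : k^o))) => _ [c ->].
rewrite rmorphXn rmorph_sum /= big1 ?expr0n // => i _.
by rewrite linearZ /= feval_gen scaler0.
Qed.

HB.instance Definition _ :=
  GRing.PzSemiRing_isNonZero.Build exterior exterior_neq0.
HB.instance Definition _ :=
  GRing.Lmodule_isLalgebra.Build k exterior (@quotAlg_scaleAl _ _ ext_ideal).
HB.instance Definition _ :=
  GRing.Lalgebra_isAlgebra.Build k exterior (@quotAlg_scaleAr _ _ ext_ideal).

End Exterior.

(* The tensor product is generated by the symbols a (x) b, subject to
   bilinearity and to (a (x) b) (a' (x) b') = a a' (x) b b' *)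
Section Tensor.
Variables (k : fieldType) (A B : algType k).

Definition tsym (a : A) (b : B) : freeAlg k (A * B)%type := fgen k (a, b).

Inductive tensor_rel : freeAlg k (A * B)%type -> freeAlg k (A * B)%type -> Prop :=
| TensorDl a a' b : tensor_rel (tsym (a + a') b) (tsym a b + tsym a' b)
| TensorDr a b b' : tensor_rel (tsym a (b + b')) (tsym a b + tsym a b')
| TensorZl c a b : tensor_rel (tsym (c *: a) b) (c *: tsym a b)
| TensorZr c a b : tensor_rel (tsym a (c *: b)) (c *: tsym a b)
| TensorM a a' b b' :
    tensor_rel (tsym a b * tsym a' b') (tsym (a * a') (b * b'))
| Tensor1 : tensor_rel (tsym 1 1) 1.

Definition tensor := quotAlg (relIdeal tensor_rel).

HB.instance Definition _ := EqQuotient.on tensor.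
HB.instance Definition _ := GRing.PzRing.on tensor.
HB.instance Definition _ := GRing.Lmodule.on tensor.

End Tensor.

Definition left_ideal (R : pzRingType) (J : R -> Prop) : Prop :=
  [/\ J 0, forall a b, J a -> J b -> J (a + b) & forall a b, J b -> J (a * b)].

Definition left_noetherian (R : pzRingType) : Prop :=
  forall J : nat -> R -> Prop,
    (forall n, left_ideal (J n)) -> (forall n a, J n a -> J n.+1 a) ->
  exists N, forall n a, (N <= n)%N -> J n a -> J N a.

Definition noetherian (R : pzRingType) : Prop :=
  left_noetherian R /\ left_noetherian R^c.

(* The polynomial f has noncommuting variables indexed by nat *)
Definition PI_algebra (k : fieldType) (A : algType k) : Prop :=
  exists2 f : freeAlg k nat, f != 0 & forall rho : nat -> A, feval rho f = 0.

(* Main.v *)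
From Stdlib Require Import Ncring Ncring_tac Setoid.
Require Import Defs.
From HB Require Import structures.
From mathcomp Require Import all_boot all_fingroup all_algebra.
From mathcomp Require Import finmap ring boolp functions.
From mathcomp.multinomials Require Import monalg.

Set Implicit Arguments.
Unset Strict Implicit.
Unset Printing Implicit Defensive.

Import GRing.Theory.
Local Open Scope ring_scope.

(** The element v2 = u2 + zeta u1 makes the presentation symmetric.  Writing
    v1 = u1, the mixed anticommutators become {v1,x1} = 0,
    {v1,x2} = {v2,x1} = 1 - g and {v2,x2} = zeta, so that exchanging x_i with
    v_i and fixing g and zeta is an anti-automorphism ([double_rel_op]); half
    of the computations below is deduced from the other half in this way.
    Put z = {x1,x2}, w = {v1,v2}, y = x2^2 and u = v2^2.

    Part (i).  Take the eleven letters g, g^-1, zeta, z, w, y, u (even) and x1,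
    v1, x2, v2 (odd), with weight 0 for g and g^-1, weight 1 for zeta, x1, v1,
    weight 2 for z, w, x2, v2 and weight 3 for y, u.  The weights are chosen so
    that the supercommutator of two letters, and the square of an odd letter,
    is a combination of words lighter than the product of the two letters
    ([defect]).  Hence the classes of the letters in the graded algebra of the
    filtration by the weight of words satisfy the relations of
    k[X_1, ..., X_5, T, T^-1] (x) Lambda(Y_1, ..., Y_4); this gives a
    surjection [tensor_to_gr] from the tensor product, both sides being spanned
    by the ordered monomials g^i z^b w^d x1^a v1^e y^n x2^r u^m v2^q zeta^j.
    It is injective because the monomials are independent in the graded
    algebra ([gr_mon_independent]).  That rests on coordinate functionals
    [tcoord] on the double that are dual to the monomials.  They come from a
    representation: were the monomials known to be a basis, the double would act
    by transposed left multiplication on the functions of the exponents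
    (i, b, d, a, e, n, r, m, q) with values in k[zeta]; the formulas for this
    action are written down a priori, and the defining relations are checked on
    them ([operator_rel]).

    Part (ii).  Hilbert's basis theorem holds for a subring P and an element t
    such that tP is contained in Pt + P and Pt in tP + P
    ([extension_noetherian]).  The powers of t may be dependent over P, as they
    are for t = x1, where t^2 = 0.  Adjoining g, g^-1, zeta, x1, v1, z, w, x2,
    v2 to k in this order, and then the parity element epsilon, yields the left
    noetherian property; the right one is the left one of the opposite algebra,
    which has the same presentation.

    Part (iii).  In characteristic p, y^p t = t y^p + ad(y)^p(t)
    ([leibniz_p]).  It makes g^p, z^p, w^p, y^p, u^p and zeta^p - zeta central,
    so that finitely many ordered monomials span the double over its center.
    An alternating multilinear function of more arguments than there are
    generators vanishes, and the standard polynomial is such a function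
    ([finite_over_center_PI]). *)

(** * The symmetric presentation *)

Section NoncommutativeRing.
Variable A : pzRingType.

(** The tactic for noncommutative rings finds the operations of a ring through
    an instance of its own operation class. *)
Definition ncops :
  @Ring_ops A 0 1 +%R *%R (fun a b => a - b) -%R eq := Build_Ring_ops _ _ _ _ _ _ _.

Fact ncring : Ring (Ro := ncops).
Proof.
split=> //.
- exact: eq_equivalence.
- by move=> ? ? -> ? ? ->.
- by move=> ? ? -> ? ? ->.
- by move=> ? ? -> ? ? ->.
- by move=> ? ? ->.
- exact: add0r.
- exact: addrC.
- exact: addrA.
- exact: mul1r.
- exact: mulr1.
- exact: mulrA.
- exact: mulrDl.
- by move=> x y z; apply: mulrDr.
- exact: addrN.
Qed.

End NoncommutativeRing.

#[local] Existing Instance ncops.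
#[local] Existing Instance ncring.

Ltac ncr := non_commutative_ring.

(** The defining relations in terms of v1 = u1 and v2 = u2 + zeta u1, for
    arbitrary elements of a ring: the same facts are needed in the double, in
    its opposite and in the algebra of operators. *)
Record double_rel (A : pzRingType) (x1 x2 v1 v2 g gi zeta : A) : Prop :=
DoubleRel {
  rel_x1x1 : x1 * x1 = 0;
  rel_v1v1 : v1 * v1 = 0;
  rel_x2z : x2 * (x2 * x1 + x1 * x2) = (x2 * x1 + x1 * x2) * x2
              + x1 * (x2 * x1 + x1 * x2);
  rel_wv2 : (v1 * v2 + v2 * v1) * v2 = v2 * (v1 * v2 + v2 * v1)
              + (v1 * v2 + v2 * v1) * v1;
  rel_zetax1 : zeta * x1 = x1 * zeta + x1;
  rel_zetax2 : zeta * x2 = x2 * zeta + x2;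
  rel_v1zeta : v1 * zeta = zeta * v1 + v1;
  rel_v2zeta : v2 * zeta = zeta * v2 + v2;
  rel_gx1 : g * x1 = x1 * g;
  rel_gx2 : g * x2 = x2 * g - x1 * g;
  rel_v1g : v1 * g = g * v1;
  rel_v2g : v2 * g = g * v2 - g * v1;
  rel_v1x1 : v1 * x1 = - (x1 * v1);
  rel_v1x2 : v1 * x2 = 1 - g - x2 * v1;
  rel_v2x1 : v2 * x1 = 1 - g - x1 * v2;
  rel_v2x2 : v2 * x2 = zeta - x2 * v2;
  rel_gzeta : zeta * g = g * zeta;
  rel_ggi : g * gi = 1;
  rel_gig : gi * g = 1 }.

(** Reversing products and exchanging x_i with v_i permutes the relations; a
    statement about the double thus has a mirror image, proved by the same
    lemma. *)
Lemma double_rel_op (A : pzRingType) (x1 x2 v1 v2 g gi zeta : A) :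
  double_rel x1 x2 v1 v2 g gi zeta ->
  @double_rel A^c v1 v2 x1 x2 g gi zeta.
Proof. by case=> *; split. Qed.

Section Commutation.
Variables (A : pzRingType) (x1 x2 v1 v2 g gi zeta : A).
Hypothesis R : double_rel x1 x2 v1 v2 g gi zeta.
Local Notation z := (x2 * x1 + x1 * x2).
Local Notation w := (v1 * v2 + v2 * v1).
Local Notation y := (x2 * x2).
Local Notation u := (v2 * v2).

Let x221 : x2 * x2 * x1 = x1 * x2 * x2 + x1 * x2 * x1.
Proof.
transitivity (x2 * z - (z * x2 + x1 * z) + x1 * x2 * x2 + x1 * x2 * x1
  + x1 * x1 * x2); first by ncr.
by rewrite (rel_x2z R) (rel_x1x1 R); ncr.
Qed.

Let v122 : v1 * v2 * v2 = v2 * v2 * v1 + v1 * v2 * v1.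
Proof.
transitivity (w * v2 - (v2 * w + w * v1) + v2 * v2 * v1 + v1 * v2 * v1
  + v2 * (v1 * v1)); first by ncr.
by rewrite (rel_wv2 R) (rel_v1v1 R); ncr.
Qed.

Let under (a b r : A) : a * b = r -> forall p, p * a * b = p * r.
Proof. by move=> <- p; rewrite mulrA. Qed.

Let under3 (a b c r : A) : a * b * c = r -> forall p, p * a * b * c = p * r.
Proof. by move=> <- p; rewrite !mulrA. Qed.

Let rules := (rel_x1x1 R, rel_v1v1 R, rel_zetax1 R, rel_zetax2 R, rel_v1zeta R,
  rel_v2zeta R, rel_gx1 R, rel_gx2 R, rel_v1g R, rel_v2g R, rel_v1x1 R,
  rel_v1x2 R, rel_v2x1 R, rel_v2x2 R, rel_gzeta R, x221, v122).
Let rulesr := (under (rel_x1x1 R), under (rel_v1v1 R), under (rel_zetax1 R),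
  under (rel_zetax2 R), under (rel_v1zeta R), under (rel_v2zeta R),
  under (rel_gx1 R), under (rel_gx2 R), under (rel_v1g R), under (rel_v2g R),
  under (rel_v1x1 R), under (rel_v1x2 R), under (rel_v2x1 R),
  under (rel_v2x2 R), under (rel_gzeta R), under3 x221, under3 v122).

Local Ltac dnf := rewrite
  ?(mulrDl, mulrDr, mulrN, mulNr, mulr0, mul0r, mulr1, mul1r, mulrA, rules, rulesr);
  ncr.

Lemma rel_x1z : x1 * z = z * x1. Proof. dnf. Qed.
Lemma rel_zetaz : zeta * z = z * zeta + z + z. Proof. dnf. Qed.
Lemma rel_gz : g * z = z * g. Proof. dnf. Qed.
Lemma rel_yz : y * z = z * y + z * z. Proof. dnf. Qed.
Lemma rel_yx1 : y * x1 = x1 * y + x1 * z. Proof. dnf. Qed.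
Lemma rel_zetay : zeta * y = y * zeta + y + y. Proof. dnf. Qed.
Lemma rel_gy : g * y = y * g - z * g. Proof. dnf. Qed.
Lemma rel_v1z : v1 * z = z * v1. Proof. dnf. Qed.
Lemma rel_v2z : v2 * z = z * v2 + x1 + x1 * g. Proof. dnf. Qed.
Lemma rel_v1y : v1 * y = y * v1 + x1 * g. Proof. dnf. Qed.
Lemma rel_v2y : v2 * y = y * v2 + x2. Proof. dnf. Qed.
Lemma rel_wz : w * z = z * w. Proof. dnf. Qed.
Lemma rel_wy : w * y = y * w + 1 - g * g + x1 * g * v1. Proof. dnf. Qed.
Lemma rel_uz : u * z = z * u + 1 - g * g + x1 * g * v1. Proof. dnf. Qed.
Lemma rel_uy : u * y = y * u + zeta. Proof. dnf. Qed.
End Commutation.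

Section DualCommutation.
Variables (A : pzRingType) (x1 x2 v1 v2 g gi zeta : A).
Hypothesis R : double_rel x1 x2 v1 v2 g gi zeta.
Local Notation z := (x2 * x1 + x1 * x2).
Local Notation w := (v1 * v2 + v2 * v1).
Local Notation y := (x2 * x2).
Local Notation u := (v2 * v2).
Let Rc := double_rel_op R.

Lemma rel_wv1 : w * v1 = v1 * w. Proof. exact: rel_x1z Rc. Qed.
Lemma rel_wzeta : w * zeta = zeta * w + w + w. Proof. exact: rel_zetaz Rc. Qed.
Lemma rel_wg : w * g = g * w. Proof. exact: rel_gz Rc. Qed.
Lemma rel_wu : w * u = u * w + w * w. Proof. exact: rel_yz Rc. Qed.
Lemma rel_v1u : v1 * u = u * v1 + w * v1. Proof. exact: rel_yx1 Rc. Qed.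
Lemma rel_uzeta : u * zeta = zeta * u + u + u. Proof. exact: rel_zetay Rc. Qed.
Lemma rel_ug : u * g = g * u - g * w. Proof. exact: rel_gy Rc. Qed.
Lemma rel_wx1 : w * x1 = x1 * w. Proof. exact: rel_v1z Rc. Qed.
Lemma rel_wx2 : w * x2 = x2 * w + v1 + g * v1. Proof. exact: rel_v2z Rc. Qed.
Lemma rel_ux1 : u * x1 = x1 * u + g * v1. Proof. exact: rel_v1y Rc. Qed.
Lemma rel_ux2 : u * x2 = x2 * u + v2. Proof. exact: rel_v2y Rc. Qed.

End DualCommutation.

(** * Operators on tableaux *)

Section Operators.
Variables (S : comNzRingType) (s : S).

(** A tableau f stands for a right k[zeta]-linear map on the double: its value
    at (i, b, d, a, e, n, r, m, q) is the image of g^i z^b w^d x1^a v1^e y^n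
    x2^r u^m v2^q, and the ring element s is the action of zeta on S.  The
    operator of a letter l maps f to the map sending c to f (l c); its formula
    is found by moving l to its place in the monomial. *)
Definition tableau := int -> nat -> nat -> bool -> bool -> nat -> bool -> nat -> bool -> S.
Implicit Type f : tableau.

Definition op_g f : tableau := fun i b d a e n r m q => f (i + 1) b d a e n r m q.
Definition op_gi f : tableau := fun i b d a e n r m q => f (i - 1) b d a e n r m q.
(** Every factor of the monomial is an eigenvector of ad(zeta), with
    eigenvalue 0 for g, 2 for z and y, 1 for x1 and x2, and the opposite
    values for w, u, v1 and v2. *)
Definition op_zeta f : tableau := fun i b d a e n r m q =>
  (s + (b.*2 + a + n.*2 + r)%:R - (d.*2 + e + m.*2 + q)%:R) * f i b d a e n r m q.
Definition op_x1 f : tableau := fun i b d a e n r m q =>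
  if a then 0 else f i b d true e n r m q.
Definition op_v1 f : tableau := fun i b d a e n r m q =>
  if e then 0 else (-1) ^+ a * f i b d a true n r m q.
(** [tail_x2] and [tail_v2] are the effect of x2 and v2 on the last factors
    y^n x2^r u^m v2^q, after the earlier ones have been crossed. *)
Definition tail_x2 f : tableau := fun i b d a e n r m q =>
  if r then f i b d a e n.+1 false m q else f i b d a e n true m q.
Definition tail_v2 f : tableau := fun i b d a e n r m q =>
  let v2f := if q then f i b d a e n r m.+1 false else f i b d a e n r m true in
  if r then (s + n%:R - (m.*2 + q)%:R) * f i b d a e n false m q - v2f
  else v2f + n%:R * f i b d a e n.-1 true m q.
(** Moving x2 to the right costs, up to sign, a term for each factor crossed:
    z for x1, 1 - g for v1, x1 g for g, x1 z for z and v1 + g v1 for w.  The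
    coefficients i, b and d count the occurrences of g, z and w. *)
Definition op_x2 f : tableau := fun i b d a e n r m q =>
  (-1) ^+ (a + e) * tail_x2 f i b d a e n r m q
  + (if a then f i b.+1 d false e n r m q else 0)
  + (if e then (-1) ^+ a * (f i b d a false n r m q - f (i + 1) b d a false n r m q)
     else 0)
  + (i%:~R + b%:R) * op_x1 f i b d a e n r m q
  - d%:R * (op_v1 f i b d.-1 a e n r m q + op_v1 f (i + 1) b d.-1 a e n r m q).
(** As for [op_x2], with w for v1, 1 - g for x1, g v1 for g, w v1 for w and x1
    + x1 g for z. *)
Definition op_v2 f : tableau := fun i b d a e n r m q =>
  (-1) ^+ (a + e) * tail_v2 f i b d a e n r m q
  + (if e then (-1) ^+ a * f i b d.+1 a false n r m q else 0)
  + (if a then f i b d false e n r m q - f (i + 1) b d false e n r m q else 0)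
  - (i%:~R + d%:R) * op_v1 f i b d a e n r m q
  + b%:R * (op_x1 f i b.-1 d a e n r m q + op_x1 f (i + 1) b.-1 d a e n r m q).

(** z and w commute with g and with each other, and so reach their places at
    no cost. *)
Definition op_Z f : tableau := fun i b d a e n r m q => f i b.+1 d a e n r m q.
Definition op_W f : tableau := fun i b d a e n r m q => f i b d.+1 a e n r m q.

Local Ltac op_ring a e r q := case: a; case: e; case: r; case: q;
  rewrite /op_zeta /op_g /op_gi /op_x2 /op_v2 /tail_x2 /tail_v2 /op_x1 /op_v1 /op_Z /op_W
    /= -?muln2 ?subrK ?addrK //;
  repeat match goal with |- context [?x.-1] => is_var x; case: x => [|x] end;
  rewrite /= ?addrK ?subrK; ring.

Lemma op_zE f i b d a e n r m q :
  op_x1 (op_x2 f) i b d a e n r m q + op_x2 (op_x1 f) i b d a e n r m q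
  = op_Z f i b d a e n r m q.
Proof. op_ring a e r q. Qed.

Lemma op_wE f i b d a e n r m q :
  op_v2 (op_v1 f) i b d a e n r m q + op_v1 (op_v2 f) i b d a e n r m q
  = op_W f i b d a e n r m q.
Proof. op_ring a e r q. Qed.

Lemma op_x1x1 f i b d a e n r m q :
  op_x1 (op_x1 f) i b d a e n r m q
  = 0.
Proof. op_ring a e r q. Qed.

Lemma op_v1v1 f i b d a e n r m q :
  op_v1 (op_v1 f) i b d a e n r m q
  = 0.
Proof. op_ring a e r q. Qed.

Lemma op_x2z f i b d a e n r m q :
  op_Z (op_x2 f) i b d a e n r m q
  = op_x2 (op_Z f) i b d a e n r m q + op_Z (op_x1 f) i b d a e n r m q.
Proof. op_ring a e r q. Qed.

Lemma op_wv2 f i b d a e n r m q :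
  op_v2 (op_W f) i b d a e n r m q
  = op_W (op_v2 f) i b d a e n r m q + op_v1 (op_W f) i b d a e n r m q.
Proof. op_ring a e r q. Qed.

Lemma op_zetax1 f i b d a e n r m q :
  op_x1 (op_zeta f) i b d a e n r m q
  = op_zeta (op_x1 f) i b d a e n r m q + op_x1 f i b d a e n r m q.
Proof. op_ring a e r q. Qed.

Lemma op_zetax2 f i b d a e n r m q :
  op_x2 (op_zeta f) i b d a e n r m q
  = op_zeta (op_x2 f) i b d a e n r m q + op_x2 f i b d a e n r m q.
Proof. op_ring a e r q. Qed.

Lemma op_v1zeta f i b d a e n r m q :
  op_zeta (op_v1 f) i b d a e n r m q
  = op_v1 (op_zeta f) i b d a e n r m q + op_v1 f i b d a e n r m q.
Proof. op_ring a e r q. Qed.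

Lemma op_v2zeta f i b d a e n r m q :
  op_zeta (op_v2 f) i b d a e n r m q
  = op_v2 (op_zeta f) i b d a e n r m q + op_v2 f i b d a e n r m q.
Proof. op_ring a e r q. Qed.

Lemma op_gx1 f i b d a e n r m q :
  op_x1 (op_g f) i b d a e n r m q
  = op_g (op_x1 f) i b d a e n r m q.
Proof. op_ring a e r q. Qed.

Lemma op_gx2 f i b d a e n r m q :
  op_x2 (op_g f) i b d a e n r m q
  = op_g (op_x2 f) i b d a e n r m q - op_g (op_x1 f) i b d a e n r m q.
Proof. op_ring a e r q. Qed.

Lemma op_v1g f i b d a e n r m q :
  op_g (op_v1 f) i b d a e n r m q
  = op_v1 (op_g f) i b d a e n r m q.
Proof. op_ring a e r q. Qed.

Lemma op_v2g f i b d a e n r m q :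
  op_g (op_v2 f) i b d a e n r m q
  = op_v2 (op_g f) i b d a e n r m q - op_v1 (op_g f) i b d a e n r m q.
Proof. op_ring a e r q. Qed.

Lemma op_v1x1 f i b d a e n r m q :
  op_x1 (op_v1 f) i b d a e n r m q
  = - op_v1 (op_x1 f) i b d a e n r m q.
Proof. op_ring a e r q. Qed.

Lemma op_v1x2 f i b d a e n r m q :
  op_x2 (op_v1 f) i b d a e n r m q
  = f i b d a e n r m q - op_g f i b d a e n r m q - op_v1 (op_x2 f) i b d a e n r m q.
Proof. op_ring a e r q. Qed.

Lemma op_v2x1 f i b d a e n r m q :
  op_x1 (op_v2 f) i b d a e n r m q
  = f i b d a e n r m q - op_g f i b d a e n r m q - op_v2 (op_x1 f) i b d a e n r m q.
Proof. op_ring a e r q. Qed.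

Lemma op_v2x2 f i b d a e n r m q :
  op_x2 (op_v2 f) i b d a e n r m q
  = op_zeta f i b d a e n r m q - op_v2 (op_x2 f) i b d a e n r m q.
Proof. op_ring a e r q. Qed.

Lemma op_gzeta f i b d a e n r m q :
  op_g (op_zeta f) i b d a e n r m q
  = op_zeta (op_g f) i b d a e n r m q.
Proof. op_ring a e r q. Qed.

Lemma op_ggi f i b d a e n r m q :
  op_gi (op_g f) i b d a e n r m q
  = f i b d a e n r m q.
Proof. op_ring a e r q. Qed.

Lemma op_gig f i b d a e n r m q :
  op_g (op_gi f) i b d a e n r m q
  = f i b d a e n r m q.
Proof. op_ring a e r q. Qed.

End Operators.

(** * The algebra of operators *)

(** Linear endomorphisms, with the product of f and h being f followed by h:
    transposed multiplications compose in the reversed order. *)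
Record endo (k : fieldType) (W : lmodType k) :=
  Endo { endo_fun :> W -> W; endo_linear : linear endo_fun }.

Section Endo.
Variables (k : fieldType) (W : lmodType k).
Local Notation endo := (endo W).
Implicit Types f h : endo.

Lemma endoP f h : f =1 h -> f = h.
Proof.
case: f h => [f fl] [h hl] /= /funext e; case: _ / e in hl *.
by congr Endo; apply: Prop_irrelevance.
Qed.

HB.instance Definition _ := gen_eqMixin endo.
HB.instance Definition _ := gen_choiceMixin endo.

Fact endo_add_subproof f h : linear (fun x => f x + h x).
Proof.
by move=> c x y; rewrite !endo_linear scalerDr addrACA.
Qed.
Fact endo_zero_subproof : linear (fun _ : W => 0 : W).
Proof. by move=> c x y; rewrite scaler0 addr0. Qed.
Fact endo_opp_subproof f : linear (fun x => - f x).
Proof. by move=> c x y; rewrite endo_linear opprD scalerN. Qed.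
Fact endo_one_subproof : linear (fun x : W => x).
Proof. by []. Qed.
Fact endo_mul_subproof f h : linear (fun x => h (f x)).
Proof. by move=> c x y; rewrite !endo_linear. Qed.
Fact endo_scale_subproof (a : k) f : linear (fun x => a *: f x).
Proof. by move=> c x y; rewrite endo_linear scalerDr !scalerA mulrC. Qed.

Definition endo_add f h := Endo (endo_add_subproof f h).
Definition endo_zero := Endo endo_zero_subproof.
Definition endo_opp f := Endo (endo_opp_subproof f).
Definition endo_one := Endo endo_one_subproof.
Definition endo_mul f h := Endo (endo_mul_subproof f h).
Definition endo_scale a f := Endo (endo_scale_subproof a f).

Fact endo_addA : associative endo_add.
Proof. by move=> f h l; apply: endoP => x; apply: addrA. Qed.
Fact endo_addC : commutative endo_add.
Proof. by move=> f h; apply: endoP => x; apply: addrC. Qed.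
Fact endo_add0 : left_id endo_zero endo_add.
Proof. by move=> f; apply: endoP => x; apply: add0r. Qed.
Fact endo_addN : left_inverse endo_zero endo_opp endo_add.
Proof. by move=> f; apply: endoP => x; apply: addNr. Qed.

HB.instance Definition _ := GRing.isZmodule.Build endo
  endo_addA endo_addC endo_add0 endo_addN.

Fact endo_mulA : associative endo_mul. Proof. by move=> f h l; apply: endoP. Qed.
Fact endo_mul1 : left_id endo_one endo_mul. Proof. by move=> f; apply: endoP. Qed.
Fact endo_mulr1 : right_id endo_one endo_mul. Proof. by move=> f; apply: endoP. Qed.
Fact endo_mulDl : left_distributive endo_mul +%R.
Proof.
move=> f h l; apply: endoP => x /=.
by have := endo_linear l 1 (f x) (h x); rewrite !scale1r.
Qed.
Fact endo_mulDr : right_distributive endo_mul +%R.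
Proof. by move=> f h l; apply: endoP. Qed.

HB.instance Definition _ := GRing.Zmodule_isPzRing.Build endo
  endo_mulA endo_mul1 endo_mulr1 endo_mulDl endo_mulDr.

Fact endo_scaleA a c f : endo_scale a (endo_scale c f) = endo_scale (a * c) f.
Proof. by apply: endoP => x; apply: scalerA. Qed.
Fact endo_scale1 : left_id 1 endo_scale.
Proof. by move=> f; apply: endoP => x; apply: scale1r. Qed.
Fact endo_scaleDr : right_distributive endo_scale +%R.
Proof. by move=> a f h; apply: endoP => x; apply: scalerDr. Qed.
Fact endo_scaleDl f : {morph endo_scale^~ f : a c / a + c}.
Proof. by move=> a c; apply: endoP => x; apply: scalerDl. Qed.

HB.instance Definition _ := GRing.Zmodule_isLmodule.Build k endo
  endo_scaleA endo_scale1 endo_scaleDr endo_scaleDl.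

Lemma endo0 f : f 0 = 0.
Proof. by have := endo_linear f (-1) 0 0; rewrite scaler0 addr0 scaleN1r addNr. Qed.

Lemma endo_linE c f h x : (c *: f + h) x = c *: f x + h x.
Proof. by []. Qed.

Fact endo_scaleAl (c : k) f h : c *: (f * h) = (c *: f) * h.
Proof.
by apply: endoP => x /=; have := endo_linear h c (f x) 0; rewrite endo0 !addr0.
Qed.
Fact endo_scaleAr (c : k) f h : c *: (f * h) = f * (c *: h).
Proof. by apply: endoP. Qed.

End Endo.

Section Regular.
Variable k : fieldType.

(** Here zeta acts on the values, which are polynomials, as the variable 'X. *)
Definition ktableau := tableau {poly k}.
HB.instance Definition _ := GRing.Lmodule.copy ktableau
  (int -> nat -> nat -> bool -> bool -> nat -> bool -> nat -> bool -> {poly k}).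

Definition operator := endo ktableau.
HB.instance Definition _ := GRing.PzRing.on operator.
HB.instance Definition _ := GRing.Lmodule.on operator.

Fact operator_neq0 : 1 != 0 :> operator.
Proof.
apply/eqP => /(congr1 (fun f : operator => f (fun _ _ _ _ _ _ _ _ _ => 1))) /=.
move/(congr1 (fun f : ktableau => f 0 0%N 0%N false false 0%N false 0%N false)).
by move/eqP; rewrite oner_eq0.
Qed.

HB.instance Definition _ := GRing.PzSemiRing_isNonZero.Build operator operator_neq0.
HB.instance Definition _ :=
  GRing.Lmodule_isLalgebra.Build k operator (@endo_scaleAl k ktableau).
HB.instance Definition _ :=
  GRing.Lalgebra_isAlgebra.Build k operator (@endo_scaleAr k ktableau).

Implicit Type f : ktableau.

Lemma tableauP f h :
  (forall i b d a e n r m q, f i b d a e n r m q = h i b d a e n r m q) -> f = h.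
Proof. by move=> fh; do 9![apply: funext => ?]. Qed.

Fact tableau_lin c f h i b d a e n r m q :
  (c *: f + h) i b d a e n r m q
  = c%:P * f i b d a e n r m q + h i b d a e n r m q.
Proof. by rewrite mul_polyC. Qed.

Local Ltac op_linear a e r q := move=> c f h; apply: tableauP => i b d a e n r m q;
  rewrite tableau_lin /op_g /op_gi /op_zeta /op_x2 /op_v2 /op_x1 /op_v1
    /tail_x2 /tail_v2;
  case: a; case: e; case: r; case: q; rewrite /= ?tableau_lin; ring.

Fact op_g_linear : linear (@op_g {poly k} : ktableau -> ktableau).
Proof. by []. Qed.
Fact op_gi_linear : linear (@op_gi {poly k} : ktableau -> ktableau).
Proof. by []. Qed.
Fact op_zeta_linear : linear (@op_zeta {poly k} 'X : ktableau -> ktableau).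
Proof. op_linear a e r q. Qed.
Fact op_x1_linear : linear (@op_x1 {poly k} : ktableau -> ktableau).
Proof. op_linear a e r q. Qed.
Fact op_v1_linear : linear (@op_v1 {poly k} : ktableau -> ktableau).
Proof. op_linear a e r q. Qed.
Fact op_x2_linear : linear (@op_x2 {poly k} : ktableau -> ktableau).
Proof. op_linear a e r q. Qed.
Fact op_v2_linear : linear (@op_v2 {poly k} 'X : ktableau -> ktableau).
Proof. op_linear a e r q. Qed.

Definition rop_g : operator := Endo op_g_linear.
Definition rop_gi : operator := Endo op_gi_linear.
Definition rop_zeta : operator := Endo op_zeta_linear.
Definition rop_x1 : operator := Endo op_x1_linear.
Definition rop_v1 : operator := Endo op_v1_linear.
Definition rop_x2 : operator := Endo op_x2_linear.
Definition rop_v2 : operator := Endo op_v2_linear.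

Fact op_Z_linear : linear (@op_Z {poly k} : ktableau -> ktableau).
Proof. by []. Qed.
Fact op_W_linear : linear (@op_W {poly k} : ktableau -> ktableau).
Proof. by []. Qed.
Definition rop_z : operator := Endo op_Z_linear.
Definition rop_w : operator := Endo op_W_linear.

Local Ltac rop op := apply: endoP => f; apply: tableauP => i b d a e n r m q; exact: op.

Lemma rop_zE : rop_x2 * rop_x1 + rop_x1 * rop_x2 = rop_z.
Proof. rop op_zE. Qed.
Lemma rop_wE : rop_v1 * rop_v2 + rop_v2 * rop_v1 = rop_w.
Proof. rop op_wE. Qed.

(** The check that the double acts on tableaux.  Because products are
    reversed, a relation between operators reads from right to left as a
    composition. *)
Lemma operator_rel :
  double_rel rop_x1 rop_x2 rop_v1 rop_v2 rop_g rop_gi rop_zeta.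
Proof.
split; rewrite ?rop_zE ?rop_wE; [rop op_x1x1 | rop op_v1v1 | rop op_x2z
 | rop op_wv2 | rop op_zetax1 | rop op_zetax2 | rop op_v1zeta | rop op_v2zeta
 | rop op_gx1 | rop op_gx2 | rop op_v1g | rop op_v2g | rop op_v1x1 | rop op_v1x2
 | rop op_v2x1 | rop op_v2x2 | rop op_gzeta | rop op_ggi | rop op_gig].
Qed.

End Regular.

(** * The two presentations agree *)

Section Presentations.
Variables (A : nzRingType) (gen : Dgen -> A).
Local Notation x1 := (gen Dx1).
Local Notation x2 := (gen Dx2).
Local Notation u1 := (gen Du1).
Local Notation u2 := (gen Du2).
Local Notation g := (gen Dg).
Local Notation gi := (gen Dginv).
Local Notation zeta := (gen Dzeta).
Local Notation v2 := (u2 + zeta * u1).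

(** The element w is both {u1,v2} and {u1,u2}, since {u1, zeta u1} = (zeta u1
    + u1) u1 + zeta u1 u1 = 0. *)
Lemma Drel_double :
  (forall a b, Drel gen a b -> a = b) -> double_rel x1 x2 u1 v2 g gi zeta.
Proof.
move=> H; pose h := H _ _.
have h_x1x1 := h _ _ (Drel_x1x1 gen).
have h_x2x21 := h _ _ (Drel_x2x21 gen).
have h_u1u1 := h _ _ (Drel_u1u1 gen).
have h_u2u21 := h _ _ (Drel_u2u21 gen).
have h_u1zeta := h _ _ (Drel_u1zeta gen).
have h_u2zeta := h _ _ (Drel_u2zeta gen).
have h_zetag := h _ _ (Drel_zetag gen).
have h_u1g := h _ _ (Drel_u1g gen).
have h_u2g := h _ _ (Drel_u2g gen).
have h_u1x1 := h _ _ (Drel_u1x1 gen).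
have h_u1x2 := h _ _ (Drel_u1x2 gen).
have h_u2x1 := h _ _ (Drel_u2x1 gen).
have h_u2x2 := h _ _ (Drel_u2x2 gen).
have h_zetax1 := h _ _ (Drel_zetax1 gen).
have h_zetax2 := h _ _ (Drel_zetax2 gen).
have wE : u1 * v2 + v2 * u1 = u1 * u2 + u2 * u1.
  transitivity (u1 * u2 + u2 * u1 + (u1 * zeta) * u1 + zeta * (u1 * u1)).
    by ncr.
  by rewrite h_u1zeta mulrDl -mulrA h_u1u1; ncr.
have w_u1 : (u1 * u2 + u2 * u1) * u1 = u1 * (u1 * u2 + u2 * u1).
  transitivity (u1 * u2 * u1 + u2 * (u1 * u1)); first by ncr.
  rewrite h_u1u1; transitivity (u1 * u2 * u1 + (u1 * u1) * u2); last by ncr.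
  by rewrite h_u1u1; ncr.
have w_zeta : (u1 * u2 + u2 * u1) * zeta
    = zeta * (u1 * u2 + u2 * u1) + (u1 * u2 + u2 * u1) + (u1 * u2 + u2 * u1).
  transitivity (u1 * (u2 * zeta) + u2 * (u1 * zeta)); first by ncr.
  rewrite h_u1zeta h_u2zeta.
  transitivity ((u1 * zeta) * u2 + u1 * u2 + (u2 * zeta) * u1 + u2 * u1).
    by ncr.
  by rewrite h_u1zeta h_u2zeta; ncr.
split; rewrite ?wE //.
- set W := u1 * u2 + u2 * u1 in h_u2u21 w_u1 w_zeta *.
  transitivity (W * u2 + (W * zeta) * u1); first by ncr.
  transitivity (u2 * W + zeta * (u1 * W) + W * u1); last by ncr.
  (* The remaining terms match because w = {u1,u2} commutes with u1. *)
  rewrite w_zeta h_u2u21 -w_u1.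
  by ncr.
- transitivity (u2 * zeta + zeta * (u1 * zeta)); first by ncr.
  by rewrite h_u1zeta h_u2zeta; ncr.
- exact: (h _ _ (Drel_gx1 gen)).
- exact: (h _ _ (Drel_gx2 gen)).
- transitivity (u2 * g + zeta * (u1 * g)); first by ncr.
  rewrite h_u1g h_u2g; transitivity (g * u2 - g * u1 + (zeta * g) * u1); first by ncr.
  by rewrite h_zetag; ncr.
- by rewrite h_u1x2; ncr.
- transitivity (u2 * x1 + zeta * (u1 * x1)); first by ncr.
  rewrite h_u2x1 h_u1x1.
  transitivity (- (x1 * u2) + (1 - g) + x1 * u1 - (zeta * x1) * u1); first by ncr.
  by rewrite h_zetax1; ncr.
- transitivity (u2 * x2 + zeta * (u1 * x2)); first by ncr.
  rewrite h_u2x2 h_u1x2.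
  transitivity (- (x2 * u2) + g * zeta + x2 * u1 - (zeta * x2) * u1 + zeta - zeta * g).
    by ncr.
  by rewrite h_zetax2 h_zetag; ncr.
- exact: (h _ _ (Drel_gginv gen)).
- exact: (h _ _ (Drel_ginvg gen)).
Qed.

Lemma double_Drel : double_rel x1 x2 u1 v2 g gi zeta ->
  forall a b, Drel gen a b -> a = b.
Proof.
have : u2 = v2 - zeta * u1 by ncr.
move: v2 => v u2E R.
have wE : u1 * u2 + u2 * u1 = u1 * v + v * u1.
  transitivity (u1 * v + v * u1 - (u1 * zeta) * u1 - zeta * (u1 * u1)).
    by rewrite u2E; ncr.
  by rewrite (rel_v1zeta R) mulrDl -mulrA (rel_v1v1 R); ncr.
have w_zeta := rel_wzeta R; have w_u1 := rel_wv1 R; have w_v := rel_wv2 R.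
have v_zeta := rel_v2zeta R; have u1_zeta := rel_v1zeta R.
have v_g := rel_v2g R; have u1_g := rel_v1g R; have zeta_g := rel_gzeta R.
have v_x1 := rel_v2x1 R; have u1_x1 := rel_v1x1 R; have zeta_x1 := rel_zetax1 R.
have v_x2 := rel_v2x2 R; have u1_x2 := rel_v1x2 R; have zeta_x2 := rel_zetax2 R.
move=> a b; case; rewrite ?wE ?u2E; try by case: R.
- set W := u1 * v + v * u1 in w_zeta w_u1 w_v *.
  transitivity (v * W - zeta * (u1 * W)); first by ncr.
  transitivity (W * v - (W * zeta) * u1 + u1 * W); last by ncr.
  rewrite w_zeta w_v -w_u1.
  by ncr.
- transitivity (v * zeta - zeta * (u1 * zeta)); first by ncr.
  by rewrite v_zeta u1_zeta; ncr.
- transitivity (v * g - zeta * (u1 * g)); first by ncr.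
  rewrite v_g u1_g.
  by transitivity (g * v - g * u1 - (zeta * g) * u1); [ncr | rewrite zeta_g; ncr].
- by rewrite u1_x2; ncr.
- transitivity (v * x1 - zeta * (u1 * x1)); first by ncr.
  rewrite v_x1 u1_x1.
  by transitivity (1 - g - x1 * v + (zeta * x1) * u1); [ncr | rewrite zeta_x1; ncr].
- transitivity (v * x2 - zeta * (u1 * x2)); first by ncr.
  rewrite v_x2 u1_x2.
  transitivity (zeta * g - x2 * v + (zeta * x2) * u1); first by ncr.
  by rewrite zeta_x2 zeta_g; ncr.
Qed.
End Presentations.

Lemma Drel_morph (A B : nzRingType) (f : {rmorphism A -> B}) (gen : Dgen -> A) a b :
  Drel gen a b -> Drel (fun i => f (gen i)) (f a) (f b).
Proof.
by case; rewrite !(rmorphM, rmorphD, rmorphN, rmorph0, rmorph1) /=; constructor.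
Qed.

(** Turns a relation between images of generators, as [Drel_double] asks for,
    into the image of a relation imposed on the free algebra. *)
Lemma Drel_lift (A B : nzRingType) (f : {rmorphism A -> B}) (gen : Dgen -> A) a b :
  Drel (fun i => f (gen i)) a b -> exists a' b', [/\ Drel gen a' b', a = f a' & b = f b'].
Proof.
move=> ab; case: ab;
[ do 2 eexists; split; first exact: (Drel_x1x1 gen)
| do 2 eexists; split; first exact: (Drel_x2x21 gen)
| do 2 eexists; split; first exact: (Drel_u1u1 gen)
| do 2 eexists; split; first exact: (Drel_u2u21 gen)
| do 2 eexists; split; first exact: (Drel_u1zeta gen)
| do 2 eexists; split; first exact: (Drel_u2zeta gen)
| do 2 eexists; split; first exact: (Drel_zetax1 gen)
| do 2 eexists; split; first exact: (Drel_zetax2 gen)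
| do 2 eexists; split; first exact: (Drel_gginv gen)
| do 2 eexists; split; first exact: (Drel_ginvg gen)
| do 2 eexists; split; first exact: (Drel_zetag gen)
| do 2 eexists; split; first exact: (Drel_gx1 gen)
| do 2 eexists; split; first exact: (Drel_gx2 gen)
| do 2 eexists; split; first exact: (Drel_u1g gen)
| do 2 eexists; split; first exact: (Drel_u2g gen)
| do 2 eexists; split; first exact: (Drel_u1x1 gen)
| do 2 eexists; split; first exact: (Drel_u1x2 gen)
| do 2 eexists; split; first exact: (Drel_u2x1 gen)
| do 2 eexists; split; first exact: (Drel_u2x2 gen) ];
by rewrite !(rmorphM, rmorphD, rmorphN, rmorph0, rmorph1).
Qed.

Section Generators.
Variable k : fieldType.
Local Notation A := (Dtilde k).

Definition Dgenerator (i : Dgen) : A := Dpi (fgen k i).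

Definition tx1 : A := Dgenerator Dx1.
Definition tx2 : A := Dgenerator Dx2.
Definition tv1 : A := Dgenerator Du1.
Definition tv2 : A := Dgenerator Du2 + Dgenerator Dzeta * Dgenerator Du1.
Definition tg : A := Dgenerator Dg.
Definition tgi : A := Dgenerator Dginv.
Definition tzeta : A := Dgenerator Dzeta.

Lemma Dtilde_rel : double_rel tx1 tx2 tv1 tv2 tg tgi tzeta.
Proof.
apply: Drel_double => a b ab.
have [a' [b' [ab' -> ->]]] := Drel_lift (f := @Dpi k) ab.
exact: Dpi_rel.
Qed.
End Generators.

(** * Ordered monomials and their coordinates *)

(** The letters generate the same algebra as the original generators, but with
    them every element is a combination of ordered monomials with odd
    exponents at most 1. *)
Variant letter := Lg | Lgi | Lzeta | Lz | Lw | Ly | Lu | Lx1 | Lv1 | Lx2 | Lv2.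

Definition letter_val (A : pzRingType) (x1 x2 v1 v2 g gi zeta : A) (l : letter) : A :=
  match l with
  | Lg => g | Lgi => gi | Lzeta => zeta
  | Lz => x2 * x1 + x1 * x2 | Lw => v1 * v2 + v2 * v1
  | Ly => x2 * x2 | Lu => v2 * v2
  | Lx1 => x1 | Lv1 => v1 | Lx2 => x2 | Lv2 => v2
  end.

(** The components are the exponents of g, z, w, x1, v1, y, x2, u, v2 and
    zeta, in this order. *)
Definition exponent : Type :=
  int * nat * nat * bool * bool * nat * bool * nat * bool * nat.

Section Monomials.
Variable B : pzRingType.

Definition zpow (t t' : B) (i : int) : B :=
  match i with Posz n => t ^+ n | Negz n => t' ^+ n.+1 end.

Definition mon (f : letter -> B) (t : exponent) : B :=
  let: (i, b, d, a, e, n, r, m, q, j) := t in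
  zpow (f Lg) (f Lgi) i * f Lz ^+ b * f Lw ^+ d * f Lx1 ^+ a * f Lv1 ^+ e
  * f Ly ^+ n * f Lx2 ^+ r * f Lu ^+ m * f Lv2 ^+ q * f Lzeta ^+ j.

Definition word (f : letter -> B) (s : seq letter) : B := \prod_(l <- s) f l.

End Monomials.

Lemma mon_morph (B C : pzRingType) (h : B -> C) f t :
  monoid_morphism h -> h (mon f t) = mon (h \o f) t.
Proof.
move=> [h1 hM]; have hX x n : h (x ^+ n) = h x ^+ n.
  by elim: n => [|n IH]; rewrite ?h1 // !exprS hM IH.
case: t => [[[[[[[[[i b] d] a] e] n] r] m] q] j].
by rewrite /mon !hM !hX; case: i => i /=; rewrite hX.
Qed.

Section Coordinates.
Variable k : fieldType.
Local Notation A := (Dtilde k).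

Definition tletter : letter -> A :=
  letter_val (tx1 k) (tx2 k) (tv1 k) (tv2 k) (tg k) (tgi k) (tzeta k).

Definition rop_gen (i : Dgen) : operator k :=
  match i with
  | Dx1 => rop_x1 k | Dx2 => rop_x2 k | Du1 => rop_v1 k
  | Du2 => rop_v2 k - rop_zeta k * rop_v1 k
  | Dg => rop_g k | Dginv => rop_gi k | Dzeta => rop_zeta k
  end.

Fact rop_ideal a : Dideal k a -> feval rop_gen a = 0.
Proof.
apply: (gen_idealW (I := kernel (feval rop_gen))) => _ [b [c [Rbc ->]]] /=.
rewrite rmorphB /=; apply/eqP; rewrite subr_eq0; apply/eqP.
have /= := Drel_morph (feval rop_gen) Rbc.
have -> : (fun i => feval rop_gen (fgen k i)) = rop_gen.
  by apply: funext => i; exact: feval_gen.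
by apply: double_Drel; rewrite subrK; apply: operator_rel.
Qed.

Definition Drep : A -> operator k := quotAlg_lift rop_ideal.
HB.instance Definition _ := GRing.isLinear.Build k A (operator k) *:%R Drep
  (quotAlg_lift_linear rop_ideal).
HB.instance Definition _ := GRing.isMonoidMorphism.Build A (operator k) Drep
  (quotAlg_lift_monoid_morphism rop_ideal).

Lemma Drep_gen i : Drep (Dgenerator k i) = rop_gen i.
Proof. exact: etrans (quotAlg_liftE rop_ideal _) (feval_gen _ _). Qed.

Definition rop_letter (l : letter) : operator k :=
  match l with
  | Lg => rop_g k | Lgi => rop_gi k | Lzeta => rop_zeta k
  | Lz => rop_z k | Lw => rop_w k
  | Ly => rop_x2 k * rop_x2 k | Lu => rop_v2 k * rop_v2 k
  | Lx1 => rop_x1 k | Lv1 => rop_v1 k | Lx2 => rop_x2 k | Lv2 => rop_v2 k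
  end.

Lemma Drep_letter l : Drep (tletter l) = rop_letter l.
Proof.
have x1E : Drep (tx1 k) = rop_x1 k := Drep_gen Dx1.
have x2E : Drep (tx2 k) = rop_x2 k := Drep_gen Dx2.
have v1E : Drep (tv1 k) = rop_v1 k := Drep_gen Du1.
have v2E : Drep (tv2 k) = rop_v2 k.
  transitivity (Drep (Dgenerator k Du2) + Drep (tzeta k) * Drep (tv1 k)).
    by rewrite /tv2 rmorphD rmorphM.
  by rewrite v1E (Drep_gen Du2) [Drep (tzeta k)](Drep_gen Dzeta) /= subrK.
have DrepM a b : Drep (a * b) = Drep a * Drep b by rewrite rmorphM.
have DrepD a b : Drep (a * b + b * a) = Drep a * Drep b + Drep b * Drep a.
  by rewrite rmorphD; congr (_ + _); apply: DrepM.
case: l; try exact: Drep_gen; rewrite /tletter /letter_val /rop_letter.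
- by rewrite DrepD x1E x2E rop_zE.
- by rewrite DrepD v1E v2E rop_wE.
- by rewrite DrepM x2E.
- by rewrite DrepM v2E.
- exact: v2E.
Qed.

Implicit Type f : ktableau k.

Lemma operatorM (h l : operator k) f : (h * l) f = l (h f). Proof. by []. Qed.

(** The [raise] lemmas evaluate the operators of an ordered monomial at the
    exponent of 1: each factor, from the last to the first, moves the point of
    evaluation to its own exponent and adds no other term, since the factors
    before it still have exponent 0 there. *)
Lemma raise_zeta j f :
  (rop_zeta k ^+ j) f 0 0%N 0%N false false 0%N false 0%N false
  = 'X ^+ j * f 0 0%N 0%N false false 0%N false 0%N false.
Proof.
elim: j f => [|j IH] f; first by rewrite mul1r.
by rewrite exprS operatorM IH /= /op_zeta /= subr0 addr0 exprSr mulrA.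
Qed.

Lemma raise_v2 (q : bool) f m :
  (rop_v2 k ^+ q) f 0 0%N 0%N false false 0%N false m false
  = f 0 0%N 0%N false false 0%N false m q.
Proof. by case: q => //=; rewrite /= ?expr1 /= /op_v2 /tail_v2 /=; ring. Qed.

Lemma raise_u m f m0 q :
  ((rop_v2 k * rop_v2 k) ^+ m) f 0 0%N 0%N false false 0%N false m0 q
  = f 0 0%N 0%N false false 0%N false (m0 + m)%N q.
Proof.
elim: m f => [|m IH] f; first by rewrite addn0.
rewrite exprS operatorM IH addnS /= /op_v2 /tail_v2 /=.
by case: q {IH} => /=; ring.
Qed.

Lemma raise_x2 (r : bool) f n m q :
  (rop_x2 k ^+ r) f 0 0%N 0%N false false n false m q
  = f 0 0%N 0%N false false n r m q.
Proof. by case: r => //=; rewrite /= ?expr1 /= /op_x2 /tail_x2 /=; ring. Qed.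

Lemma raise_y n f n0 r m q :
  ((rop_x2 k * rop_x2 k) ^+ n) f 0 0%N 0%N false false n0 r m q
  = f 0 0%N 0%N false false (n0 + n)%N r m q.
Proof.
elim: n f => [|n IH] f; first by rewrite addn0.
rewrite exprS operatorM IH addnS /= /op_x2 /tail_x2 /=.
by case: r {IH} => /=; ring.
Qed.

Lemma raise_v1 (e : bool) f i b d n r m q :
  (rop_v1 k ^+ e) f i b d false false n r m q = f i b d false e n r m q.
Proof. by case: e => //=; rewrite /= ?expr1 /= /op_v1 /= mul1r. Qed.

Lemma raise_x1 (a : bool) f i b d e n r m q :
  (rop_x1 k ^+ a) f i b d false e n r m q = f i b d a e n r m q.
Proof. by case: a => //=; rewrite /= ?expr1. Qed.

Lemma raise_w d f i b d0 a e n r m q :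
  (rop_w k ^+ d) f i b d0 a e n r m q = f i b (d0 + d)%N a e n r m q.
Proof.
elim: d f => [|d IH] f; first by rewrite addn0.
by rewrite exprS operatorM IH addnS.
Qed.

Lemma raise_z b f i b0 d a e n r m q :
  (rop_z k ^+ b) f i b0 d a e n r m q = f i (b0 + b)%N d a e n r m q.
Proof.
elim: b f => [|b IH] f; first by rewrite addn0.
by rewrite exprS operatorM IH addnS.
Qed.

Lemma raise_g (i : int) f i0 b d a e n r m q :
  zpow (rop_g k) (rop_gi k) i f i0 b d a e n r m q
  = f (i0 + i) b d a e n r m q.
Proof.
case: i => i /=.
  elim: i f => [|i IH] f; first by rewrite addr0.
  by rewrite exprS operatorM IH /= /op_g -addrA [_ + 1]addrC -intS.
elim: i f => [|i IH] f //.
rewrite exprS operatorM IH /= /op_gi /=; congr (f _ _ _ _ _ _ _ _ _).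
by rewrite !NegzE -addrA -opprD [_ + 1]addrC -intS.
Qed.

(** A linear map f is determined by its values at the monomials without zeta,
    and the action of a sends it to a map whose value at 1 is f a.  Taking f
    to be the coordinate of one such monomial extracts its coefficient, a
    polynomial in zeta. *)
Definition tcoord (t : exponent) (a : A) : k :=
  let: (i, b, d, x, e, n, r, m, q, j) := t in
  (Drep a (fun i' b' d' x' e' n' r' m' q' =>
     ((i', b', d', x', e', n', r', m', q') == (i, b, d, x, e, n, r, m, q))%:R)
   0 0%N 0%N false false 0%N false 0%N false)`_j.

Lemma Drep_lin c a1 a2 : Drep (c *: a1 + a2) = c *: Drep a1 + Drep a2.
Proof. exact: quotAlg_lift_linear. Qed.

Lemma operator_lin c (h1 h2 : operator k) f : (c *: h1 + h2) f = c *: h1 f + h2 f.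
Proof. exact: endo_linE. Qed.

Lemma tcoord_lin t c a1 a2 :
  tcoord t (c *: a1 + a2) = c * tcoord t a1 + tcoord t a2.
Proof.
case: t => [[[[[[[[[i b] d] x] e] n] r] m] q] j].
by rewrite /tcoord Drep_lin operator_lin tableau_lin coefD coefCM.
Qed.

(** Coordinates thus exist without knowing beforehand that the monomials are a
    basis. *)
Lemma tcoord_mon t t' : tcoord t (mon tletter t') = (t' == t)%:R.
Proof.
have fE : Drep \o tletter = rop_letter by apply: funext => l /=; apply: Drep_letter.
case: t => [[[[[[[[[i b] d] x] e] n] r] m] q] j] /=.
rewrite mon_morph ?fE; last exact: quotAlg_lift_monoid_morphism.
case: t' => [[[[[[[[[i' b'] d'] x'] e'] n'] r'] m'] q'] j'].
rewrite /mon !operatorM raise_zeta raise_v2 raise_u raise_x2 raise_y raise_v1.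
rewrite raise_x1 raise_w raise_z raise_g !add0n add0r.
(* The action of zeta^j on the coordinate of the monomial is 'X^j. *)
rewrite [in RHS]xpair_eqE; case: eqP => _; last by rewrite mulr0 coef0.
by rewrite mulr1 coefXn eq_sym.
Qed.

End Coordinates.

(** * Spanning by ordered monomials *)

Section Span.
Variables (k : fieldType) (B : lmodType k) (I : eqType) (M : I -> B).

(** Finite linear combinations of the M i with P i, written as lists with
    repetitions so that sums are concatenations. *)
Definition in_span (P : pred I) (x : B) : Prop :=
  exists2 s : seq (k * I), all (fun c => P c.2) s & x = \sum_(c <- s) c.1 *: M c.2.

Variable P : pred I.
Local Notation span := (in_span P).

Lemma span0 : span 0.
Proof. by exists [::]; rewrite ?big_nil. Qed.

Lemma spanD x y : span x -> span y -> span (x + y).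
Proof.
move=> [s Ps ->] [t Pt ->]; exists (s ++ t); first by rewrite all_cat Ps.
by rewrite big_cat.
Qed.

Lemma spanZ c x : span x -> span (c *: x).
Proof.
move=> [s Ps ->]; exists [seq (c * p.1, p.2) | p <- s].
  by rewrite all_map.
by rewrite big_map scaler_sumr; apply: eq_bigr => p _; rewrite scalerA.
Qed.

Lemma span_gen i : P i -> span (M i).
Proof. by move=> Pi; exists [:: (1, i)]; rewrite /= ?Pi // big_seq1 scale1r. Qed.

Lemma span_sum (J : Type) (r : seq J) (Q : pred J) (E : J -> B) :
  (forall j, Q j -> span (E j)) -> span (\sum_(j <- r | Q j) E j).
Proof. by move=> h; apply: (big_ind span) => //; [apply: span0 | apply: spanD]. Qed.

Lemma span_ind (Q : B -> Prop) :
  Q 0 -> (forall c x y, Q x -> Q y -> Q (c *: x + y)) ->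
  (forall i, P i -> Q (M i)) -> forall x, span x -> Q x.
Proof.
move=> Q0 Qlin QM x [s Ps ->]; elim: s Ps => [|[c i] s IH] /=.
  by rewrite big_nil.
by move=> /andP[Pi Ps]; rewrite big_cons; apply: Qlin; [apply: QM | apply: IH].
Qed.

Lemma span_uniq x : span x ->
  exists (s : seq I) (c : I -> k),
    [/\ uniq s, all P s & x = \sum_(i <- s) c i *: M i].
Proof.
move=> [s Ps ->]; exists (undup (map snd s)).
exists (fun i => \sum_(p <- s | p.2 == i) p.1); split.
- exact: undup_uniq.
- by rewrite all_undup all_map.
- under [RHS]eq_bigr do rewrite scaler_suml.
  rewrite (exchange_big_dep xpredT) //= [LHS]big_seq [RHS]big_seq.
  apply: eq_bigr => p ps.
  rewrite (big_rem p.2) /=; last by rewrite mem_undup map_f.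
  rewrite eqxx big_seq_cond big_pred0 ?addr0 // => i.
  by apply/negP => /andP[+ /eqP pi]; rewrite -pi mem_rem_uniqF ?undup_uniq.
Qed.

End Span.

Lemma span_mull (k : fieldType) (B : algType k) (I J : eqType) (M : I -> B)
    (N : J -> B) (P : pred I) (Q : pred J) a x :
  (forall i, P i -> in_span N Q (a * M i)) -> in_span M P x ->
  in_span N Q (a * x).
Proof.
move=> h; elim/span_ind => [|c y z Qy Qz|i Pi]; last exact: h.
  by rewrite mulr0; apply: span0.
by rewrite mulrDr -scalerAr; apply: spanD => //; apply: spanZ.
Qed.

Lemma span_mulr (k : fieldType) (B : algType k) (I J : eqType) (M : I -> B)
    (N : J -> B) (P : pred I) (Q : pred J) a x :
  (forall i, P i -> in_span N Q (M i * a)) -> in_span M P x ->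
  in_span N Q (x * a).
Proof.
move=> h; elim/span_ind => [|c y z Qy Qz|i Pi]; last exact: h.
  by rewrite mul0r; apply: span0.
by rewrite mulrDl -scalerAl; apply: spanD => //; apply: spanZ.
Qed.

Definition letter_code (l : letter) : nat :=
  match l with
  | Lg => 0 | Lgi => 1 | Lzeta => 2 | Lz => 3 | Lw => 4 | Ly => 5 | Lu => 6
  | Lx1 => 7 | Lv1 => 8 | Lx2 => 9 | Lv2 => 10
  end.

Fact letter_code_inj : injective letter_code.
Proof. by do 2 case. Qed.

HB.instance Definition _ := Equality.copy letter (inj_type letter_code_inj).

Definition odd_letter (l : letter) : bool :=
  match l with Lx1 | Lv1 | Lx2 | Lv2 => true | _ => false end.

Section Supercommutative.
Variables (k : fieldType) (B : algType k) (f : letter -> B).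

(** What the graded algebra and the tensor product have in common; it suffices
    to order words. *)
Record supercommutative : Prop := Supercommutative {
  super_comm : forall l l',
    f l * f l' = (-1) ^+ (odd_letter l && odd_letter l') *: (f l' * f l);
  super_sq : forall l, odd_letter l -> f l * f l = 0;
  super_gi : f Lg * f Lgi = 1 }.

Hypothesis H : supercommutative.

Lemma super_commX l l' n :
  f l * f l' ^+ n
  = ((-1) ^+ (odd_letter l && odd_letter l')) ^+ n *: (f l' ^+ n * f l).
Proof.
elim: n => [|n IH]; first by rewrite scale1r mul1r mulr1.
rewrite [f l' ^+ _]exprS mulrA (super_comm H) -scalerAl -(mulrA _ (f l)) IH.
by rewrite -scalerAr scalerA (exprS (_ ^+ _)) mulrA.
Qed.

Definition powers (L : seq letter) (e : letter -> nat) : B :=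
  \prod_(l <- L) f l ^+ e l.

(** A second occurrence of an odd letter makes the product 0, so that its
    exponent may stay at 1. *)
Definition incr (l : letter) (e : letter -> nat) : letter -> nat :=
  fun l' => if l' == l then if odd_letter l then 1%N else (e l).+1 else e l'.

(** The scalar is a sign, or 0 when an odd letter would occur twice. *)
Lemma mul_powers l L e : uniq L -> l \in L ->
  (forall l', odd_letter l' -> (e l' <= 1)%N) ->
  exists c : k, f l * powers L e = c *: powers L (incr l e).
Proof.
move=> + + e1; elim: L => // l0 L IH /= /andP[l0L uL].
rewrite inE /powers !big_cons -/(powers L e) -/(powers L _) [incr l e l0]/incr eq_sym.
case: eqVneq => [ll0|ll0] /=; last first.
  move=> /(IH uL)[c IHc]; rewrite mulrA super_commX -scalerAl -mulrA IHc.
  by rewrite -scalerAr scalerA; eexists.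
move=> _; rewrite ll0 in l0L *.
have -> : powers L (incr l e) = powers L e.
  apply: eq_big_seq => l' l'L; rewrite /incr; case: eqP => // e'.
  by rewrite -e' l'L in l0L.
case: ifP => [ol|_]; last by exists 1; rewrite scale1r exprS mulrA.
case: (e l) (e1 _ ol) => [|[|//]] _; first by exists 1; rewrite scale1r mul1r.
by exists 0; rewrite scale0r mulrA super_sq // mul0r.
Qed.

Local Notation Lt := [:: Lz; Lw; Lx1; Lv1; Ly; Lx2; Lu; Lv2; Lzeta].

Definition exponent_fun (t : exponent) (l : letter) : nat :=
  let: (i, b, d, a, e, n, r, m, q, j) := t in
  match l with
  | Lz => b | Lw => d | Lx1 => a | Lv1 => e | Ly => n | Lx2 => r | Lu => m
  | Lv2 => q | Lzeta => j | Lg | Lgi => 0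
  end.

Lemma mon_powers i b d a e n r m q j :
  let t := (i, b, d, a, e, n, r, m, q, j) in
  mon f t = zpow (f Lg) (f Lgi) i * powers Lt (exponent_fun t).
Proof. by rewrite /mon /powers !big_cons big_nil mulr1 !mulrA. Qed.

Lemma powers_mon i (h : letter -> nat) :
  (forall l', odd_letter l' -> (h l' <= 1)%N) ->
  zpow (f Lg) (f Lgi) i * powers Lt h
  = mon f (i, h Lz, h Lw, h Lx1 == 1%N, h Lv1 == 1%N, h Ly, h Lx2 == 1%N,
           h Lu, h Lv2 == 1%N, h Lzeta).
Proof.
move=> h1; rewrite mon_powers; congr (_ * _); apply: eq_big_seq => l.
have hE l' : odd_letter l' -> h l' = (h l' == 1%N).
  by move/h1; case: (h l') => [|[]].
by rewrite !inE; case: l => //= _; rewrite -hE.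
Qed.

Lemma super_gig : f Lgi * f Lg = 1.
Proof. by rewrite (super_comm H) scale1r (super_gi H). Qed.

Lemma zpow_incr i : f Lg * zpow (f Lg) (f Lgi) i = zpow (f Lg) (f Lgi) (i + 1).
Proof.
case: i => [i|[|i]] /=; first by rewrite -exprS addn1.
  by rewrite expr1 (super_gi H).
by rewrite exprS mulrA (super_gi H) mul1r subn1.
Qed.

Lemma zpow_decr i : f Lgi * zpow (f Lg) (f Lgi) i = zpow (f Lg) (f Lgi) (i - 1).
Proof.
case: i => [[|i]|i] /=; first by rewrite mulr1.
  by rewrite exprS mulrA super_gig mul1r subn1.
by rewrite -exprS addn0.
Qed.

Lemma span_letter_mon l t : in_span (mon f) predT (f l * mon f t).
Proof.
case: t => [[[[[[[[[i b] d] a] e] n] r] m] q] j]; rewrite mon_powers.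
set h := exponent_fun _.
have h1 l' : odd_letter l' -> (h l' <= 1)%N.
  by case: l' => //= _; rewrite leq_b1.
case: (boolP (l \in Lt)) => lL; last first.
  have [->|->] : l = Lg \/ l = Lgi by case: l lL => // _; [left | right].
    by rewrite mulrA zpow_incr powers_mon //; apply: span_gen.
  by rewrite mulrA zpow_decr powers_mon //; apply: span_gen.
have [c hc] := @mul_powers l Lt h isT lL h1.
have pass i0 : exists c', f l * zpow (f Lg) (f Lgi) i0
    = c' *: (zpow (f Lg) (f Lgi) i0 * f l).
  by case: i0 => i0 /=; rewrite super_commX; eexists.
have [c' hc'] := pass i.
rewrite mulrA hc' -scalerAl -mulrA hc -scalerAr.
have h1' l' : odd_letter l' -> (incr l h l' <= 1)%N.
  by rewrite /incr; case: eqP => [-> ->|_ /h1].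
by rewrite powers_mon //; do 2 apply: spanZ; apply: span_gen.
Qed.

Lemma span_word s : in_span (mon f) predT (word f s).
Proof.
elim: s => [|l s IH]; rewrite /word.
  have -> : \prod_(l <- [::]) f l = mon f (0%:Z, 0, 0, false, false, 0, false, 0, false, 0)%N.
    by rewrite big_nil /mon /= !mulr1.
  exact: span_gen.
rewrite big_cons; apply: span_mull IH => t _; exact: span_letter_mon.
Qed.

End Supercommutative.

Definition exponent_word (t : exponent) : seq letter :=
  let: (i, b, d, a, e, n, r, m, q, j) := t in
  match i with Posz n => nseq n Lg | Negz n => nseq n.+1 Lgi end
  ++ nseq b Lz ++ nseq d Lw ++ nseq a Lx1 ++ nseq e Lv1 ++ nseq n Ly
  ++ nseq r Lx2 ++ nseq m Lu ++ nseq q Lv2 ++ nseq j Lzeta.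

Lemma word_cat (B : pzRingType) (f : letter -> B) s t :
  word f (s ++ t) = word f s * word f t.
Proof. exact: big_cat. Qed.

Lemma word_nseq (B : pzRingType) (f : letter -> B) n l : word f (nseq n l) = f l ^+ n.
Proof. by rewrite /word big_nseq iter_mulr_1. Qed.

Lemma word_exponent (B : pzRingType) (f : letter -> B) t :
  word f (exponent_word t) = mon f t.
Proof.
case: t => [[[[[[[[[i b] d] a] e] n] r] m] q] j].
rewrite /exponent_word !word_cat !word_nseq /mon !mulrA.
by case: i => i; rewrite word_nseq.
Qed.

(** * Classes in an associated graded algebra *)

Section Classes.
Variables (k : fieldType) (A : algType k) (F : filtration A).

Lemma filZ n c a : F n a -> F n (c *: a).
Proof. by move=> Fa; rewrite -[c *: a]addr0; apply: filP => //; apply: fil0. Qed.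

Lemma filD n a b : F n a -> F n b -> F n (a + b).
Proof. by move=> Fa Fb; rewrite -[a]scale1r; apply: filP. Qed.

Lemma fil_le m n a : (m <= n)%N -> F m a -> F n a.
Proof. by move/subnK <-; elim: (n - m)%N => // j IH /IH; apply: filS. Qed.

(** The class of a in degree n.  The graded algebra is a quotient of the Rees
    algebra, whose elements are polynomials with a proof; [insubd] supplies
    the proof when a has filtration degree at most n, and otherwise gives 0. *)
Definition gr_class (n : nat) (a : A) : gr F :=
  quotAlg_pi (gr_ideal F) (insubd (0 : rees F) (a *: 'X^n)).

Lemma val_class n a : F n a -> rees_val (insubd (0 : rees F) (a *: 'X^n)) = a *: 'X^n.
Proof.
move=> Fa; apply: (insubdK (0 : rees F)); apply/asboolP => j; rewrite coefZ coefXn.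
by case: eqP => [->|_]; rewrite ?mulr1 ?mulr0 //; apply: fil0.
Qed.

Lemma class_lin n c a b : F n a -> F n b ->
  gr_class n (c *: a + b) = c *: gr_class n a + gr_class n b.
Proof.
move=> Fa Fb; rewrite /gr_class -quotAlg_piZ -quotAlg_piD; congr quotAlg_pi.
apply: val_inj; rewrite [LHS]val_class; last exact: filP.
rewrite [RHS]/= !val_class //.
by apply/polyP => i; rewrite !(coefD, coefZ) mulrDl mulr_algl scalerAl.
Qed.

Lemma class0 n : gr_class n 0 = 0.
Proof.
have := @class_lin n (-1) 0 0 (fil0 F n) (fil0 F n).
by rewrite scaler0 addr0 scaleN1r addNr.
Qed.

Lemma classZ n c a : F n a -> gr_class n (c *: a) = c *: gr_class n a.
Proof.
move=> Fa; rewrite -[c *: a]addr0 class_lin ?class0 ?addr0 //; exact: fil0.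
Qed.

Lemma classD n a b : F n a -> F n b ->
  gr_class n (a + b) = gr_class n a + gr_class n b.
Proof. by move=> Fa Fb; rewrite -[a]scale1r class_lin // !scale1r. Qed.

Lemma classM m n a b : F m a -> F n b ->
  gr_class m a * gr_class n b = gr_class (m + n)%N (a * b).
Proof.
move=> Fa Fb; rewrite /gr_class -quotAlg_piM; congr quotAlg_pi.
apply: val_inj; rewrite [RHS]val_class; last exact: filM.
rewrite [LHS]/= !val_class //.
rewrite -!mul_polyC polyCM exprD -!mulrA; congr (_ * _).
by rewrite !mulrA; congr (_ * _); apply/esym/commr_polyXn.
Qed.

Lemma class1 : gr_class 0 1 = 1.
Proof.
rewrite /gr_class -[RHS](quotAlg_pi1 (gr_ideal F)); congr quotAlg_pi.
by apply: val_inj; rewrite [LHS]val_class ?scale1r //; apply: fil1.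
Qed.

Lemma gr_pi_eq0 (p : rees F) : quotAlg_pi (gr_ideal F) p = 0 <-> gr_mem p.
Proof.
rewrite -[0 in X in X <-> _](raddf0 (quotAlg_pi (gr_ideal F))).
by split=> [/quotAlg_eq|h]; [|apply/quotAlg_eq]; rewrite subr0.
Qed.

Lemma class_eq0 n a : F n a -> fil_pred F n a -> gr_class n a = 0.
Proof.
move=> Fa lowa; apply/gr_pi_eq0 => j; rewrite val_class // coefZ coefXn.
case: eqP => [->|_]; first by rewrite mulr1.
by rewrite mulr0; case: j => //= j; apply: fil0.
Qed.

Lemma class_decomposition (x : gr F) : exists N (a : nat -> A),
  (forall n, F n (a n)) /\ x = \sum_(n < N) gr_class n (a n).
Proof.
elim/quotAlg_ind: x => p; exists (size (rees_val p)), (fun n => (rees_val p)`_n).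
have /asboolP Fp := valP p; split=> //.
rewrite /gr_class -(raddf_sum (quotAlg_pi (gr_ideal F))); congr quotAlg_pi.
apply: val_inj; rewrite [LHS]/= -[LHS]coefK poly_def.
rewrite (raddf_sum (val : rees F -> {poly A})) /=.
by apply: eq_bigr => i _; rewrite val_class.
Qed.

(** A sum of classes is represented by the polynomial with coefficients a n,
    and the ideal is a condition on each coefficient. *)
Lemma class_independent N (a : nat -> A) : (forall n, F n (a n)) ->
  \sum_(n < N) gr_class n (a n) = 0 -> forall n, (n < N)%N -> fil_pred F n (a n).
Proof.
move=> Fa; rewrite /gr_class -(raddf_sum (quotAlg_pi (gr_ideal F))).
move=> /gr_pi_eq0 h n nN; have := h n.
have -> : rees_val (\sum_(i < N) insubd (0 : rees F) (a i *: 'X^i))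
    = \sum_(i < N) a i *: 'X^i.
  transitivity (\sum_(i < N) rees_val (insubd (0 : rees F) (a i *: 'X^i))).
    exact: (raddf_sum (val : rees F -> {poly A})).
  by apply: eq_bigr => i _; rewrite val_class.
by rewrite -poly_def coef_poly nN.
Qed.

End Classes.

(** * Supercommutators of the letters *)

Definition weight (l : letter) : nat :=
  match l with
  | Lg | Lgi => 0 | Lzeta | Lx1 | Lv1 => 1 | Lz | Lw | Lx2 | Lv2 => 2
  | Ly | Lu => 3
  end.

Definition word_weight (s : seq letter) : nat := sumn (map weight s).

(** For the pairs of letters that have an entry, l l' is l' l, or - l' l if both
    are odd, plus the combination of words listed, a word marked true having
    coefficient -1.  One order of each pair is enough. *)
Definition defect (l l' : letter) : option (seq (bool * seq letter)) :=
  match l, l' with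
  | Lzeta, Lx1 => Some [:: (false, [:: Lx1])]
  | Lzeta, Lx2 => Some [:: (false, [:: Lx2])]
  | Lv1, Lzeta => Some [:: (false, [:: Lv1])]
  | Lv2, Lzeta => Some [:: (false, [:: Lv2])]
  | Lg, Lx1 | Lv1, Lg | Lv1, Lx1 | Lzeta, Lg | Lx1, Lz | Lg, Lz | Lv1, Lz
  | Lw, Lz | Lw, Lv1 | Lw, Lg | Lw, Lx1 | Ly, Lx2 | Lu, Lv2 => Some [::]
  | Lg, Lx2 => Some [:: (true, [:: Lx1; Lg])]
  | Lv2, Lg => Some [:: (true, [:: Lg; Lv1])]
  | Lv1, Lx2 | Lv2, Lx1 => Some [:: (false, [::]); (true, [:: Lg])]
  | Lv2, Lx2 => Some [:: (false, [:: Lzeta])]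
  | Lx2, Lx1 => Some [:: (false, [:: Lz])]
  | Lv1, Lv2 => Some [:: (false, [:: Lw])]
  | Lx2, Lz => Some [:: (false, [:: Lx1; Lz])]
  | Lw, Lv2 => Some [:: (false, [:: Lw; Lv1])]
  | Lzeta, Lz => Some [:: (false, [:: Lz]); (false, [:: Lz])]
  | Lw, Lzeta => Some [:: (false, [:: Lw]); (false, [:: Lw])]
  | Ly, Lz => Some [:: (false, [:: Lz; Lz])]
  | Lw, Lu => Some [:: (false, [:: Lw; Lw])]
  | Ly, Lx1 => Some [:: (false, [:: Lx1; Lz])]
  | Lv1, Lu => Some [:: (false, [:: Lw; Lv1])]
  | Lzeta, Ly => Some [:: (false, [:: Ly]); (false, [:: Ly])]
  | Lu, Lzeta => Some [:: (false, [:: Lu]); (false, [:: Lu])]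
  | Lg, Ly => Some [:: (true, [:: Lz; Lg])]
  | Lu, Lg => Some [:: (true, [:: Lg; Lw])]
  | Lv2, Lz => Some [:: (false, [:: Lx1]); (false, [:: Lx1; Lg])]
  | Lw, Lx2 => Some [:: (false, [:: Lv1]); (false, [:: Lg; Lv1])]
  | Lv1, Ly => Some [:: (false, [:: Lx1; Lg])]
  | Lu, Lx1 => Some [:: (false, [:: Lg; Lv1])]
  | Lv2, Ly => Some [:: (false, [:: Lx2])]
  | Lu, Lx2 => Some [:: (false, [:: Lv2])]
  | Lw, Ly | Lu, Lz =>
      Some [:: (false, [::]); (true, [:: Lg; Lg]); (false, [:: Lx1; Lg; Lv1])]
  | Lu, Ly => Some [:: (false, [:: Lzeta])]
  | _, _ => None
  end.

Lemma defect_complete l l' : l != l' -> l != Lgi -> l' != Lgi ->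
  isSome (defect l l') || isSome (defect l' l).
Proof. by case: l; case: l'. Qed.

Lemma defect_weight l l' t : defect l l' = Some t ->
  all (fun c => word_weight c.2 < weight l + weight l')%N t.
Proof. by case: l; case: l' => //= -[<-]. Qed.

Section Defect.
Variables (k : fieldType) (A : algType k) (x1 x2 v1 v2 g gi zeta : A).
Hypothesis R : double_rel x1 x2 v1 v2 g gi zeta.
Local Notation val := (letter_val x1 x2 v1 v2 g gi zeta).

Lemma defectE l l' t : defect l l' = Some t ->
  val l * val l' = (-1) ^+ (odd_letter l && odd_letter l') *: (val l' * val l)
    + \sum_(c <- t) (-1) ^+ c.1 *: word val c.2.
Proof.
case: l; case: l' => //= -[<-];
 rewrite /word ?big_cons ?big_nil /= ?big_cons ?big_nil /letter_val
   ?expr0 ?expr1 ?scale1r ?scaleN1r ?mulr1 ?addr0;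
 try (first [ apply: etrans (rel_zetax1 R) _
   | apply: etrans (rel_zetax2 R) _
   | apply: etrans (rel_v1zeta R) _
   | apply: etrans (rel_v2zeta R) _
   | apply: etrans (rel_gx1 R) _
   | apply: etrans (rel_gx2 R) _
   | apply: etrans (rel_v1g R) _
   | apply: etrans (rel_v2g R) _
   | apply: etrans (rel_v1x1 R) _
   | apply: etrans (rel_v1x2 R) _
   | apply: etrans (rel_v2x1 R) _
   | apply: etrans (rel_v2x2 R) _
   | apply: etrans (rel_gzeta R) _
   | apply: etrans (rel_x2z R) _
   | apply: etrans (rel_wv2 R) _
   | apply: etrans (rel_x1z R) _
   | apply: etrans (rel_zetaz R) _
   | apply: etrans (rel_gz R) _
   | apply: etrans (rel_yz R) _
   | apply: etrans (rel_yx1 R) _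
   | apply: etrans (rel_zetay R) _
   | apply: etrans (rel_gy R) _
   | apply: etrans (rel_v1z R) _
   | apply: etrans (rel_v2z R) _
   | apply: etrans (rel_v1y R) _
   | apply: etrans (rel_v2y R) _
   | apply: etrans (rel_wz R) _
   | apply: etrans (rel_wy R) _
   | apply: etrans (rel_uz R) _
   | apply: etrans (rel_uy R) _
   | apply: etrans (rel_wv1 R) _
   | apply: etrans (rel_wzeta R) _
   | apply: etrans (rel_wg R) _
   | apply: etrans (rel_wu R) _
   | apply: etrans (rel_v1u R) _
   | apply: etrans (rel_uzeta R) _
   | apply: etrans (rel_ug R) _
   | apply: etrans (rel_wx1 R) _
   | apply: etrans (rel_wx2 R) _
   | apply: etrans (rel_ux1 R) _
   | apply: etrans (rel_ux2 R) _ ]); ncr.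
Qed.
End Defect.

(** * The word filtration *)

(** The inverse of g is left out of the table: it commutes with whatever g
    commutes with. *)
Lemma comm_inverse (B : pzRingType) (g gi a : B) :
  g * gi = 1 -> gi * g = 1 -> g * a = a * g -> a * gi = gi * a.
Proof.
by move=> ggi gig ga; rewrite -[a in LHS]mul1r -gig -(mulrA gi) ga -!mulrA ggi mulr1.
Qed.

Section Filtration.
Variable k : fieldType.
Local Notation A := (Dtilde k).
Local Notation val := (@tletter k).

Definition light (n : nat) (s : seq letter) : bool := (word_weight s <= n)%N.

(** The span of the words of weight at most n; multiplicativity is then
    immediate from concatenation. *)
Definition Dfil_mem (n : nat) (a : A) : Prop := in_span (word val) (light n) a.

Fact Dfil0 n : Dfil_mem n 0. Proof. exact: span0. Qed.
Fact DfilP n c a b : Dfil_mem n a -> Dfil_mem n b -> Dfil_mem n (c *: a + b).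
Proof. by move=> Fa Fb; apply: spanD => //; apply: spanZ. Qed.
Fact DfilS n a : Dfil_mem n a -> Dfil_mem n.+1 a.
Proof.
elim/span_ind => [|c x y|s sn]; [exact: span0 | exact: DfilP |].
by apply: span_gen; apply: leqW.
Qed.
Fact Dfil1 : Dfil_mem 0 1.
Proof. by exists [:: (1, [::])] => //; rewrite big_seq1 scale1r /word big_nil. Qed.
Fact DfilM m n a b : Dfil_mem m a -> Dfil_mem n b -> Dfil_mem (m + n)%N (a * b).
Proof.
move=> Fa Fb; apply: span_mulr Fa => s sm; apply: span_mull Fb => t tn.
rewrite -word_cat; apply: span_gen.
by rewrite /light /word_weight map_cat sumn_cat leq_add.
Qed.

Definition Dfil : filtration A := Filtration Dfil0 DfilP DfilS Dfil1 DfilM.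

Lemma Dfil_word n s : light n s -> Dfil n (word val s).
Proof. exact: span_gen. Qed.

Lemma Dfil_letter l : Dfil (weight l) (val l).
Proof.
have -> : val l = word val [:: l] by rewrite /word big_seq1.
by apply: Dfil_word; rewrite /light /word_weight /= addn0.
Qed.

Lemma Dtilde_gen_ind (Q : A -> Prop) :
  Q 1 -> (forall c a b, Q a -> Q b -> Q (c *: a + b)) ->
  (forall a b, Q a -> Q b -> Q (a * b)) -> (forall i, Q (Dgenerator k i)) ->
  forall a, Q a.
Proof.
move=> Q1 Qlin QM Qgen; have Q0 : Q 0.
  by have := Qlin (-1) 1 1 Q1 Q1; rewrite scaleN1r addNr.
elim/quotAlg_ind => f; rewrite -/(Dpi f).
rewrite (feval_uniq (@Dpi k)) /feval.
apply: (big_ind Q) => // [a b Qa Qb|w _].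
  by rewrite -[a]scale1r; apply: Qlin.
rewrite -[_ *: _]addr0; apply: Qlin => //.
by rewrite /feval_mon; apply: (big_ind Q) => // i _; apply: Qgen.
Qed.

Lemma Dfil_exhaustive : exhaustive Dfil.
Proof.
apply: Dtilde_gen_ind => [|c a b [m Fa] [n Fb]|a b [m Fa] [n Fb]|].
- by exists 0%N; apply: fil1.
- exists (maxn m n); apply: filP; first exact: fil_le (leq_maxl _ _) Fa.
  exact: fil_le (leq_maxr _ _) Fb.
- by exists (m + n)%N; apply: filM.
have FL l : exists n, Dfil n (val l) by exists (weight l); apply: Dfil_letter.
have FM a b : (exists n, Dfil n a) -> (exists n, Dfil n b) -> exists n, Dfil n (a - b).
  move=> [m Fa] [n Fb]; exists (maxn n m); rewrite addrC -scaleN1r; apply: filP.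
    exact: fil_le (leq_maxl _ _) Fb.
  exact: fil_le (leq_maxr _ _) Fa.
case; [exact: FL Lx1 | exact: FL Lx2 | exact: FL Lv1 | | exact: FL Lg
  | exact: FL Lgi | exact: FL Lzeta].
have -> : Dgenerator k Du2 = tv2 k - tzeta k * tv1 k by rewrite /tv2 addrK.
apply: FM; first exact: FL Lv2.
by exists 2%N; apply: (@filM _ _ Dfil 1 1); [exact: Dfil_letter Lzeta | exact: Dfil_letter Lv1].
Qed.

Definition gr_letter (l : letter) : gr Dfil := gr_class Dfil (weight l) (val l).

Lemma gr_word s : word gr_letter s = gr_class Dfil (word_weight s) (word val s).
Proof.
elim: s => [|l s IH]; first by rewrite /word !big_nil class1.
rewrite /word !big_cons -/(word _ s) IH classM //; first exact: Dfil_letter.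
by apply: Dfil_word; apply: leqnn.
Qed.

(** The words of the defect are lighter than l l', hence vanish in its degree. *)
Lemma gr_defect l l' t : defect l l' = Some t ->
  gr_letter l * gr_letter l'
  = (-1) ^+ (odd_letter l && odd_letter l') *: (gr_letter l' * gr_letter l).
Proof.
move=> lt; have Fl := Dfil_letter l; have Fl' := Dfil_letter l'.
rewrite !classM //.
have -> : val l * val l' = _ := defectE (Dtilde_rel k) lt.
have low : fil_pred Dfil (weight l + weight l')%N
   (\sum_(c <- t) (-1) ^+ c.1 *: word val c.2).
  have := defect_weight lt; elim: t {lt} => [|[c s] t IH] /=.
    by rewrite big_nil; case: (_ + _)%N => //= n _; apply: span0.
  rewrite big_cons; case: (_ + _)%N IH => //= n IH /andP[sn /IH].
  by apply: DfilP; apply: span_gen.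
have Fsum : Dfil (weight l + weight l')%N (\sum_(c <- t) (-1) ^+ c.1 *: word val c.2).
  by case: (_ + _)%N low => [|n] /=; [move=> ->; apply: span0 | apply: DfilS].
rewrite [(weight l' + _)%N]addnC class_lin //; last first.
  by rewrite addnC; apply: filM.
by rewrite (class_eq0 Fsum low) addr0.
Qed.

(** The squares of x2 and v2 are the letters y and u, whose weight 3 is less
    than 2 + 2. *)
Lemma gr_supercommutative : supercommutative gr_letter.
Proof.
have ggi : gr_letter Lg * gr_letter Lgi = 1.
  rewrite classM; [|exact: Dfil_letter Lg|exact: Dfil_letter Lgi].
  by rewrite (rel_ggi (Dtilde_rel k)) class1.
have gig : gr_letter Lgi * gr_letter Lg = 1.
  rewrite classM; [|exact: Dfil_letter Lgi|exact: Dfil_letter Lg].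
  by rewrite (rel_gig (Dtilde_rel k)) class1.
have sq l : odd_letter l -> gr_letter l * gr_letter l = 0.
  move=> ol; rewrite classM; [|exact: Dfil_letter|exact: Dfil_letter].
  apply: class_eq0; first by apply: filM; apply: Dfil_letter.
  case: l ol => // _; rewrite /tletter /letter_val /=.
  - by rewrite (rel_x1x1 (Dtilde_rel k)); apply: span0.
  - by rewrite (rel_v1v1 (Dtilde_rel k)); apply: span0.
  - exact: Dfil_letter Ly.
  - exact: Dfil_letter Lu.
have comm_ l l' : l != Lgi -> l' != Lgi -> gr_letter l * gr_letter l'
    = (-1) ^+ (odd_letter l && odd_letter l') *: (gr_letter l' * gr_letter l).
  move=> lgi l'gi; have [<-|ll'] := eqVneq l l'.
    by case ol: (odd_letter l); [rewrite sq ?ol // scaler0 | rewrite scale1r].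
  case/orP: (defect_complete ll' lgi l'gi).
    by case E: (defect l l') => [t|//] _; apply: gr_defect E.
  case E: (defect l' l) => [t|//] _.
  by rewrite (gr_defect E) scalerA andbC -expr2 sqrr_sign scale1r.
have comm_gi l : l != Lgi -> gr_letter l * gr_letter Lgi = gr_letter Lgi * gr_letter l.
  move=> lgi; apply: comm_inverse ggi gig _.
  exact: etrans (comm_ Lg l isT lgi) (scale1r _).
split; [move=> l l' | exact: sq | exact: ggi].
have [->|lgi] := eqVneq l Lgi; have [->|l'gi] := eqVneq l' Lgi.
- by rewrite scale1r.
- by rewrite scale1r comm_gi.
- by rewrite andbF scale1r comm_gi.
- exact: comm_.
Qed.

End Filtration.

(** * Maps out of Laurent and exterior algebras *)

Lemma quotAlg_pi_eq0 (k : fieldType) (A : algType k) (I : ideal A) a :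
  quotAlg_pi I a = 0 <-> I a.
Proof.
rewrite -[0](raddf0 (quotAlg_pi I)).
by split=> [/quotAlg_eq|h]; [|apply/quotAlg_eq]; rewrite subr0.
Qed.

Lemma rmorph_mul_sub1 (R S : pzRingType) (f : {rmorphism R -> S}) a b :
  f a * f b = 1 -> f (a * b - 1) = 0.
Proof. by rewrite rmorphB rmorphM rmorph1 => ->; rewrite subrr. Qed.

Section LaurentMorphism.
Variables (k : fieldType) (B : algType k) (n : nat) (c : 'I_(n + 2) -> B).
Hypothesis c_comm : forall i j, GRing.comm (c i) (c j).

Definition cmonom_eval (m : 'X_{1..n + 2}) : B := \prod_i c i ^+ m i.

Fact cmonom_eval_mmorphism : mmorphism cmonom_eval.
Proof.
split=> [m m'|]; last by rewrite /cmonom_eval big1 // => i _; rewrite cm1.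
rewrite /cmonom_eval -prodrM_comm => [|i j _ _].
  by apply: eq_bigr => i _; rewrite cmM exprD.
by apply/commrX/commr_sym/commrX.
Qed.
HB.instance Definition _ := isMultiplicative.Build _ _ cmonom_eval
  cmonom_eval_mmorphism.

Definition mpoly_eval : {mpoly k[n + 2]} -> B := mmap (in_alg B) cmonom_eval.

Fact mpoly_eval_linear : linear mpoly_eval.
Proof.
by move=> a f g; rewrite /mpoly_eval mmapD mmapZ mulr_algl.
Qed.
Fact mpoly_eval_monoid_morphism : monoid_morphism mpoly_eval.
Proof.
have [hM h1] := @commr_mmap_is_multiplicative _ _ _ (in_alg B) cmonom_eval
  (fun g m m' => comm_alg _ _).
by split.
Qed.
HB.instance Definition _ := GRing.isLinear.Build k {mpoly k[n + 2]} B *:%R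
  mpoly_eval mpoly_eval_linear.
HB.instance Definition _ := GRing.isMonoidMorphism.Build {mpoly k[n + 2]} B
  mpoly_eval mpoly_eval_monoid_morphism.

Lemma mpoly_eval_var i : mpoly_eval (lvar k i) = c i.
Proof.
rewrite /mpoly_eval /lvar mmapU /= scale1r mul1r /cmonom_eval.
rewrite -[RHS](big_pred1_eq *%R i c) [RHS]big_mkcond; apply: eq_bigr => j _.
by rewrite cmU eq_sym; case: eqP.
Qed.

Hypothesis c_inv : c (rshift n ord0) * c (rshift n ord_max) = 1.

Fact laurent_eval_ideal a : laurent_ideal k n a -> mpoly_eval a = 0.
Proof.
apply: (gen_idealW (I := kernel mpoly_eval)) => _ ->.
apply: (rmorph_mul_sub1 (f := mpoly_eval)); rewrite -c_inv.
by congr (_ * _); apply: mpoly_eval_var.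
Qed.

Definition laurent_eval : laurent k n -> B := quotAlg_lift laurent_eval_ideal.
HB.instance Definition _ := GRing.isLinear.Build k (laurent k n) B *:%R laurent_eval
  (quotAlg_lift_linear laurent_eval_ideal).
HB.instance Definition _ := GRing.isMonoidMorphism.Build (laurent k n) B laurent_eval
  (quotAlg_lift_monoid_morphism laurent_eval_ideal).

Lemma laurent_eval_pi a : laurent_eval (quotAlg_pi _ a) = mpoly_eval a.
Proof. exact: (quotAlg_liftE laurent_eval_ideal). Qed.

End LaurentMorphism.

Section Laurent.
Variables (k : fieldType) (n : nat).

Definition lgen (i : 'I_(n + 2)) : laurent k n := quotAlg_pi _ (lvar k i).

Lemma laurent_eval_gen (B : algType k) c c_comm c_inv i :
  @laurent_eval k B n c c_comm c_inv (lgen i) = c i.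
Proof. exact: (etrans (laurent_eval_pi c_comm c_inv (lvar k i)) (mpoly_eval_var c i)). Qed.

Lemma laurentC (a b : laurent k n) : a * b = b * a.
Proof.
elim/quotAlg_ind: a => a; elim/quotAlg_ind: b => b.
by rewrite -!quotAlg_piM mulrC.
Qed.

Lemma laurent_inv : lgen (rshift n ord0) * lgen (rshift n ord_max) = 1.
Proof.
rewrite -quotAlg_piM -quotAlg_pi1; apply/quotAlg_eq.
exact: mem_gen_ideal.
Qed.

(** By induction on the degree, dividing a monomial by one of its variables. *)
Lemma mpoly_gen_ind (Q : {mpoly k[n + 2]} -> Prop) :
  Q 1 -> (forall c a b, Q a -> Q b -> Q (c *: a + b)) ->
  (forall a b, Q a -> Q b -> Q (a * b)) -> (forall i, Q (lvar k i)) ->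
  forall a, Q a.
Proof.
move=> Q1 Qlin QM Qvar; have Q0 : Q 0.
  by have := Qlin (-1) 1 1 Q1 Q1; rewrite scaleN1r addNr.
have Qmon (m : 'X_{1..n + 2}) : Q << m >>.
  have [d] := ubnP (mdeg m); elim: d m => [m|d IH m md].
    by rewrite (ltn0 (mdeg m)); discriminate.
  have [/mdeg_eq0I ->|] := posnP (mdeg m); first exact: Q1.
  rewrite mdegE lt0n sum_nat_seq_neq0 => /hasP[i _ /= mi].
  have mE : m = mmul (ucm i) (divcm m (ucm i)).
    apply/eqP/cmP => j; rewrite cmM cmU divcmE ucmE.
    by case: eqP => [<-|_]; rewrite ?subn0 // add1n subn1 prednK // lt0n.
  have -> : << m >> = lvar k i * << divcm m (ucm i) >> :> {mpoly k[n + 2]}.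
    by rewrite [RHS]fgmulUU mulr1 -mE.
  have dE : mdeg m = (mdeg (divcm m (ucm i))).+1 by rewrite {1}mE mdegM mdegU.
  by apply: QM; [exact: Qvar | apply: IH; rewrite dE (ltnS (mdeg _).+1) in md].
move=> a; rewrite [a]monalgE; apply: (big_ind Q); [exact: Q0 | move=> x y Qx Qy | move=> m _].
  by rewrite -[x]scale1r; apply: Qlin; [exact: Qx | exact: Qy].
rewrite malgU_scale -[_ *: _]addr0; apply: Qlin; [exact: Qmon | exact: Q0].
Qed.

Lemma laurent_gen_ind (Q : laurent k n -> Prop) :
  Q 1 -> (forall c a b, Q a -> Q b -> Q (c *: a + b)) ->
  (forall a b, Q a -> Q b -> Q (a * b)) -> (forall i, Q (lgen i)) ->
  forall a, Q a.
Proof.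
move=> Q1 Qlin QM Qgen; elim/quotAlg_ind; apply: mpoly_gen_ind => //.
- by move=> c a b Qa Qb; rewrite quotAlg_piD quotAlg_piZ; apply: Qlin.
- by move=> a b Qa Qb; rewrite quotAlg_piM; apply: QM.
Qed.

End Laurent.

Lemma sum_delta (k : fieldType) (V : lmodType k) n (e : 'I_n -> V) i :
  \sum_j (j == i)%:R *: e j = e i.
Proof.
rewrite (bigD1 i) //= eqxx scale1r big1 ?addr0 // => j /negPf ->.
by rewrite scale0r.
Qed.

Lemma sum_delta2 (k : fieldType) (V : lmodType k) n (e : 'I_n -> V) i j :
  \sum_l ((l == i)%:R + (l == j)%:R) *: e l = e i + e j.
Proof.
by under eq_bigr do rewrite scalerDl; rewrite big_split /= !sum_delta.
Qed.

Lemma sq_anticomm (B : pzRingType) (a b : B) :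
  a * a = 0 -> b * b = 0 -> (a + b) ^+ 2 = 0 -> a * b = - (b * a).
Proof.
move=> aa bb; rewrite expr2 mulrDl !mulrDr aa bb add0r addr0 => /eqP.
by rewrite addr_eq0 => /eqP.
Qed.

Section Exterior.
Variables (k : fieldType) (n : nat).

Definition egen (i : 'I_n) : exterior k n := quotAlg_pi _ (fgen k i).

Lemma freeAlg_gen_ind (X : choiceType) (Q : freeAlg k X -> Prop) :
  Q 1 -> (forall c a b, Q a -> Q b -> Q (c *: a + b)) ->
  (forall a b, Q a -> Q b -> Q (a * b)) -> (forall i, Q (fgen k i)) ->
  forall a, Q a.
Proof.
move=> Q1 Qlin QM Qgen a; have Q0 : Q 0.
  by have := Qlin (-1) 1 1 Q1 Q1; rewrite scaleN1r addNr.
rewrite [a](feval_uniq idfun) /feval; apply: (big_ind Q) => // [x y Qx Qy|w _].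
  by rewrite -[x]scale1r; apply: Qlin.
rewrite -[_ *: _]addr0; apply: Qlin => //.
by rewrite /feval_mon; apply: (big_ind Q) => [||i _]; [exact: Q1 | exact: QM | exact: Qgen].
Qed.

Lemma exterior_gen_ind (Q : exterior k n -> Prop) :
  Q 1 -> (forall c a b, Q a -> Q b -> Q (c *: a + b)) ->
  (forall a b, Q a -> Q b -> Q (a * b)) -> (forall i, Q (egen i)) ->
  forall a, Q a.
Proof.
move=> Q1 Qlin QM Qgen; elim/quotAlg_ind; apply: freeAlg_gen_ind => //.
- by move=> c a b Qa Qb; rewrite quotAlg_piD quotAlg_piZ; apply: Qlin.
- by move=> a b Qa Qb; rewrite quotAlg_piM; apply: QM.
Qed.

Lemma exterior_sq (c : 'I_n -> k) : (\sum_i c i *: egen i) ^+ 2 = 0.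
Proof.
have -> : \sum_i c i *: egen i = quotAlg_pi (ext_ideal k n) (\sum_i c i *: fgen k i).
  by rewrite raddf_sum; apply: eq_bigr => i _; rewrite [RHS]quotAlg_piZ.
rewrite expr2 -quotAlg_piM; apply/quotAlg_pi_eq0/mem_gen_ideal.
by exists c; rewrite expr2.
Qed.

Lemma egen_sq i : egen i * egen i = 0.
Proof.
have := exterior_sq (fun j => (j == i)%:R).
by rewrite (sum_delta egen) expr2.
Qed.

(** Polarization of the relations v^2 = 0. *)
Lemma egen_anticomm i j : egen i * egen j = - (egen j * egen i).
Proof.
have := exterior_sq (fun l => (l == i)%:R + (l == j)%:R).
rewrite (sum_delta2 egen); exact: sq_anticomm (egen_sq i) (egen_sq j).
Qed.

Variables (B : algType k) (c : 'I_n -> B).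
Hypothesis c_anti : forall i j, c i * c j = - (c j * c i).
Hypothesis two_neq0 : (2%:R : k) != 0.

(** For a combination v of anticommuting elements, exchanging the summation
    indices gives v^2 = - v^2; hence v^2 = 0, as 2 is invertible. *)
Fact exterior_eval_ideal a : ext_ideal k n a -> feval c a = 0.
Proof.
apply: (gen_idealW (I := kernel (feval c))) => _ [a0 ->] /=.
rewrite rmorphXn /= raddf_sum /= expr2.
under eq_bigr do rewrite linearZ /= feval_gen.
set s := \sum_i _.
have ss : s * s = - (s * s).
  transitivity (\sum_i \sum_j (a0 i *: c i) * (a0 j *: c j)).
    by rewrite mulr_suml; apply: eq_bigr => i _; rewrite mulr_sumr.
  rewrite [in RHS]mulr_suml exchange_big -sumrN; apply: eq_bigr => i _.
  rewrite mulr_sumr -sumrN; apply: eq_bigr => j _.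
  by rewrite -!(scalerAl, scalerAr) c_anti !scalerN ![a0 j *: _]scalerA
    ![a0 i *: _]scalerA mulrC.
apply: (scalerI two_neq0); rewrite scaler0 scaler_nat mulr2n {1}ss.
exact: addNr.
Qed.

Definition exterior_eval : exterior k n -> B := quotAlg_lift exterior_eval_ideal.
HB.instance Definition _ := GRing.isLinear.Build k (exterior k n) B *:%R exterior_eval
  (quotAlg_lift_linear exterior_eval_ideal).
HB.instance Definition _ := GRing.isMonoidMorphism.Build (exterior k n) B exterior_eval
  (quotAlg_lift_monoid_morphism exterior_eval_ideal).

Lemma exterior_eval_gen i : exterior_eval (egen i) = c i.
Proof. exact: etrans (quotAlg_liftE _ _) (feval_gen _ _). Qed.

End Exterior.

(** * A basis of the associated graded algebra *)

Section GradedBasis.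
Variable k : fieldType.
Local Notation F := (Dfil k).
Local Notation val := (@tletter k).
Local Notation gl := (@gr_letter k).

Definition exponent_weight (t : exponent) : nat := word_weight (exponent_word t).
Local Notation wt := exponent_weight.

Lemma Dfil_mon t : F (wt t) (mon val t).
Proof. by rewrite -word_exponent; apply: Dfil_word; apply: leqnn. Qed.

Lemma gr_mon t : mon gl t = gr_class F (wt t) (mon val t).
Proof. by rewrite -!word_exponent gr_word. Qed.

Lemma class_sum n (I : Type) (s : seq I) (P : pred I) (E : I -> Dtilde k) :
  (forall i, P i -> F n (E i)) ->
  gr_class F n (\sum_(i <- s | P i) E i) = \sum_(i <- s | P i) gr_class F n (E i).
Proof.
move=> FE; apply: (proj1 (_ : _ /\ F n (\sum_(i <- s | P i) E i))).
elim: s => [|i s [IH1 IH2]]; first by rewrite !big_nil class0; split=> //; exact: fil0.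
rewrite !big_cons; case: ifP => [Pi|_]; last by split.
by split; [rewrite classD // ?IH1 //; apply: FE | apply: filD => //; apply: FE].
Qed.

Definition component (c : exponent -> k) (s : seq exponent) (n : nat) : Dtilde k :=
  \sum_(t <- s | wt t == n) c t *: mon val t.

Lemma Dfil_component c s n : F n (component c s n).
Proof.
rewrite /component; elim/big_ind: _ => [|a b Fa Fb|t /eqP <-].
- exact: fil0.
- exact: filD.
- by apply: filZ; apply: Dfil_mon.
Qed.

Lemma class_components c s N : all (fun t => wt t < N)%N s ->
  \sum_(n < N) gr_class F n (component c s n) = \sum_(t <- s) c t *: mon gl t.
Proof.
move=> sN; under eq_bigr => n _.
  rewrite class_sum; last by move=> t /eqP <-; apply: filZ; apply: Dfil_mon.
  over.
rewrite (exchange_big_dep xpredT) //= [LHS]big_seq [RHS]big_seq.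
apply: eq_bigr => t ts; have tN := allP sN _ ts.
rewrite (big_pred1 (Ordinal tN)) => [|n]; last by rewrite [RHS]/= -(inj_eq val_inj) /= eq_sym.
by rewrite gr_mon classZ //; apply: Dfil_mon.
Qed.

Lemma seq_bound (s : seq exponent) m : exists2 N, (m < N)%N & all (fun t => wt t < N)%N s.
Proof.
elim: s => [|t s [N mN sN]]; first by exists m.+1.
exists (maxn N (wt t).+1); first by rewrite leq_max mN.
rewrite /= leq_max leqnn orbT /=; apply: sub_all sN => t' t'N.
by rewrite leq_max t'N.
Qed.

Lemma span_sum_light n (s : seq (k * seq letter)) : all (fun c => light n c.2) s ->
  F n (\sum_(c <- s) c.1 *: word val c.2).
Proof. by move=> sn; exists s. Qed.

(** A class of degree n is a sum of classes of words of weight at most n; the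
    lighter ones vanish, and the others are products of classes of letters,
    which can be ordered. *)
Lemma gr_span x : in_span (mon gl) predT x.
Proof.
have [N [a [Fa ->]]] := class_decomposition x.
apply: span_sum => n _; have [s sl ->] := Fa n; elim: s sl => [|[c w] s IH] /=.
  by rewrite big_nil class0 => _; apply: span0.
move=> /andP[wn sn]; rewrite big_cons /= class_lin; last first.
- by apply: (span_sum_light sn).
- exact: Dfil_word.
apply: spanD; last exact: IH; apply: spanZ.
case: (ltngtP (word_weight w) n) => [lt|gt|<-].
- rewrite class_eq0; [exact: span0 | exact: Dfil_word |].
  move: (nat_of_ord n) lt => [|j] lt; first by rewrite ltn0 in lt.
  exact: (Dfil_word k lt).
- by rewrite /light leqNgt gt in wn.
- by rewrite -gr_word; apply: span_word; apply: gr_supercommutative.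
Qed.

(** By induction on m: the class of a is a combination of monomials of the
    graded algebra, and subtracting the part of weight m of the corresponding
    combination in the double lowers the degree of a. *)
Lemma Dfil_span m a : F m a -> in_span (mon val) (fun t => wt t <= m)%N a.
Proof.
elim/ltn_ind: m a => m IH a Fa.
have [s [c [_ _ classE]]] := span_uniq (gr_span (gr_class F m a)).
have [N mN sN] := seq_bound s m.
(* The difference of a and the whole combination, sorted by weight. *)
pose b n := (if n == m then a else 0) - component c s n.
have Fb n : F n (b n).
  rewrite /b addrC -scaleN1r; apply: filP; first exact: Dfil_component.
  by case: eqP => [->|_] //; apply: fil0.
have b0 : \sum_(n < N) gr_class F n (b n) = 0.
  transitivity (\sum_(n < N) (gr_class F n (if n == m :> nat then a else 0)
      - gr_class F n (component c s n))).
    apply: eq_bigr => n _; rewrite /b addrC -scaleN1r class_lin ?scaleN1r 1?addrC //.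
      exact: Dfil_component.
    by case: eqP => [->|_] //; apply: fil0.
  rewrite sumrB class_components // -classE (bigD1 (Ordinal mN)) //= eqxx.
  rewrite big1 ?addr0 ?subrr // => n; rewrite -val_eqE /= => /negPf ->.
  exact: class0.
have low := class_independent Fb b0 mN; rewrite /b eqxx in low.
have -> : a = (a - component c s m) + component c s m by rewrite subrK.
apply: spanD; last first.
  by apply: span_sum => t /eqP <-; apply: spanZ; apply: span_gen => /=.
case: m {Fa classE mN b Fb b0} IH low => [|m] IH /= low.
  by rewrite low; apply: span0.
have := IH m (leqnn _) _ low; elim/span_ind => [|e x y|t tm].
- exact: span0.
- by move=> hx hy; apply: spanD => //; apply: spanZ.
- by apply: span_gen; apply: leqW.
Qed.

Lemma tcoord0 t : tcoord t (0 : Dtilde k) = 0.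
Proof.
have e : (-1) *: (0 : Dtilde k) + 0 = 0 by rewrite scaler0 addr0.
by rewrite -e tcoord_lin mulN1r addNr.
Qed.

(** Ordered monomials of smaller weight span the lower part of the filtration,
    and none of them is t. *)
Lemma tcoord_low t a : fil_pred F (wt t) a -> tcoord t a = 0.
Proof.
case E: (wt t) => [|n] /=; first by move=> ->; exact: tcoord0.
move=> /Dfil_span; elim/span_ind => [|c x y hx hy|t' t'n].
- exact: tcoord0.
- by rewrite tcoord_lin hx hy mulr0 addr0.
- by rewrite tcoord_mon; case: eqP => // tt'; rewrite tt' E ltnn in t'n.
Qed.

Lemma tcoord_sum t (I : Type) (s : seq I) (P : pred I) (c : I -> k) (E : I -> Dtilde k) :
  tcoord t (\sum_(i <- s | P i) c i *: E i) = \sum_(i <- s | P i) c i * tcoord t (E i).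
Proof.
elim/big_rec2: _ => [|i x y _ <-]; first exact: tcoord0.
by rewrite tcoord_lin.
Qed.

(** A relation between monomials of the graded algebra splits by degree; in
    each degree it says that a combination of monomials of the double lies
    lower in the filtration, where the coordinates in question vanish. *)
Lemma gr_mon_independent (s : seq exponent) (c : exponent -> k) : uniq s ->
  \sum_(t <- s) c t *: mon gl t = 0 -> forall t, t \in s -> c t = 0.
Proof.
move=> us s0 t ts; have [N tN sN] := seq_bound s (wt t).
rewrite -(class_components c sN) in s0.
have := class_independent (Dfil_component c s) s0 tN => /tcoord_low.
rewrite tcoord_sum -big_filter (bigD1_seq t) ?mem_filter ?eqxx ?filter_uniq //=.
rewrite tcoord_mon eqxx mulr1 big1 ?addr0 // => t' t't.
by rewrite tcoord_mon (negPf t't) mulr0.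
Qed.

End GradedBasis.

(** * The tensor product *)

Section TensorMorphism.
Variables (k : fieldType) (L E B : algType k).
Variables (phi : {lrmorphism L -> B}) (psi : {lrmorphism E -> B}).
Hypothesis phi_psi : forall a b, GRing.comm (phi a) (psi b).

Let sym (p : L * E) : B := phi p.1 * psi p.2.

Lemma tsym_eval a b : feval sym (tsym a b) = phi a * psi b.
Proof. exact: feval_gen. Qed.

Lemma tensor_rel_eval a b : tensor_rel (A := L) (B := E) a b -> feval sym a = feval sym b.
Proof.
case=> [x x' y|x y y'|c x y|c x y|x x' y y'|].
- by rewrite rmorphD /= !tsym_eval rmorphD mulrDl.
- by rewrite rmorphD /= !tsym_eval rmorphD mulrDr.
- by rewrite [RHS]linearZ /= !tsym_eval linearZ scalerAl.
- by rewrite [RHS]linearZ /= !tsym_eval linearZ scalerAr.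
- rewrite rmorphM /= !tsym_eval !rmorphM.
  by rewrite -!mulrA; congr (_ * _); rewrite !mulrA phi_psi.
- by rewrite tsym_eval !rmorph1 mulr1.
Qed.

Fact tensor_eval_ideal f : relIdeal (@tensor_rel k L E) f -> feval sym f = 0.
Proof.
apply: (gen_idealW (I := kernel (feval sym))) => _ [a [b [ab ->]]] /=.
by rewrite rmorphB /= (tensor_rel_eval ab) subrr.
Qed.

Definition tensor_eval : tensor L E -> B := quotAlg_lift tensor_eval_ideal.

Definition tens (a : L) (b : E) : tensor L E := quotAlg_pi _ (tsym a b).

Lemma tensor_eval_tens a b : tensor_eval (tens a b) = phi a * psi b.
Proof. exact: etrans (quotAlg_liftE tensor_eval_ideal _) (tsym_eval _ _). Qed.

(** Commuting morphisms to a nonzero algebra show that the tensor product is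
    nonzero; the target used below is the graded algebra. *)
Lemma tensor_neq0 : 1 != 0 :> tensor L E.
Proof. exact/quotAlg_neq0/(relIdeal_proper (rho := sym))/tensor_rel_eval. Qed.

End TensorMorphism.

Section TensorSymbols.
Variables (k : fieldType) (L E : algType k).
Local Notation tens := (@tens k L E).

Lemma tens_eq f h : tensor_rel f h -> quotAlg_pi (relIdeal (@tensor_rel k L E)) f
  = quotAlg_pi (relIdeal (@tensor_rel k L E)) h.
Proof. by move=> fh; apply/quotAlg_eq/mem_gen_ideal; exists f, h. Qed.

Lemma tensDl a a' b : tens (a + a') b = tens a b + tens a' b.
Proof. by rewrite -quotAlg_piD; apply: tens_eq; apply: TensorDl. Qed.
Lemma tensDr a b b' : tens a (b + b') = tens a b + tens a b'.
Proof. by rewrite -quotAlg_piD; apply: tens_eq; apply: TensorDr. Qed.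
Lemma tensZl c a b : tens (c *: a) b = c *: tens a b.
Proof. by rewrite -quotAlg_piZ; apply: tens_eq; apply: TensorZl. Qed.
Lemma tensZr c a b : tens a (c *: b) = c *: tens a b.
Proof. by rewrite -quotAlg_piZ; apply: tens_eq; apply: TensorZr. Qed.
Lemma tensM a a' b b' : tens a b * tens a' b' = tens (a * a') (b * b').
Proof. by rewrite -quotAlg_piM; apply: tens_eq; apply: TensorM. Qed.
Lemma tens1 : tens 1 1 = 1.
Proof. by rewrite -quotAlg_pi1; apply: tens_eq; apply: Tensor1. Qed.
Lemma tensNr a b : tens a (- b) = - tens a b.
Proof. by rewrite -scaleN1r tensZr scaleN1r. Qed.
Lemma tens0r a : tens a 0 = 0.
Proof. by rewrite -(scale0r 0) tensZr scale0r. Qed.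

Lemma tens_comm a a' : a * a' = a' * a ->
  tens a 1 * tens a' 1 = tens a' 1 * tens a 1.
Proof. by move=> aa'; rewrite !tensM aa'. Qed.
Lemma tens_mixed a b : tens a 1 * tens 1 b = tens 1 b * tens a 1.
Proof. by rewrite !tensM !mul1r !mulr1. Qed.
Lemma tens_anticomm b b' : b * b' = - (b' * b) ->
  tens 1 b * tens 1 b' = - (tens 1 b' * tens 1 b).
Proof. by move=> bb'; rewrite !tensM bb' tensNr. Qed.
Lemma tens_sq b : b * b = 0 -> tens 1 b * tens 1 b = 0.
Proof. by move=> bb; rewrite tensM bb tens0r. Qed.
Lemma tens_inv a a' : a * a' = 1 -> tens a 1 * tens a' 1 = 1.
Proof. by move=> aa'; rewrite tensM aa' mulr1 tens1. Qed.
Lemma tens_split a b : tens a b = tens a 1 * tens 1 b.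
Proof. by rewrite tensM mulr1 mul1r. Qed.
Lemma tensMl a a' : tens (a * a') 1 = tens a 1 * tens a' 1.
Proof. by rewrite tensM mulr1. Qed.
Lemma tensMr b b' : tens 1 (b * b') = tens 1 b * tens 1 b'.
Proof. by rewrite tensM mulr1. Qed.

End TensorSymbols.

Lemma comm_lin (k : fieldType) (B : algType k) (c : k) (x a b : B) :
  GRing.comm x a -> GRing.comm x b -> GRing.comm x (c *: a + b).
Proof.
move=> xa xb; apply: commrD => //.
by rewrite /GRing.comm -scalerAr xa scalerAl.
Qed.

Section Isomorphism.
Variable k : fieldType.
Hypothesis two_neq0 : (2%:R : k) != 0.
Local Notation B := (gr (Dfil k)).
Local Notation gl := (@gr_letter k).
Local Notation L := (laurent k 5).
Local Notation E := (exterior k 4).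
Local Notation T := (tensor L E).

Let gs := gr_supercommutative k.

(** The letters that X_1, ..., X_5, T and T^-1 stand for, then those for Y_1,
    ..., Y_4. *)
Definition even_letters := [:: Lz; Lw; Ly; Lu; Lzeta; Lg; Lgi].
Definition odd_letters := [:: Lx1; Lv1; Lx2; Lv2].

Definition even_class (i : 'I_(5 + 2)) : B := gl (nth Lg even_letters i).
Definition odd_class (i : 'I_4) : B := gl (nth Lx1 odd_letters i).

Lemma even_letter_nth (i : 'I_(5 + 2)) : odd_letter (nth Lg even_letters i) = false.
Proof. by case: i => [[|[|[|[|[|[|[|]]]]]]]]. Qed.
Lemma odd_letter_nth (i : 'I_4) : odd_letter (nth Lx1 odd_letters i).
Proof. by case: i => [[|[|[|[|]]]]]. Qed.

Fact even_class_comm i j : GRing.comm (even_class i) (even_class j).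
Proof.
rewrite /GRing.comm /even_class (super_comm gs) even_letter_nth.
exact: scale1r.
Qed.
Fact even_class_inv : even_class (rshift 5 ord0) * even_class (rshift 5 ord_max) = 1.
Proof. exact: super_gi gs. Qed.
Fact odd_class_anti i j : odd_class i * odd_class j = - (odd_class j * odd_class i).
Proof.
rewrite /odd_class (super_comm gs) !odd_letter_nth.
exact: scaleN1r.
Qed.

Definition laurent_to_gr : L -> B := laurent_eval even_class_comm even_class_inv.
Definition exterior_to_gr : E -> B := exterior_eval odd_class_anti two_neq0.
HB.instance Definition _ := GRing.LRMorphism.copy laurent_to_gr
  (laurent_eval even_class_comm even_class_inv).
HB.instance Definition _ := GRing.LRMorphism.copy exterior_to_gr
  (exterior_eval odd_class_anti two_neq0).

Lemma laurent_to_gr_gen i : laurent_to_gr (lgen k i) = even_class i.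
Proof. exact: laurent_eval_gen. Qed.
Lemma exterior_to_gr_gen i : exterior_to_gr (egen k i) = odd_class i.
Proof. exact: exterior_eval_gen. Qed.

Lemma laurent_to_gr_lin c a a' :
  laurent_to_gr (c *: a + a') = c *: laurent_to_gr a + laurent_to_gr a'.
Proof. exact: (quotAlg_lift_linear (laurent_eval_ideal _ even_class_inv)). Qed.
Lemma laurent_to_grM a a' : laurent_to_gr (a * a') = laurent_to_gr a * laurent_to_gr a'.
Proof. exact: (quotAlg_lift_monoid_morphism (laurent_eval_ideal _ even_class_inv)).2. Qed.
Lemma laurent_to_gr1 : laurent_to_gr 1 = 1.
Proof. exact: (quotAlg_lift_monoid_morphism (laurent_eval_ideal _ even_class_inv)).1. Qed.
Lemma exterior_to_gr_lin c b b' :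
  exterior_to_gr (c *: b + b') = c *: exterior_to_gr b + exterior_to_gr b'.
Proof. exact: (quotAlg_lift_linear (exterior_eval_ideal _ _)). Qed.
Lemma exterior_to_grM b b' : exterior_to_gr (b * b') = exterior_to_gr b * exterior_to_gr b'.
Proof. exact: (quotAlg_lift_monoid_morphism (exterior_eval_ideal _ _)).2. Qed.
Lemma exterior_to_gr1 : exterior_to_gr 1 = 1.
Proof. exact: (quotAlg_lift_monoid_morphism (exterior_eval_ideal _ _)).1. Qed.

Lemma laurent_exterior_comm a b : GRing.comm (laurent_to_gr a) (exterior_to_gr b).
Proof.
elim/exterior_gen_ind: b => [|c b b' h h'|b b' h h'|j].
- by rewrite exterior_to_gr1; apply: commr1.
- rewrite (exterior_to_gr_lin c b b'); exact: comm_lin h h'.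
- rewrite (exterior_to_grM b b'); exact: commrM h h'.
apply: commr_sym; elim/laurent_gen_ind: a => [|c a a' h h'|a a' h h'|i].
- by rewrite laurent_to_gr1; apply: commr1.
- rewrite (laurent_to_gr_lin c a a'); exact: comm_lin h h'.
- rewrite (laurent_to_grM a a'); exact: commrM h h'.
rewrite /GRing.comm laurent_to_gr_gen exterior_to_gr_gen /odd_class /even_class (super_comm gs).
by rewrite even_letter_nth andbF; apply: scale1r.
Qed.

(** A copy of the tensor product that carries the structure of an algebra;
    this structure includes the fact that 1 is not 0, which is known once
    there is a morphism to the graded algebra. *)
Definition tensor_alg := T.
HB.instance Definition _ := GRing.PzRing.on tensor_alg.
HB.instance Definition _ := GRing.Lmodule.on tensor_alg.
Fact tensor_alg_neq0 : 1 != 0 :> tensor_alg. Proof. exact: tensor_neq0 laurent_exterior_comm. Qed.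
HB.instance Definition _ := GRing.PzSemiRing_isNonZero.Build tensor_alg tensor_alg_neq0.
HB.instance Definition _ := GRing.Lmodule_isLalgebra.Build k tensor_alg
  (@quotAlg_scaleAl _ _ (relIdeal (@tensor_rel k L E))).
HB.instance Definition _ := GRing.Lalgebra_isAlgebra.Build k tensor_alg
  (@quotAlg_scaleAr _ _ (relIdeal (@tensor_rel k L E))).

Definition tensor_to_gr : tensor_alg -> B := tensor_eval laurent_exterior_comm.
HB.instance Definition _ := GRing.isLinear.Build k tensor_alg B *:%R tensor_to_gr
  (quotAlg_lift_linear (tensor_eval_ideal laurent_exterior_comm)).
HB.instance Definition _ := GRing.isMonoidMorphism.Build tensor_alg B tensor_to_gr
  (quotAlg_lift_monoid_morphism (tensor_eval_ideal laurent_exterior_comm)).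

Definition even_index (l : letter) : 'I_(5 + 2) := @inord 6 (index l even_letters).

Definition tens_letter (l : letter) : tensor_alg :=
  if odd_letter l then tens 1 (egen k (inord (index l odd_letters)))
  else tens (lgen k (even_index l)) 1.

Lemma tensor_to_gr_letter l : tensor_to_gr (tens_letter l) = gl l.
Proof.
rewrite /tens_letter /tensor_to_gr; case ol: (odd_letter l).
  rewrite (tensor_eval_tens laurent_exterior_comm).
  transitivity (1 * odd_class (inord (index l odd_letters))).
    by congr (_ * _); [exact: laurent_to_gr1 | exact: exterior_to_gr_gen].
  rewrite mul1r /odd_class inordK; last by case: l ol.
  by rewrite nth_index //; case: l ol.
rewrite (tensor_eval_tens laurent_exterior_comm).
transitivity (even_class (even_index l) * 1).
  by congr (_ * _); [exact: laurent_to_gr_gen | exact: exterior_to_gr1].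
rewrite mulr1 /even_class /even_index inordK; last by case: l ol.
by rewrite nth_index //; case: l ol.
Qed.

Lemma tens_supercommutative : supercommutative tens_letter.
Proof.
split=> [l l'|l ol|].
- rewrite /tens_letter; case ol: (odd_letter l); case ol': (odd_letter l').
  + by apply: etrans (esym (scaleN1r _)); apply: tens_anticomm; apply: egen_anticomm.
  + by apply: etrans (esym (scale1r _)); apply: esym; apply: tens_mixed.
  + by apply: etrans (esym (scale1r _)); apply: tens_mixed.
  + by apply: etrans (esym (scale1r _)); apply: tens_comm; apply: laurentC.
- by rewrite /tens_letter ol; apply: tens_sq; apply: egen_sq.
- have e1 : even_index Lg = rshift 5 ord0 by apply: val_inj; rewrite /= inordK.
  have e2 : even_index Lgi = rshift 5 ord_max by apply: val_inj; rewrite /= inordK.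
  rewrite /tens_letter [odd_letter Lg]/= [odd_letter Lgi]/= e1 e2.
  exact: tens_inv (laurent_inv k 5).
Qed.

Lemma even_indexK (i : 'I_(5 + 2)) : even_index (nth Lg even_letters i) = i.
Proof. by apply: val_inj; case: i => [[|[|[|[|[|[|[|]]]]]]]] //= ?; rewrite inordK. Qed.

Lemma odd_indexK (i : 'I_4) : inord (index (nth Lx1 odd_letters i) odd_letters) = i.
Proof. by apply: val_inj; case: i => [[|[|[|[|]]]]] //= ?; rewrite inordK. Qed.

Lemma lgen_letter (i : 'I_(5 + 2)) :
  tens_letter (nth Lg even_letters i) = tens (lgen k i) 1.
Proof. by rewrite /tens_letter even_letter_nth even_indexK. Qed.

Lemma egen_letter (i : 'I_4) : tens_letter (nth Lx1 odd_letters i) = tens 1 (egen k i).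
Proof. by rewrite /tens_letter odd_letter_nth odd_indexK. Qed.

Local Notation WS := (in_span (word tens_letter) predT).

Lemma wspanM (a b : tensor_alg) : WS a -> WS b -> WS (a * b).
Proof.
move=> Wa Wb; apply: span_mulr Wa => s _; apply: span_mull Wb => t _.
by rewrite -word_cat; apply: span_gen.
Qed.

Lemma wspan1 : WS 1.
Proof. by exists [:: (1, [::])] => //; rewrite big_seq1 scale1r /word big_nil. Qed.

Lemma wspan_letter l : WS (tens_letter l).
Proof.
have -> : tens_letter l = word tens_letter [:: l] by rewrite /word big_seq1.
exact: span_gen.
Qed.

Lemma wspan_left (a : L) : WS (tens a 1).
Proof.
elim/laurent_gen_ind: a => [|c a b Wa Wb|a b Wa Wb|i].
- by rewrite tens1; apply: wspan1.
- by rewrite tensDl tensZl; apply: spanD => //; apply: spanZ.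
- by rewrite (tensMl E a b); exact: wspanM Wa Wb.
- by rewrite -lgen_letter; apply: wspan_letter.
Qed.

Lemma wspan_right (b : E) : WS (tens 1 b).
Proof.
elim/exterior_gen_ind: b => [|c a b Wa Wb|a b Wa Wb|i].
- by rewrite tens1; apply: wspan1.
- by rewrite tensDr tensZr; apply: spanD => //; apply: spanZ.
- by rewrite (tensMr L a b); exact: wspanM Wa Wb.
- by rewrite -egen_letter; apply: wspan_letter.
Qed.

(** Pure tensors factor as (a (x) 1) (1 (x) b), so that words in the
    generators of the two factors span; supercommutativity orders them. *)
Lemma tensor_span (x : tensor_alg) : in_span (mon tens_letter) predT x.
Proof.
suff : WS x.
  elim/span_ind => [|c a b ha hb|s _]; first exact: span0.
    by apply: spanD => //; apply: spanZ.
  exact: span_word tens_supercommutative s.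
elim/quotAlg_ind: x; elim/freeAlg_gen_ind => [|c a b Wa Wb|a b Wa Wb|[a b]].
- exact: wspan1.
- by rewrite quotAlg_piD quotAlg_piZ; apply: spanD => //; apply: spanZ.
- by rewrite quotAlg_piM; apply: wspanM.
- rewrite -/(tsym a b) -/(tens a b) tens_split.
  exact: wspanM (wspan_left a) (wspan_right b).
Qed.
End Isomorphism.

(** * The graded isomorphism *)

Section GradedIso.
Variable k : fieldType.
Hypothesis two_neq0 : (2%:R : k) != 0.
Local Notation B := (gr (Dfil k)).
Local Notation T := (tensor (laurent k 5) (exterior k 4)).
Local Notation tensor_alg := (tensor_alg k).
Local Notation G := (tensor_to_gr two_neq0).
Local Notation gl := (@gr_letter k).
Local Notation tl := (@tens_letter k).

Lemma tensor_to_gr_lin c x y : G (c *: x + y) = c *: G x + G y.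
Proof. exact: quotAlg_lift_linear. Qed.

Lemma tensor_to_gr_mul x y : G (x * y) = G x * G y.
Proof. exact: (quotAlg_lift_monoid_morphism (tensor_eval_ideal _)).2. Qed.

Lemma tensor_to_gr_mon t : G (mon tl t) = mon gl t.
Proof.
have letters : G \o tl = gl.
  by apply: funext => l; apply: tensor_to_gr_letter.
apply: etrans (congr1 (fun f => mon f t) letters); apply: mon_morph.
exact: (quotAlg_lift_monoid_morphism (tensor_eval_ideal _)).
Qed.

Lemma tensor_to_gr0 : G 0 = 0.
Proof. exact: raddf0. Qed.

Lemma tensor_to_gr_sum (s : seq exponent) (c : exponent -> k) :
  G (\sum_(t <- s) c t *: mon tl t) = \sum_(t <- s) c t *: mon gl t.
Proof.
elim/big_rec2: _ => [|t x y _ IH]; first exact: tensor_to_gr0.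
by rewrite [LHS]tensor_to_gr_lin IH tensor_to_gr_mon.
Qed.

Lemma tensor_to_gr_ker x : G x = 0 -> x = 0.
Proof.
have [s [c [us _ ->]]] := span_uniq (tensor_span two_neq0 x).
rewrite tensor_to_gr_sum => /(gr_mon_independent us) c0.
by rewrite big_seq big1 // => t /c0 ->; rewrite scale0r.
Qed.

Lemma tensor_to_gr_inj : injective G.
Proof.
move=> x y xy; apply/eqP; rewrite -subr_eq0; apply/eqP/tensor_to_gr_ker.
by rewrite -scaleN1r addrC [LHS]tensor_to_gr_lin xy scaleN1r addNr.
Qed.

Lemma tensor_to_gr_surj y : exists x, G x = y.
Proof.
have [s [c [_ _ ->]]] := span_uniq (gr_span y).
by exists (\sum_(t <- s) c t *: mon tl t); apply: tensor_to_gr_sum.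
Qed.

(** The morphism [tensor_to_gr] maps the ordered monomials of the tensor
    product, which span, to those of the graded algebra, which are independent
    and span; the isomorphism is its inverse. *)
Theorem gr_Dfil_iso : exists f : B -> T,
  [/\ linear f, monoid_morphism f & bijective f].
Proof.
have [f Gf] := choice tensor_to_gr_surj.
have fG : cancel G f by move=> x; apply: tensor_to_gr_inj; rewrite Gf.
exists f; split; last by exists G.
- by move=> c x y; apply: tensor_to_gr_inj; rewrite Gf [RHS]tensor_to_gr_lin !Gf.
- split=> [|x y]; apply: tensor_to_gr_inj; rewrite Gf.
    exact/esym/rmorph1.
  by rewrite [RHS]tensor_to_gr_mul !Gf.
Qed.
End GradedIso.

(** * Iterated extensions and noetherianity *)

Section OreExtension.
Variable B : pzRingType.

Record subring (P : B -> Prop) : Prop := Subring {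
  subring1 : P 1;
  subringB : forall a b, P a -> P b -> P (a - b);
  subringM : forall a b, P a -> P b -> P (a * b) }.

Section SubringTheory.
Variables (P : B -> Prop) (sP : subring P).

Lemma subring0 : P 0.
Proof. by rewrite -(subrr 1); apply: (subringB sP); apply: subring1. Qed.
Lemma subringN a : P a -> P (- a).
Proof. by move=> Pa; rewrite -[- a]add0r; apply: (subringB sP) => //; apply: subring0. Qed.
Lemma subringD a b : P a -> P b -> P (a + b).
Proof. by move=> Pa Pb; rewrite -[b]opprK; apply: (subringB sP) => //; apply: subringN. Qed.
End SubringTheory.

(** Left ideals of a subring given as a predicate: every stage of the tower of
    extensions lives in the same ring. *)
Definition ideal_in (P J : B -> Prop) : Prop :=
  [/\ J 0, forall a b, J a -> J b -> J (a + b), forall a b, P a -> J b -> J (a * b)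
    & forall a, J a -> P a].

Definition noetherian_in (P : B -> Prop) : Prop :=
  forall J : nat -> B -> Prop,
    (forall n, ideal_in P (J n)) -> (forall n a, J n a -> J n.+1 a) ->
  exists N, forall n a, (N <= n)%N -> J n a -> J N a.

Lemma chain_le (J : nat -> B -> Prop) : (forall n a, J n a -> J n.+1 a) ->
  forall m n a, (m <= n)%N -> J m a -> J n a.
Proof. by move=> incJ m n a /subnK <-; elim: (n - m)%N => // j IH /IH; apply: incJ. Qed.

Definition left_ore (P : B -> Prop) (t a : B) : Prop :=
  exists a1 a0, [/\ P a1, P a0 & t * a = a1 * t + a0].
Definition right_ore (P : B -> Prop) (t a : B) : Prop :=
  exists a1 a0, [/\ P a1, P a0 & a * t = t * a1 + a0].

Section Extension.
Variables (P : B -> Prop) (t : B).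

(** Polynomials in t of degree less than n with right coefficients in P.  The
    powers of t may well be dependent over P, so that an element has no degree
    but only bounds for it. *)
Definition degree_lt (n : nat) (b : B) : Prop :=
  exists2 c : nat -> B, forall i, P (c i) & b = \sum_(i < n) t ^+ i * c i.

Definition extension (b : B) : Prop := exists n, degree_lt n b.

Hypotheses (sP : subring P).

Lemma degree_lt0 b : degree_lt 0 b -> b = 0.
Proof. by move=> [c _ ->]; rewrite big_ord0. Qed.

Lemma degree_lt_zero n : degree_lt n 0.
Proof.
exists (fun=> 0) => [_|]; first exact: subring0.
by rewrite big1 // => i _; rewrite mulr0.
Qed.

Lemma degree_ltB n a b : degree_lt n a -> degree_lt n b -> degree_lt n (a - b).
Proof.
move=> [c Pc ->] [d Pd ->]; exists (fun i => c i - d i).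
  by move=> i; apply: (subringB sP).
by rewrite -sumrB; apply: eq_bigr => i _; rewrite mulrBr.
Qed.

Lemma degree_ltN n a : degree_lt n a -> degree_lt n (- a).
Proof. by move=> na; rewrite -[- a]add0r; apply: degree_ltB (degree_lt_zero n) na. Qed.

Lemma degree_ltD n a b : degree_lt n a -> degree_lt n b -> degree_lt n (a + b).
Proof. by move=> na nb; rewrite -[b]opprK; apply: degree_ltB na (degree_ltN nb). Qed.

Lemma degree_ltMr n a b : degree_lt n a -> P b -> degree_lt n (a * b).
Proof.
move=> [c Pc ->] Pb; exists (fun i => c i * b); first by move=> i; apply: (subringM sP).
by rewrite mulr_suml; apply: eq_bigr => i _; rewrite mulrA.
Qed.

Lemma degree_lt_monomial n a : P a -> degree_lt n.+1 (t ^+ n * a).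
Proof.
move=> Pa; exists (fun i => if i == n then a else 0).
  by move=> i; case: eqP => // _; apply: subring0.
rewrite big_ord_recr /= eqxx big1 ?add0r // => i _.
by rewrite ltn_eqF // mulr0.
Qed.

Lemma degree_ltS n a : degree_lt n a -> degree_lt n.+1 a.
Proof.
move=> [c Pc ->]; exists (fun i => if (i < n)%N then c i else 0).
  by move=> i; case: ifP => // _; apply: subring0.
rewrite big_ord_recr /= ltnn mulr0 addr0.
by apply: eq_bigr => i _; rewrite ltn_ord.
Qed.

Lemma degree_lt_le m n a : (m <= n)%N -> degree_lt m a -> degree_lt n a.
Proof. by move/subnK <-; elim: (n - m)%N => // j IH /IH; apply: degree_ltS. Qed.

Lemma degree_lt_mult n a : degree_lt n a -> degree_lt n.+1 (t * a).
Proof.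
move=> [c Pc ->]; exists (fun i => if i is i'.+1 then c i' else 0).
  by case=> // ; apply: subring0.
rewrite big_ord_recl mulr0 add0r mulr_sumr; apply: eq_bigr => i _ /=.
by rewrite exprS mulrA.
Qed.

Lemma degree_lt_multX i n a : degree_lt n a -> degree_lt (i + n)%N (t ^+ i * a).
Proof.
move=> na; elim: i => [|i IH]; first by rewrite mul1r.
by rewrite exprS -mulrA addSn; apply: degree_lt_mult.
Qed.

Lemma degree_lt_lead n b : degree_lt n.+1 b ->
  exists2 a, P a & degree_lt n (b - t ^+ n * a).
Proof.
move=> [c Pc ->]; exists (c n) => //; rewrite big_ord_recr addrK.
by exists c.
Qed.

Hypotheses (lt : forall a, P a -> left_ore P t a).
Hypotheses (rt : forall a, P a -> right_ore P t a).

Lemma degree_lt_coef n a : P a -> degree_lt n.+1 (a * t ^+ n).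
Proof.
elim: n a => [|n IH] a Pa.
  by rewrite mulr1 -[a]mul1r -(expr0 t); apply: degree_lt_monomial.
have [a1 [a0 [Pa1 Pa0 ta]]] := rt Pa.
rewrite exprS mulrA ta mulrDl -mulrA; apply: degree_ltD; last exact/degree_ltS/IH.
exact/degree_lt_mult/IH.
Qed.

Lemma degree_ltMl n a b : P a -> degree_lt n b -> degree_lt n (a * b).
Proof.
move=> Pa [c Pc ->]; rewrite mulr_sumr.
apply: (big_ind (degree_lt n)) => [|x y|i _]; [exact: degree_lt_zero | exact: degree_ltD |].
rewrite mulrA; apply: degree_ltMr => //.
exact: degree_lt_le (ltn_ord i) (degree_lt_coef _ Pa).
Qed.

(** Every element x of P can be moved across t^n at the cost of replacing it
    by another y of P on the left, up to lower degree; this is what makes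
    leading coefficients a left ideal. *)
Lemma commute_power n x : P x -> exists2 y, P y & degree_lt n (y * t ^+ n - t ^+ n * x).
Proof.
move=> Px; elim: n => [|n [y Py ny]].
  by exists x => //; rewrite mul1r mulr1 subrr; apply: degree_lt_zero.
have [y1 [y0 [Py1 Py0 ty]]] := lt Py; exists y1 => //.
have -> : y1 * t ^+ n.+1 - t ^+ n.+1 * x
    = t * (y * t ^+ n - t ^+ n * x) - y0 * t ^+ n.
  by rewrite mulrBr !mulrA ty mulrDl addrAC addrK exprS mulrA.
by apply: degree_ltB (degree_lt_mult ny) (degree_lt_coef _ Py0).
Qed.

Lemma extension_subring : subring extension.
Proof.
split=> [|a b [m ma] [n nb]|a b [m ma] [n [c Pc ->]]].
- exists 1%N; rewrite -[1](mulr1 (t ^+ 0)); apply: degree_lt_monomial.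
  exact: subring1.
- exists (maxn m n); apply: degree_ltB; apply: degree_lt_le.
  + exact: leq_maxl.
  + exact: ma.
  + exact: leq_maxr.
  + exact: nb.
have ext0 : extension 0 by exists 0%N; apply: degree_lt_zero.
have extD x y : extension x -> extension y -> extension (x + y).
  move=> [i ix] [j jy]; exists (maxn i j); apply: degree_ltD; apply: degree_lt_le.
  + exact: leq_maxl.
  + exact: ix.
  + exact: leq_maxr.
  + exact: jy.
case: ma => d Pd ->; rewrite mulr_suml; apply: (big_ind extension) => // i _.
rewrite mulr_sumr; apply: (big_ind extension) => // j _.
exists (i + j.+1)%N; rewrite -mulrA [d i * _]mulrA; apply: degree_lt_multX.
by apply: degree_ltMr (Pc j); apply: degree_lt_coef.
Qed.

Lemma extension_base a : P a -> extension a.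
Proof. by move=> Pa; exists 1%N; rewrite -[a]mul1r -(expr0 t); apply: degree_lt_monomial. Qed.

Lemma extension_gen : extension t.
Proof.
by exists 2%N; rewrite -[t]mulr1; apply: (@degree_lt_monomial 1); apply: subring1.
Qed.

(** The leading ideal of J in degree n; the coefficients being on the right of
    t^n, it is a left ideal only thanks to [commute_power]. *)
Definition lead (J : B -> Prop) (n : nat) (a : B) : Prop :=
  P a /\ exists2 b, J b & degree_lt n (b - t ^+ n * a).

Lemma lead_ideal J n : ideal_in extension J -> ideal_in P (lead J n).
Proof.
move=> [J0 JD JM _]; split=> [|a b|x a|a []] //.
- split; first exact: subring0.
  by exists 0 => //; rewrite mulr0 subrr; apply: degree_lt_zero.
- move=> [Pa [a' Ja' na]] [Pb [b' Jb' nb]]; split; first exact: subringD.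
  exists (a' + b'); first exact: JD.
  by rewrite mulrDr opprD addrACA; apply: degree_ltD.
- move=> Px [Pa [b Jb nb]]; split; first exact: (subringM sP).
  have [y Py ny] := commute_power n Px.
  exists (y * b); first exact/JM/Jb/extension_base.
  have -> : y * b - t ^+ n * (x * a)
      = y * (b - t ^+ n * a) + (y * t ^+ n - t ^+ n * x) * a.
    by rewrite mulrBr mulrBl !mulrA addrA subrK.
  by apply: degree_ltD; [apply: degree_ltMl | apply: degree_ltMr].
Qed.

Lemma leadS J n a : ideal_in extension J -> lead J n a -> lead J n.+1 a.
Proof.
move=> [_ _ JM _] [Pa [b Jb nb]]; split=> //; exists (t * b).
  exact/JM/Jb/extension_gen.
by rewrite exprS -mulrA -mulrBr; apply: degree_lt_mult.
Qed.

(** The argument of Hilbert's basis theorem.  The diagonal chain of leading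
    ideals [lead (J m) m] is stationary from some N0 on, and each of the
    finitely many chains [lead (J m) i] with i < N0 is stationary too.  From
    there on all leading ideals agree, and subtracting elements of J N lowers
    the degree of an element of J m down to 0. *)
Theorem extension_noetherian : noetherian_in P -> noetherian_in extension.
Proof.
move=> nP J idJ incJ.
have leadJ m n i a : (m <= n)%N -> lead (J m) i a -> lead (J n) i a.
  by move=> mn [Pa [b Jb nb]]; split=> //; exists b => //; apply: (chain_le incJ mn Jb).
have lead_le m i j a : (i <= j)%N -> lead (J m) i a -> lead (J m) j a.
  by apply: (@chain_le (lead (J m))) => n b; apply: leadS.
(* The ideals grow along both indices, hence along the diagonal. *)
have [N0 N0P] : exists N0, forall m a, (N0 <= m)%N -> lead (J m) m a -> lead (J N0) N0 a.
  apply: (nP (fun m => lead (J m) m)) => [m|m a la]; first exact: lead_ideal.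
  by apply: (leadJ m) => //; apply: leadS.
have [N1 N1P] : exists N1, forall i m a, (i < N0)%N -> (N1 <= m)%N ->
    lead (J m) i a -> lead (J N1) i a.
  elim: N0 {N0P} => [|n [N1 N1P]]; first by exists 0%N.
  have [N2 N2P] : exists N2, forall m a, (N2 <= m)%N -> lead (J m) n a -> lead (J N2) n a.
    by apply: (nP (fun m => lead (J m) n)) => [m|m a]; [apply: lead_ideal | apply: leadJ].
  exists (maxn N1 N2) => i m a; rewrite ltnS leq_eqVlt geq_max => /orP[/eqP ->|i_n].
    by move=> /andP[_ N2m] /(N2P _ _ N2m); apply: leadJ; apply: leq_maxr.
  by move=> /andP[N1m _] /(N1P _ _ _ i_n N1m); apply: leadJ; apply: leq_maxl.
pose N := maxn N0 N1.
have stable m i a : (N <= m)%N -> lead (J m) i a -> lead (J N) i a.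
  rewrite geq_max => /andP[N0m N1m] la; case: (ltnP i N0) => [iN0|N0i].
    by apply: (leadJ N1); [apply: leq_maxr | apply: N1P la].
  apply: (leadJ N0); first exact: leq_maxl.
  apply: (lead_le _ _ _ _ N0i); apply: (N0P (maxn m i)); first by rewrite leq_max N0m.
  by apply: (lead_le _ _ _ _ (leq_maxr m i)); apply: leadJ la; apply: leq_maxl.
exists N => m b Nm Jb; have [_ _ _ Jext] := idJ m.
have [n nb] := Jext _ Jb; elim: n b Jb nb => [|n IH] b Jb nb.
  by rewrite (degree_lt0 nb); case: (idJ N).
have [a Pa low] := degree_lt_lead nb.
have [_ [b' Jb' nb']] : lead (J N) n a by apply: (stable m) => //; split=> //; exists b.
have [_ JD JM _] := idJ m.
have [_ JND _ _] := idJ N.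
rewrite -[b](subrK b'); apply: JND => //; apply: IH.
  apply: JD => //; rewrite -mulN1r; apply: JM.
    by apply: (subringN extension_subring); apply: (subring1 extension_subring).
  exact: (chain_le incJ Nm Jb').
have -> : b - b' = (b - t ^+ n * a) - (b' - t ^+ n * a).
  by rewrite opprB addrA subrK.
exact: degree_ltB.
Qed.

Lemma extension_min (Q : B -> Prop) : subring Q -> (forall a, P a -> Q a) -> Q t ->
  forall a, extension a -> Q a.
Proof.
move=> sQ PQ Qt a [n [c Pc ->]]; apply: (big_ind Q) => [|x y|i _].
- exact: subring0.
- exact: subringD.
- apply: (subringM sQ); last exact/PQ.
  by elim: (nat_of_ord i) => [|j IH]; [apply: subring1 | rewrite exprS; apply: (subringM sQ)].
Qed.

End Extension.

(** The elements that satisfy the commutation condition with t form a subring,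
    so that it has to be checked on generators only. *)
Lemma ore_subring (P : B -> Prop) t : subring P ->
  subring (fun a => [/\ P a, left_ore P t a & right_ore P t a]).
Proof.
move=> sP; have P0 := subring0 sP; have P1 := subring1 sP.
split=> [|a b [Pa [a1 [a0 [Pa1 Pa0 ta]]] [a3 [a2 [Pa3 Pa2 at_]]]]
            [Pb [b1 [b0 [Pb1 Pb0 tb]]] [b3 [b2 [Pb3 Pb2 bt]]]]
         |a b [Pa [a1 [a0 [Pa1 Pa0 ta]]] [a3 [a2 [Pa3 Pa2 at_]]]]
            [Pb [b1 [b0 [Pb1 Pb0 tb]]] [b3 [b2 [Pb3 Pb2 bt]]]]].
- by split=> //; exists 1, 0; split=> //; rewrite addr0 mul1r mulr1.
- split; first exact: (subringB sP).
    exists (a1 - b1), (a0 - b0); split; [exact: (subringB sP) | exact: (subringB sP) |].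
    by rewrite mulrBr ta tb mulrBl opprD addrACA.
  exists (a3 - b3), (a2 - b2); split; [exact: (subringB sP) | exact: (subringB sP) |].
  by rewrite mulrBl at_ bt mulrBr opprD addrACA.
- split; first exact: (subringM sP).
    exists (a1 * b1), (a1 * b0 + a0 * b); split.
    + exact: (subringM sP).
    + by apply: (subringD sP); apply: (subringM sP).
    + by rewrite mulrA ta mulrDl -mulrA tb mulrDr addrA mulrA.
  exists (a3 * b3), (a2 * b3 + a * b2); split.
  + exact: (subringM sP).
  + by apply: (subringD sP); apply: (subringM sP).
  + by rewrite -mulrA bt mulrDr mulrA at_ mulrDl addrA mulrA.
Qed.

Section Tower.
Variable P0 : B -> Prop.

(** The ring obtained from P0 by adjoining the elements of s, the last one
    first. *)
Fixpoint tower (s : seq B) : B -> Prop :=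
  if s is t :: s' then extension (tower s') t else P0.

Fixpoint all_in (Q : B -> Prop) (s : seq B) : Prop :=
  if s is t :: s' then Q t /\ all_in Q s' else True.

Fixpoint ore_tower (s : seq B) : Prop :=
  if s is t :: s' then
    all_in (fun a => left_ore (tower s') t a /\ right_ore (tower s') t a) s'
    /\ ore_tower s'
  else True.

Lemma all_inW (Q Q' : B -> Prop) s :
  (forall a, Q a -> Q' a) -> all_in Q s -> all_in Q' s.
Proof. by move=> QQ'; elim: s => //= t s IH [/QQ' ? /IH]. Qed.

Lemma all_in_and (Q Q' : B -> Prop) s :
  all_in Q s -> all_in Q' s -> all_in (fun a => Q a /\ Q' a) s.
Proof. by elim: s => //= t s IH [? ?] [? ?]; split=> //; apply: IH. Qed.

Hypothesis sP0 : subring P0.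
Hypothesis P0_central : forall c a, P0 c -> c * a = a * c.

Lemma tower_min (Q : B -> Prop) s : subring Q -> (forall a, P0 a -> Q a) ->
  all_in Q s -> forall a, tower s a -> Q a.
Proof.
move=> sQ PQ; elim: s => [|t s IH] /=; first by move=> _; apply: PQ.
by move=> [Qt /IH Qs]; apply: extension_min.
Qed.

Lemma tower_properties s : ore_tower s ->
  [/\ subring (tower s), forall a, P0 a -> tower s a, all_in (tower s) s
    & noetherian_in P0 -> noetherian_in (tower s)].
Proof.
elim: s => [|t s IH] //= [ores /IH [sT PT Ts nT]].
have ore a : tower s a -> [/\ tower s a, left_ore (tower s) t a & right_ore (tower s) t a].
  apply: (tower_min (Q := fun a => [/\ tower s a, left_ore (tower s) t a
    & right_ore (tower s) t a])); first exact: ore_subring.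
    move=> c Pc; split; first exact: PT.
      exists c, 0; split; [exact: PT | exact: subring0 | by rewrite addr0 (P0_central t Pc)].
    exists c, 0; split; [exact: PT | exact: subring0 | by rewrite addr0 (P0_central t Pc)].
  by apply: all_inW (all_in_and Ts ores) => b [Tb [lb rb]]; split.
have lo a : tower s a -> left_ore (tower s) t a by move=> /ore[].
have ro a : tower s a -> right_ore (tower s) t a by move=> /ore[].
split.
- exact: extension_subring.
- by move=> a Pa; apply: extension_base => //; apply: PT.
- split; first exact: extension_gen.
  by apply: all_inW Ts => a Ta; apply: extension_base.
- by move=> /nT nTs; apply: extension_noetherian.
Qed.

End Tower.

Lemma noetherian_field (P0 : B -> Prop) : subring P0 ->
  (forall c, P0 c -> c != 0 -> exists2 d, P0 d & d * c = 1) -> noetherian_in P0.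
Proof.
move=> sP inv J idJ incJ.
have [[n [c [Jc c0]]]|no] := EM (exists n c, J n c /\ c != 0).
  exists n => m a nm Ja; have [_ _ JM JP] := idJ n.
  have [d Pd dc] := inv c (JP c Jc) c0; rewrite -[a]mulr1 -dc mulrA.
  have [_ _ _ JmP] := idJ m.
  by apply: JM => //; apply: (subringM sP) => //; apply: JmP.
exists 0%N => m a _ Ja; have [-> |a0] := eqVneq a 0; first by case: (idJ 0%N).
by case: no; exists m, a.
Qed.

Lemma noetherian_inT (P : B -> Prop) : (forall a, P a) -> noetherian_in P ->
  left_noetherian B.
Proof.
move=> PT nP J idJ; apply: nP => n; have [J0 JD JM] := idJ n.
by split=> // a b _; apply: JM.
Qed.

End OreExtension.

(** * Noetherianity of the double *)

Section OrePairs.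
Variables (B : pzRingType) (P : B -> Prop).
Hypothesis sP : subring P.
Local Notation ore t a := (left_ore P t a /\ right_ore P t a).

Lemma ore_comm t a d : P a -> P d -> t * a = a * t + d -> ore t a.
Proof.
move=> Pa Pd ta; split; first by exists a, d.
exists a, (- d); split=> //; first exact: subringN.
by rewrite ta addrK.
Qed.

Lemma ore_anti t a d : P a -> P d -> t * a = d - a * t -> ore t a.
Proof.
move=> Pa Pd ta; have PNa := subringN sP Pa; split.
  by exists (- a), d; split=> //; rewrite ta mulNr addrC.
by exists (- a), d; split=> //; rewrite mulrN ta opprB subrK.
Qed.

(** The case of zeta, which an eigenvector t of ad(zeta) shifts by an integer:
    the error t n is absorbed in the coefficient, since t itself does not
    belong to the subring. *)
Lemma ore_shift t a n : P a -> P n -> GRing.comm t n -> t * a = a * t + t * n -> ore t a.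
Proof.
move=> Pa Pn tn ta; split.
  exists (a + n), 0; split; [exact: subringD | exact: subring0 |].
  by rewrite addr0 ta mulrDl tn.
exists (a - n), 0; split; [exact: (subringB sP) | exact: subring0 |].
by rewrite addr0 mulrBr ta addrK.
Qed.

Lemma ore_inverse t a a' d : P a' -> P d -> a * a' = 1 -> a' * a = 1 ->
  t * a = a * t + d -> ore t a'.
Proof.
move=> Pa' Pd aa' a'a ta; apply: (@ore_comm _ _ (- (a' * d * a'))) => //.
  by apply: (subringN sP); apply: (subringM sP) => //; apply: (subringM sP).
transitivity (a' * (a * t + d - d) * a'); last first.
  by rewrite -ta; transitivity (a' * t * (a * a') - a' * d * a'); [ncr | rewrite aa'; ncr].
by rewrite addrK mulrA a'a mul1r.
Qed.
End OrePairs.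

Section DoubleNoetherian.
Variables (B : pzRingType) (x1 x2 v1 v2 g gi zeta : B).
Hypothesis R : double_rel x1 x2 v1 v2 g gi zeta.
Variable P0 : B -> Prop.
Hypothesis sP0 : subring P0.
Hypothesis P0_central : forall c a, P0 c -> c * a = a * c.
Hypothesis P0_field : forall c, P0 c -> c != 0 -> exists2 d, P0 d & d * c = 1.
Local Notation z := (x2 * x1 + x1 * x2).
Local Notation w := (v1 * v2 + v2 * v1).

(** An order in which every generator commutes or anticommutes with those
    after it up to the ring that these generate, zeta being shifted by an
    integer.  The squares y and u are not adjoined: they belong to the
    extensions by x2 and v2. *)
Definition double_generators := [:: v2; x2; w; z; v1; x1; zeta; gi; g].

Let gi_comm a : g * a = a * g -> a * gi = gi * a.
Proof. by move=> ga; apply: comm_inverse ga; [apply: (rel_ggi R) | apply: (rel_gig R)]. Qed.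

Lemma commN1 (t : B) : GRing.comm t (-1).
Proof. by rewrite /GRing.comm mulrN mulNr mulr1 mul1r. Qed.

Lemma double_ore : ore_tower P0 double_generators.
Proof.
have ore0 P t a : subring P -> P a -> t * a = a * t ->
    left_ore P t a /\ right_ore P t a.
  by move=> sP Pa ta; apply: (ore_comm sP Pa (subring0 sP)); rewrite addr0.
have step t s : ore_tower P0 s -> (subring (tower P0 s) -> all_in (tower P0 s) s ->
    all_in (fun a => left_ore (tower P0 s) t a /\ right_ore (tower P0 s) t a) s) ->
    ore_tower P0 (t :: s).
  move=> os h; split=> //.
  by have [sT _ mT _] := tower_properties sP0 P0_central os; apply: h.
rewrite /double_generators.
apply: (step); last first.
- move=> sT [Tx2 [Tw [Tzz [Tv1 [Tx1 [Tz [Tgi [Tg _]]]]]]]].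
  have Tgv1 : tower P0 [:: x2; w; z; v1; x1; zeta; gi; g] (- (g * v1)).
    by apply/(subringN sT)/(subringM sT).
  split; last split; last split; last split; last split; last split; last split; last split=> //.
  + by apply: (ore_anti (d := zeta) sT Tx2) => //; rewrite (rel_v2x2 R).
  + apply: (ore_comm (d := - (w * v1)) sT Tw); last by rewrite (rel_wv2 R); ncr.
    by apply/(subringN sT)/(subringM sT).
  + apply: (ore_comm (d := x1 + x1 * g) sT Tzz); last by rewrite (rel_v2z R) addrA.
    by apply: (subringD sT) => //; apply: (subringM sT).
  + by apply: (ore_anti (d := w) sT Tv1) => //; ncr.
  + apply: (ore_anti (d := 1 - g) sT Tx1); last by rewrite (rel_v2x1 R).
    by apply: (subringB sT) => //; apply: (subring1 sT).
  + apply: (ore_shift sT Tz (subring1 sT) (@commr1 _ _)).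
    by rewrite (rel_v2zeta R) mulr1.
  + exact: (ore_inverse sT Tgi Tgv1 (rel_ggi R) (rel_gig R) (rel_v2g R)).
  + exact: (ore_comm sT Tg Tgv1 (rel_v2g R)).
apply: (step); last first.
- move=> sT [Tw [Tzz [Tv1 [Tx1 [Tz [Tgi [Tg _]]]]]]].
  have Tx1g : tower P0 [:: w; z; v1; x1; zeta; gi; g] (x1 * g) by apply: (subringM sT).
  have x2g : x2 * g = g * x2 + x1 * g by rewrite (rel_gx2 R) subrK.
  split; last split; last split; last split; last split; last split; last split=> //.
  + apply: (ore_comm (d := - (v1 + g * v1)) sT Tw); last by rewrite (rel_wx2 R); ncr.
    by apply/(subringN sT)/(subringD sT) => //; apply: (subringM sT).
  + apply: (ore_comm (d := x1 * z) sT Tzz); first exact: (subringM sT).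
    exact: (rel_x2z R).
  + apply: (ore_anti (d := 1 - g) sT Tv1); last by rewrite (rel_v1x2 R); ncr.
    by apply: (subringB sT) => //; apply: (subring1 sT).
  + by apply: (ore_anti (d := z) sT Tx1) => //; ncr.
  + apply: (ore_shift sT Tz _ (@commN1 _)); first exact/(subringN sT)/(subring1 sT).
    by rewrite (rel_zetax2 R); ncr.
  + exact: (ore_inverse sT Tgi Tx1g (rel_ggi R) (rel_gig R) x2g).
  + exact: (ore_comm sT Tg Tx1g x2g).
apply: (step); last first.
- move=> sT [Tzz [Tv1 [Tx1 [Tz [Tgi [Tg _]]]]]].
  split; last split; last split; last split; last split; last split=> //.
  + by apply: ore0 => //; rewrite (rel_wz R).
  + by apply: ore0 => //; rewrite (rel_wv1 R).
  + by apply: ore0 => //; rewrite (rel_wx1 R).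
  + apply: (ore_shift (n := 1 + 1) sT Tz).
    * by apply: (subringD sT); apply: (subring1 sT).
    * by apply: commrD; apply: commr1.
    * by rewrite (rel_wzeta R); ncr.
  + by apply: ore0 => //; apply: gi_comm; rewrite (rel_wg R).
  + by apply: ore0 => //; rewrite (rel_wg R).
apply: (step); last first.
- move=> sT [Tv1 [Tx1 [Tz [Tgi [Tg _]]]]].
  split; last split; last split; last split; last split=> //.
  + by apply: ore0 => //; rewrite (rel_v1z R).
  + by apply: ore0 => //; rewrite (rel_x1z R).
  + apply: (ore_shift (n := -1 - 1) sT Tz).
    * by apply: (subringB sT); [apply/(subringN sT)/(subring1 sT) | apply: (subring1 sT)].
    * by apply: commrB; [apply: commN1 | apply: commr1].
    * by rewrite (rel_zetaz R); ncr.
  + by apply: ore0 => //; apply: gi_comm; rewrite (rel_gz R).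
  + by apply: ore0 => //; rewrite (rel_gz R).
apply: (step); last first.
- move=> sT [Tx1 [Tz [Tgi [Tg _]]]]; split; last split; last split; last split=> //.
  + by apply: (ore_anti sT Tx1 (subring0 sT)); rewrite (rel_v1x1 R) sub0r.
  + apply: (ore_shift sT Tz (subring1 sT) (@commr1 _ _)).
    by rewrite (rel_v1zeta R) mulr1.
  + by apply: ore0 => //; apply: gi_comm; rewrite (rel_v1g R).
  + by apply: ore0 => //; rewrite (rel_v1g R).
apply: (step); last first.
- move=> sT [Tz [Tgi [Tg _]]]; split; last split; last split=> //.
  + apply: (ore_shift sT Tz _ (@commN1 _)); first exact/(subringN sT)/(subring1 sT).
    by rewrite (rel_zetax1 R); ncr.
  + by apply: ore0 => //; apply: gi_comm; rewrite (rel_gx1 R).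
  + by apply: ore0 => //; rewrite (rel_gx1 R).
apply: (step); last first.
- move=> sT /= [Tgi [Tg _]]; split; last split=> //; apply: ore0 => //.
    by apply: gi_comm; rewrite (rel_gzeta R).
  exact: (rel_gzeta R).
apply: (step); last first.
- by move=> sT /= [Tg _]; split=> //; apply: ore0 => //; rewrite (rel_gig R) (rel_ggi R).
by [].
Qed.

Theorem double_noetherian :
  (forall Q : B -> Prop, subring Q -> (forall c, P0 c -> Q c) ->
     Q x1 -> Q x2 -> Q v1 -> Q v2 -> Q g -> Q gi -> Q zeta -> forall b, Q b) ->
  left_noetherian B.
Proof.
move=> gen; have [sT PT mT nT] := tower_properties sP0 P0_central double_ore.
move: mT => /= [Tv2 [Tx2 [_ [_ [Tv1 [Tx1 [Tz [Tgi [Tg _]]]]]]]]].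
by apply: (noetherian_inT (P := tower P0 double_generators)); [apply: gen | apply/nT/noetherian_field].
Qed.
End DoubleNoetherian.

(** * Noetherianity of the smash product *)

Section Scalars.
Variables (k : fieldType) (A : algType k).

Definition is_scalar (b : A) : Prop := exists c : k, b = c%:A.

Fact scalar_subring : subring is_scalar.
Proof.
split=> [|_ _ [c ->] [d ->]|_ _ [c ->] [d ->]].
- by exists 1; rewrite scale1r.
- by exists (c - d); rewrite scalerBl.
- by exists (c * d); rewrite mulr_algl scalerA.
Qed.

Fact scalar_central c a : is_scalar c -> c * a = a * c.
Proof. by move=> [e ->]; rewrite mulr_algl mulr_algr. Qed.

Fact scalar_field c : is_scalar c -> c != 0 -> exists2 d, is_scalar d & d * c = 1.
Proof.
move=> [e ->] e0; exists e^-1%:A; first by exists e^-1.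
rewrite mulr_algl scalerA mulVf ?scale1r //.
by apply: contraNneq e0 => ->; rewrite scale0r.
Qed.

Fact scalar_subring_op : @subring A^c is_scalar.
Proof.
split=> [|a b|a b sa sb]; first exact: (subring1 scalar_subring).
  exact: (subringB scalar_subring).
exact: (subringM scalar_subring sb sa).
Qed.

Fact scalar_central_op (c a : A^c) : is_scalar c -> c * a = a * c.
Proof. by move=> sc; apply/esym/(scalar_central a sc). Qed.

Fact scalar_field_op (c : A^c) : is_scalar c -> c != 0 ->
  exists2 d : A^c, is_scalar d & d * c = 1.
Proof.
move=> sc c0; have [d sd dc] := scalar_field sc c0; exists d; first exact: sd.
exact: etrans (esym (scalar_central c sd)) dc.
Qed.
End Scalars.

Lemma subring_op (B : pzRingType) (Q : B -> Prop) :
  @subring B^c Q -> subring Q.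
Proof.
move=> sQ; split=> [|a b|a b Qa Qb]; first exact: (subring1 sQ).
  exact: (subringB sQ).
exact: (subringM sQ Qb Qa).
Qed.

Section DtildeNoetherian.
Variable k : fieldType.
Local Notation A := (Dtilde k).

Lemma Dtilde_generated (Q : A -> Prop) : subring Q ->
  (forall c, is_scalar c -> Q c) -> Q (tx1 k) -> Q (tx2 k) -> Q (tv1 k) ->
  Q (tv2 k) -> Q (tg k) -> Q (tgi k) -> Q (tzeta k) -> forall b, Q b.
Proof.
move=> sQ Qs Qx1 Qx2 Qv1 Qv2 Qg Qgi Qz.
apply: Dtilde_gen_ind => [|c a b Qa Qb|a b Qa Qb|].
- exact: (subring1 sQ).
- rewrite -mulr_algl; apply: (subringD sQ) Qb; apply: (subringM sQ) Qa.
  by apply: Qs; exists c.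
- exact: (subringM sQ).
- case; [exact: Qx1 | exact: Qx2 | exact: Qv1 | | exact: Qg | exact: Qgi | exact: Qz].
  have -> : Dgenerator k Du2 = tv2 k - tzeta k * tv1 k by rewrite /tv2 addrK.
  by apply: (subringB sQ) Qv2 _; apply: (subringM sQ).
Qed.

Theorem Dtilde_noetherian : noetherian A.
Proof.
split.
  apply: (double_noetherian (Dtilde_rel k) (scalar_subring A) (@scalar_central _ A)
    (@scalar_field _ A)) => Q sQ Qs *.
  exact: Dtilde_generated.
apply: (double_noetherian (double_rel_op (Dtilde_rel k)) (scalar_subring_op A)
  (@scalar_central_op _ A) (@scalar_field_op _ A)) => Q /subring_op sQ Qs *.
exact: Dtilde_generated.
Qed.
End DtildeNoetherian.

Section Images.
Variables (A B : pzRingType) (f : A -> B).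
Hypotheses (fB : forall a b, f (a - b) = f a - f b)
  (fM : forall a b, f (a * b) = f a * f b) (f1 : f 1 = 1).

Definition image_of (b : B) : Prop := exists a, b = f a.

Lemma image_subring : subring image_of.
Proof.
split=> [|_ _ [a ->] [b ->]|_ _ [a ->] [b ->]].
- by exists 1; rewrite f1.
- by exists (a - b); rewrite fB.
- by exists (a * b); rewrite fM.
Qed.

(** Left ideals of the image pull back to left ideals along f. *)
Lemma image_noetherian : left_noetherian A -> noetherian_in image_of.
Proof.
move=> nA J idJ incJ.
have f0 : f 0 = 0 by rewrite -(subrr 0) fB subrr.
have fD a b : f (a + b) = f a + f b.
  by rewrite -[b in LHS]opprK fB -[- b]sub0r fB f0 sub0r opprK.
have [|n a|N NP] := nA (fun n a => J n (f a)).
- move=> n; have [J0 JD JM _] := idJ n; split=> [|a b|a b].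
  + by rewrite f0.
  + by rewrite fD; apply: JD.
  + by rewrite fM; apply: JM; exists a.
- exact: incJ.
exists N => n b Nn Jb; have [_ _ _ Jim] := idJ n; have [a ba] := Jim _ Jb.
by rewrite ba in Jb *; apply: NP Jb.
Qed.
End Images.

Section DoubleSmash.
Variable k : fieldType.
Local Notation A := (Dtilde k).
Local Notation DD := (Ddouble k).
Local Notation rho := (Dpar_action k).

Definition embed (a : A) : DD := [ffun x : 'Z_2 => if x == 0 then a else 0].
Definition eps : DD := [ffun x : 'Z_2 => (x == 1)%:R].

Lemma Ddouble_mulE (f h : DD) x : (f * h) x = \sum_(y : 'Z_2) f y * rho y (h (y^-1 * x)%g).
Proof. exact: ffunE. Qed.

Lemma sumZ2 (V : zmodType) (E : 'Z_2 -> V) : \sum_(y : 'Z_2) E y = E 0 + E 1.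
Proof.
rewrite big_ord_recl big_ord1; congr (E _ + E _); exact: val_inj.
Qed.

Lemma Z2P (x : 'Z_2) : x = 0 \/ x = 1.
Proof. by case: x => [[|[|]]] //= ?; [left | right]; apply: val_inj. Qed.

Lemma embedB a b : embed (a - b) = embed a - embed b.
Proof. by apply/ffunP => x; rewrite !ffunE; case: eqP => //; rewrite subrr. Qed.

Lemma embed1 : embed 1 = 1.
Proof. by apply/ffunP => x; rewrite !ffunE; case: eqP. Qed.

Lemma rhoE0 a : rho 0 a = a. Proof. by []. Qed.
Lemma rhoE1 a : rho 1 a = Dparity a. Proof. by []. Qed.

Lemma embedM a b : embed (a * b) = embed a * embed b.
Proof.
apply/ffunP => x; rewrite Ddouble_mulE sumZ2 !ffunE mul0r addr0 rhoE0 /=.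
by case: (Z2P x) => -> /=; rewrite ?mulr0.
Qed.

Local Notation tau := (1%R : 'Z_2).

Lemma embed_at0 a : embed a 0 = a. Proof. by rewrite ffunE. Qed.
Lemma embed_at1 a : embed a 1 = 0. Proof. by rewrite ffunE. Qed.
Lemma eps_at0 : eps 0 = 0. Proof. by rewrite ffunE. Qed.
Lemma eps_at1 : eps 1 = 1. Proof. by rewrite ffunE. Qed.

Lemma eps_mul (h : DD) x : (eps * h) x = Dparity (h (tau^-1 * x)%g).
Proof. by rewrite Ddouble_mulE sumZ2 eps_at0 eps_at1 mul0r mul1r add0r rhoE1. Qed.

Lemma embed_mul a (h : DD) x : (embed a * h) x = a * h x.
Proof.
rewrite Ddouble_mulE sumZ2 embed_at0 embed_at1 mul0r addr0 rhoE0.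
by congr (_ * h _); case: (Z2P x) => ->; apply: val_inj.
Qed.

Lemma eps_embed a : eps * embed a = embed (Dparity a) * eps.
Proof.
apply/ffunP => x; apply: etrans (eps_mul _ x) _.
apply: etrans _ (esym (embed_mul _ _ x)).
case: (Z2P x) => ->.
  have -> : (tau^-1 * (0%R : 'Z_2))%g = 1 :> 'Z_2 by apply: val_inj.
  by rewrite embed_at1 eps_at0 mulr0 raddf0.
have -> : (tau^-1 * tau)%g = 0 :> 'Z_2 by apply: val_inj.
by rewrite embed_at0 eps_at1 mulr1.
Qed.

Lemma Ddouble_decomp (b : DD) : b = embed (b 0) + embed (b 1) * eps.
Proof.
apply/ffunP => x; rewrite [RHS]ffunE [X in _ = _ + X]embed_mul.
case: (Z2P x) => ->; first by rewrite embed_at0 eps_at0 mulr0 addr0.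
by rewrite embed_at1 eps_at1 mulr1 add0r.
Qed.

(** The smash product is generated by the double and the parity element, which
    satisfies the condition of [extension_noetherian] because it normalizes
    the double. *)
Theorem Ddouble_noetherian : noetherian DD.
Proof.
have [nA nAc] := Dtilde_noetherian k.
have embed_eps a : embed a * eps = eps * embed (Dparity a).
  by rewrite eps_embed DparityK.
split.
  have sP := image_subring embedB embedM embed1.
  have lo a : image_of embed a -> left_ore (image_of embed) eps a.
    move=> [a' ->]; exists (embed (Dparity a')), 0; split; [by eexists | exact: subring0 |].
    exact: etrans (eps_embed a') (esym (addr0 _)).
  have ro a : image_of embed a -> right_ore (image_of embed) eps a.
    move=> [a' ->]; exists (embed (Dparity a')), 0; split; [by eexists | exact: subring0 |].
    exact: etrans (embed_eps a') (esym (addr0 _)).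
  apply: (noetherian_inT (P := extension (image_of embed) eps)); last first.
    exact: (extension_noetherian sP lo ro (image_noetherian embedB embedM nA)).
  have sE := extension_subring sP ro.
  move=> b; rewrite [b]Ddouble_decomp; apply: (subringD sE).
    by apply: extension_base => //; eexists.
  apply: (subringM sE); last exact: extension_gen.
  by apply: extension_base => //; eexists.
pose embedc : A^c -> DD^c := embed.
have embedMc a b : embedc (a * b) = embedc a * embedc b by apply: embedM.
have embedBc a b : embedc (a - b) = embedc a - embedc b by apply: embedB.
have sP := @image_subring A^c DD^c embedc embedBc embedMc embed1.
have nP := @image_noetherian A^c DD^c embedc embedBc embedMc nAc.
have lo (a : DD^c) : image_of embedc a -> left_ore (image_of embedc) (eps : DD^c) a.
  move=> [a' ->]; exists (embedc (Dparity a')), 0; split; [by eexists | exact: subring0 |].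
  exact: etrans (embed_eps a') (esym (addr0 _)).
have ro (a : DD^c) : image_of embedc a -> right_ore (image_of embedc) (eps : DD^c) a.
  move=> [a' ->]; exists (embedc (Dparity a')), 0; split; [by eexists | exact: subring0 |].
  exact: etrans (eps_embed a') (esym (addr0 _)).
apply: (noetherian_inT (P := extension (image_of embedc) (eps : DD^c))); last first.
  exact: (extension_noetherian sP lo ro nP).
have sE := extension_subring sP ro.
move=> b; rewrite [b](Ddouble_decomp (b : DD)); apply: (subringD sE).
  by apply: (extension_base (P := image_of embedc)) => //; eexists.
apply: (subringM sE); first exact: extension_gen.
by apply: (extension_base (P := image_of embedc)) => //; eexists.
Qed.
End DoubleSmash.

(** * Central p-th powers *)

Section Leibniz.
Variable B : nzRingType.
Variable p : nat.
Hypothesis charB : p \in [pchar B].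

Definition ad (y t : B) : B := y * t - t * y.

(** The left and right multiplications by y commute, and the left one is ad(y)
    plus the right one: this is the binomial formula. *)
Lemma leibniz y t n :
  y ^+ n * t = \sum_(i < n.+1) (iter i (ad y) t * y ^+ (n - i)) *+ 'C(n, i).
Proof.
elim: n => [|n IH]; first by rewrite big_ord1 mul1r mulr1.
have yad i : y * iter i (ad y) t = iter i.+1 (ad y) t + iter i (ad y) t * y.
  by rewrite /= {2}/ad subrK.
rewrite exprS -mulrA IH mulr_sumr.
transitivity (\sum_(i < n.+1) (iter i.+1 (ad y) t * y ^+ (n - i)) *+ 'C(n, i)
  + \sum_(i < n.+1) (iter i (ad y) t * y ^+ (n.+1 - i)) *+ 'C(n, i)).
  rewrite -big_split; apply: eq_bigr => i _ /=.
  rewrite mulrnAr mulrA (yad i) mulrDl mulrnDl -mulrA -exprS.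
  by rewrite subSn // -ltnS.
rewrite [RHS]big_ord_recl subn0 bin0 addrC.
transitivity ((t * y ^+ n.+1) *+ 1 + \sum_(i < n.+1)
  (iter i.+1 (ad y) t * y ^+ (n - i)) *+ ('C(n, i.+1) + 'C(n, i))); last first.
  by congr (_ + _); apply: eq_bigr => i _; rewrite /= /bump add1n subSS binS.
under [in RHS]eq_bigr do rewrite mulrnDr.
rewrite big_split /= addrA; congr (_ + _).
rewrite [LHS]big_ord_recl [in RHS]big_ord_recr /= subn0 bin0.
by rewrite bin_small // mulr0n addr0; congr (_ + _); apply: eq_bigr => i _.
Qed.

Lemma mulrn_dvd (x : B) n : (p %| n)%N -> x *+ n = 0.
Proof. by rewrite (dvdn_pcharf charB) => /eqP n0; rewrite -mulr_natr n0 mulr0. Qed.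

Lemma leibniz_p y t : y ^+ p * t = t * y ^+ p + iter p (ad y) t.
Proof.
have pp := pcharf_prime charB; have mid := mulrn_dvd.
rewrite leibniz; move: pp mid; case: p => // q pq mid.
rewrite big_ord_recl big_ord_recr /= subn0 bin0 mulr1n big1 ?add0r => [|i _].
  by rewrite /bump /= add1n subnn mulr1 binn.
by apply: mid; rewrite /bump add1n; apply: prime_dvd_bin => //=; rewrite ltnS.
Qed.

(** The hypothesis gives ad(y)^p (e 0) = (p!) e p, which is 0 in
    characteristic p. *)
Lemma pth_power_comm (y : B) (e : nat -> B) :
  (forall n, y * e n = e n * y + e n.+1 *+ n.+1) -> GRing.comm (y ^+ p) (e 0%N).
Proof.
move=> ye; have it n : iter n (ad y) (e 0%N) = e n *+ n`!.
  elim: n => //= n ->; rewrite /ad mulrnAr mulrnAl -mulrnBl ye addrC addKr.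
  by rewrite -mulrnA factS.
rewrite /GRing.comm leibniz_p it mulrn_dvd ?addr0 //.
by rewrite dvdn_fact // prime_gt0 ?(pcharf_prime charB) /=.
Qed.

Lemma pth_power_comm2 (y t s : B) :
  y * t = t * y + s -> GRing.comm y s -> GRing.comm (y ^+ p) t.
Proof.
move=> yt ys; pose e n := if n is n'.+1 then if n' is 0 then s else 0 else t.
apply: (@pth_power_comm y e) => -[|[|n]] /=; first by rewrite mulr1n.
  by rewrite mul0rn addr0.
by rewrite mulr0 mul0r mul0rn addr0.
Qed.

Lemma pth_power_comm1 (y t : B) : GRing.comm y t -> GRing.comm (y ^+ p) t.
Proof. by move=> yt; apply/commr_sym/commrX/commr_sym. Qed.

End Leibniz.

(** The Jordan plane relation [y, z] = z^2 gives [y, z^n] = n z^(n+1), so that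
    x, g and v each start a chain to which [pth_power_comm] applies. *)
Section JordanChains.
Variables (B : nzRingType) (p : nat).
Hypothesis charB : p \in [pchar B].
Variables (y z x g v : B).
Hypotheses (yz : y * z = z * y + z * z) (yx : y * x = x * y + x * z).
Hypotheses (yg : y * g = g * y + g * z) (zg : z * g = g * z).
Hypothesis vy : v * y = y * v + x * g.

Let yzn n : y * z ^+ n = z ^+ n * y + z ^+ n.+1 *+ n.
Proof.
elim: n => [|n IH]; first by rewrite mulr1 mul1r mulr0n addr0.
rewrite [in LHS]exprS mulrA yz mulrDl -mulrA IH mulrDr mulrnAr mulrA -exprS.
by rewrite -exprS -mulrA -!exprS -addrA -mulrSr.
Qed.

Lemma jordan_comm_x : GRing.comm (y ^+ p) x.
Proof.
pose e n := x * z ^+ n.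
rewrite -[x]mulr1; apply: (@pth_power_comm _ _ charB y e) => n; rewrite /e.
rewrite mulrA yx mulrDl -mulrA yzn -[x * z * _]mulrA -exprS mulrDr mulrA -addrA.
by rewrite mulrnAr -mulrSr.
Qed.

Lemma jordan_comm_g : GRing.comm (y ^+ p) g.
Proof.
pose e n := g * z ^+ n.
rewrite -[g]mulr1; apply: (@pth_power_comm _ _ charB y e) => n; rewrite /e.
rewrite mulrA yg mulrDl -mulrA yzn -[g * z * _]mulrA -exprS mulrDr mulrA -addrA.
by rewrite mulrnAr -mulrSr.
Qed.

Lemma jordan_comm_v : GRing.comm (y ^+ p) v.
Proof.
pose e n := if n is n'.+1 then - (x * g * z ^+ n') else v.
apply: (@pth_power_comm _ _ charB y e) => -[|n] /=.
  by rewrite mulr1 mulr1n vy addrK.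
rewrite mulrN mulNr mulNrn -opprD; congr (- _).
have yxg : y * (x * g) = x * g * y + x * g * z + x * g * z.
  by rewrite mulrA yx mulrDl -mulrA yg mulrDr !mulrA -(mulrA x z) zg mulrA.
rewrite mulrA yxg !mulrDl -(mulrA (x * g) y) yzn -[x * g * z * _]mulrA -exprS mulrDr mulrA.
by rewrite -!addrA; congr (_ + _); rewrite mulrnAr addrA -!mulrSr.
Qed.

End JordanChains.

Section CentralElements.
Variables (B : nzRingType) (p : nat).
Hypothesis charB : p \in [pchar B].
Variables (x1 x2 v1 v2 g gi zeta : B).
Hypothesis R : double_rel x1 x2 v1 v2 g gi zeta.
Local Notation z := (x2 * x1 + x1 * x2).
Local Notation w := (v1 * v2 + v2 * v1).
Local Notation y := (x2 * x2).
Local Notation u := (v2 * v2).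

Definition comm_generators (c : B) : Prop :=
  [/\ GRing.comm c x1, GRing.comm c x2, GRing.comm c v1, GRing.comm c v2
    & GRing.comm c g /\ GRing.comm c zeta].

Let xz1 : GRing.comm z x1. Proof. exact/esym/(rel_x1z R). Qed.
Let zg_comm : GRing.comm z g. Proof. exact/esym/(rel_gz R). Qed.

Let yg : y * g = g * y + g * z.
Proof. by rewrite -zg_comm (rel_gy R) subrK. Qed.

Lemma yp_comm : comm_generators (y ^+ p).
Proof.
split; last split.
- exact: jordan_comm_x (rel_yz R) (rel_yx1 R).
- exact/(pth_power_comm1 p)/esym/mulrA.
- exact: jordan_comm_v (rel_yz R) (rel_yx1 R) yg zg_comm (rel_v1y R).
- apply: (@pth_power_comm2 _ _ charB y v2 (- x2)); first by rewrite (rel_v2y R) addrK.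
  by apply: commrN; apply/esym/mulrA.
- exact: jordan_comm_g (rel_yz R) yg.
- apply: (@pth_power_comm2 _ _ charB y zeta (- (y + y))).
    by rewrite (rel_zetay R); ncr.
  by apply/commrN/commrD.
Qed.

Lemma zp_comm : comm_generators (z ^+ p).
Proof.
split; last split.
- exact: (pth_power_comm1 p xz1).
- apply: (@pth_power_comm2 _ _ charB z x2 (- (x1 * z))).
    by rewrite (rel_x2z R) addrK.
  by apply/commrN/commrM.
- exact/(pth_power_comm1 p)/esym/(rel_v1z R).
- apply: (@pth_power_comm2 _ _ charB z v2 (- (x1 + x1 * g))).
    by rewrite (rel_v2z R); ncr.
  by apply/commrN/commrD => //; apply: commrM.
- exact: (pth_power_comm1 p zg_comm).
- apply: (@pth_power_comm2 _ _ charB z zeta (- (z + z))).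
    by rewrite (rel_zetaz R); ncr.
  by apply/commrN/commrD.
Qed.

Lemma gp_comm : comm_generators (g ^+ p).
Proof.
have gx1 : GRing.comm g x1 := rel_gx1 R.
have gv1 : GRing.comm g v1 := esym (rel_v1g R).
split; last split.
- exact: (pth_power_comm1 p gx1).
- apply: (@pth_power_comm2 _ _ charB g x2 (- (x1 * g))); first exact: (rel_gx2 R).
  by apply/commrN/commrM.
- exact: (pth_power_comm1 p gv1).
- apply: (@pth_power_comm2 _ _ charB g v2 (g * v1)); first by rewrite (rel_v2g R) subrK.
  by apply/commrM.
- exact: pth_power_comm1.
- exact/(pth_power_comm1 p)/esym/(rel_gzeta R).
Qed.

(** ad(h) fixes a, hence so does ad(h)^p: h^p and h have the same commutator
    with a. *)
Lemma artin_schreier_comm (h a : B) : h * a = a * h + a -> GRing.comm (h ^+ p - h) a.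
Proof.
move=> ha; have it n : iter n (ad h) a = a.
  by elim: n => //= n ->; rewrite /ad ha addrC addKr.
rewrite /GRing.comm mulrBl (leibniz_p charB) it ha mulrBr opprD addrACA subrr addr0.
by [].
Qed.
End CentralElements.

Section CentralPowers.
Variables (B : nzRingType) (p : nat).
Hypothesis charB : p \in [pchar B].
Variables (x1 x2 v1 v2 g gi zeta : B).
Hypothesis R : double_rel x1 x2 v1 v2 g gi zeta.
Local Notation w := (v1 * v2 + v2 * v1).
Local Notation u := (v2 * v2).
Local Notation comm_gens := (comm_generators x1 x2 v1 v2 g zeta).
Let Rc := double_rel_op R.

Lemma exprc (a : B) n : (a : B^c) ^+ n = a ^+ n.
Proof. by elim: n => // n IH; rewrite exprS IH [RHS]exprSr. Qed.

Lemma comm_generators_op (c : B) :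
  @comm_generators B^c v1 v2 x1 x2 g zeta c -> comm_gens c.
Proof. by move=> [? ? ? ? [? ?]]; split; last split; apply/esym. Qed.

Lemma up_comm : comm_gens (u ^+ p).
Proof. by apply: comm_generators_op; rewrite -exprc; apply: (yp_comm _ Rc). Qed.

Lemma wp_comm : comm_gens (w ^+ p).
Proof. by apply: comm_generators_op; rewrite -exprc; apply: (zp_comm _ Rc). Qed.

Lemma zetap_comm : comm_gens (zeta ^+ p - zeta).
Proof.
have op (a : B) : zeta * a = a * zeta - a -> GRing.comm (zeta ^+ p - zeta) a.
  move=> za; have h : @GRing.comm B^c ((zeta : B^c) ^+ p - zeta) a.
    have az : a * zeta = zeta * a + a by rewrite za subrK.
    exact: (@artin_schreier_comm B^c p charB zeta a az).
  by rewrite exprc in h; apply/esym/h.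
split; last split.
- exact: (artin_schreier_comm charB (rel_zetax1 R)).
- exact: (artin_schreier_comm charB (rel_zetax2 R)).
- by apply: op; rewrite (rel_v1zeta R) addrK.
- by apply: op; rewrite (rel_v2zeta R) addrK.
- have zg : GRing.comm zeta g := rel_gzeta R.
  by apply/commr_sym/commrB; [apply/commrX/commr_sym | apply/commr_sym].
- by apply/commr_sym/commrB; [apply/commrX |].
Qed.
End CentralPowers.

(** * Algebras that are finite over their center *)

Definition central (A : pzRingType) (c : A) : Prop := forall b, GRing.comm c b.

Section StandardSum.
Variables (k : fieldType) (A : algType k) (N : nat).
Hypothesis two_neq0 : (2%:R : k) != 0.
Implicit Type a : 'I_N -> A.

Definition standard_sum a : A :=
  \sum_(s : 'S_N) (-1) ^+ s *: \prod_(i <- enum 'I_N) a (s i).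

(** Multiplying a permutation by the transposition of i and j changes its sign
    and leaves the product unchanged. *)
Lemma standard_sum_alt a i j : i != j -> a i = a j -> standard_sum a = 0.
Proof.
move=> ij aij; have aT l : a (tperm i j l) = a l by case: tpermP => [->|->|].
have neg : standard_sum a = - standard_sum a.
  rewrite {1}/standard_sum (reindex_inj (mulIg (tperm i j))) -sumrN.
  apply: eq_bigr => s _; rewrite odd_permM odd_tperm ij addbT signrN scaleNr.
  by congr (- (_ *: _)); apply: eq_bigr => l _; rewrite permM aT.
apply: (scalerI two_neq0); rewrite scaler0 scaler_nat mulr2n {1}neg.
exact: addNr.
Qed.

Definition replace a (j : 'I_N) (x : A) : 'I_N -> A :=
  fun i => if i == j then x else a i.

Lemma prod_replace a j (L : seq 'I_N) : uniq L -> j \in L ->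
  exists u v, forall x, \prod_(i <- L) replace a j x i = u * x * v.
Proof.
elim: L => // l L IH /= /andP[lL uL]; rewrite inE.
case: eqVneq => [->|jl] /= => [_|/(IH uL) [u [v uv]]].
  (* The entry replaced is the first factor: nothing precedes it. *)
  exists 1, (\prod_(i <- L) a i) => x; rewrite big_cons mul1r /replace eqxx.
  congr (_ * _); apply: eq_big_seq => i iL; case: eqP => // il.
  by rewrite -il iL in lL.
exists (a l * u), v => x; rewrite big_cons uv {1}/replace.
by rewrite eq_sym (negPf jl) !mulrA.
Qed.

Lemma standard_sum_linear a j (F : finType) (z m : F -> A) :
  (forall f, central (z f)) ->
  standard_sum (replace a j (\sum_f z f * m f))
  = \sum_f z f * standard_sum (replace a j (m f)).
Proof.
move=> zc; rewrite /standard_sum.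
under [RHS]eq_bigr do rewrite mulr_sumr.
rewrite exchange_big; apply: eq_bigr => s _.
have [u [v uv]] : exists u v, forall x, \prod_(i <- enum 'I_N) replace a j x (s i) = u * x * v.
  have := @prod_replace a j [seq s i | i <- enum 'I_N].
  rewrite map_inj_uniq ?enum_uniq; last exact: perm_inj.
  have -> : j \in [seq s i | i <- enum 'I_N].
    by apply/mapP; exists (s^-1 j)%g; rewrite ?mem_enum ?permKV.
  move=> [//|//|u [v uv]]; by exists u, v => x; rewrite -uv [RHS]big_map.
rewrite uv mulr_sumr mulr_suml scaler_sumr; apply: eq_bigr => f _.
by rewrite uv -scalerAr !mulrA (zc f u).
Qed.

(** By multilinearity the arguments can be replaced, one at a time, by
    generators; two of these then coincide, there being fewer generators than
    arguments. *)
Lemma standard_sum_eq0 (F : finType) (m : F -> A) : (#|F| < N)%N ->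
  (forall b, exists2 z : F -> A, forall f, central (z f) & b = \sum_f z f * m f) ->
  forall a, standard_sum a = 0.
Proof.
move=> FN span.
suff main n : (n <= N)%N -> forall a,
    (forall i : 'I_N, (n <= i)%N -> exists f, a i = m f) -> standard_sum a = 0.
  by move=> a; apply: (main N) => // i; rewrite leqNgt ltn_ord.
elim: n => [_|n IH nN] a am.
  have /fin_all_exists[h hE] : forall i, exists f, a i = m f by move=> i; apply: am.
  have /injectivePn[i [j ij hij]] : ~~ injectiveb h.
    apply/negP => /injectiveP /leq_card; rewrite card_ord => le.
    by have := leq_ltn_trans le FN; rewrite ltnn.
  by apply: (standard_sum_alt ij); rewrite !hE hij.
pose j := Ordinal nN; have [z zc aj] := span (a j).
have -> : a = replace a j (\sum_f z f * m f).
  by apply: funext => i; rewrite /replace -aj; case: eqP => [->|].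
rewrite standard_sum_linear // big1 // => f _.
rewrite IH ?mulr0 // ?(ltnW nN) // => i ni; rewrite /replace.
case: (eqVneq i j) => [_|ij]; first by exists f.
apply: am; rewrite ltn_neqAle ni andbT; apply: contraNneq ij => e.
by apply/eqP/val_inj; rewrite /= -e.
Qed.

End StandardSum.

Section StandardIdentity.
Variables (k : fieldType) (N : nat).

Definition standard_word (s : 'S_N) : {fmonom nat} :=
  FMonom [seq (s i : nat) | i <- enum 'I_N].

Definition standard_poly : freeAlg k nat :=
  \sum_(s : 'S_N) (-1) ^+ s *: << standard_word s >>.

Lemma standard_word_inj : injective standard_word.
Proof.
move=> s t [] /eq_in_map st; apply/permP => i; apply: val_inj.
by apply: st; rewrite mem_enum.
Qed.

(** Distinct permutations give distinct words, so that the coefficient of the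
    word of the identity is 1. *)
Lemma standard_poly_neq0 : standard_poly != 0.
Proof.
apply/eqP => /(congr1 (fun f : freeAlg k nat => f@_(standard_word 1%g))).
rewrite mcoeff0 /standard_poly raddf_sum /= (bigD1 1%g) //= odd_perm1 scale1r.
rewrite mcoeffU eqxx big1 ?addr0 => [/eqP|s s1]; first by rewrite oner_eq0.
by rewrite mcoeffZ mcoeffU (inj_eq standard_word_inj) (negPf s1) mulr0.
Qed.

Lemma standard_poly_eval (A : algType k) (rho : nat -> A) :
  feval rho standard_poly = standard_sum (fun i : 'I_N => rho i).
Proof.
rewrite raddf_sum; apply: eq_bigr => s _; rewrite [LHS]linearZ /= fevalU scale1r.
by congr (_ *: _); rewrite /feval_mon [LHS]big_map.
Qed.

End StandardIdentity.

Theorem finite_over_center_PI (k : fieldType) (A : algType k) (F : finType) (m : F -> A) :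
  (2%:R : k) != 0 ->
  (forall b, exists2 z : F -> A, forall f, central (z f) & b = \sum_f z f * m f) ->
  PI_algebra A.
Proof.
move=> two span; exists (standard_poly k #|F|.+1); first exact: standard_poly_neq0.
move=> rho; rewrite standard_poly_eval; exact: standard_sum_eq0 span _.
Qed.

(** * The double is finite over its center *)

Section CentralSpan.
Variable A : pzRingType.

Lemma central1 : central (1 : A).
Proof. by move=> b; apply/commr_sym/commr1. Qed.
Lemma central0 : central (0 : A).
Proof. by move=> b; apply/commr_sym/commr0. Qed.
Lemma centralD (c d : A) : central c -> central d -> central (c + d).
Proof. by move=> cc cd b; apply/commr_sym/commrD; apply/commr_sym. Qed.
Lemma centralM (c d : A) : central c -> central d -> central (c * d).
Proof. by move=> cc cd b; apply/commr_sym/commrM; apply/commr_sym. Qed.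
Lemma centralX (c : A) n : central c -> central (c ^+ n).
Proof. by move=> cc b; apply/commr_sym/commrX/commr_sym. Qed.

Lemma comm_subring (c : A) : subring (GRing.comm c).
Proof.
by split=> [|a b ca cb|a b ca cb]; [exact: commr1 | exact: commrB | exact: commrM].
Qed.

Lemma central_mulCA (x y c : A) : central c -> x * (c * y) = c * (x * y).
Proof. by move=> cc; rewrite !mulrA (cc x). Qed.

Definition central_multiple (a b : A) : Prop := exists2 c, central c & a = c * b.

Lemma central_multiple_refl a : central_multiple a a.
Proof. by exists 1; [apply: central1 | rewrite mul1r]. Qed.

Lemma central_multipleM a a' b b' :
  central_multiple a b -> central_multiple a' b' -> central_multiple (a * a') (b * b').
Proof.
move=> [c cc ->] [c' cc' ->]; exists (c * c'); first exact: centralM.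
by rewrite -!mulrA; congr (_ * _); rewrite !mulrA cc'.
Qed.

Section Span.
Variables (F : finType) (m : F -> A).

Definition central_span (b : A) : Prop :=
  exists2 z : F -> A, forall f, central (z f) & b = \sum_f z f * m f.

Lemma central_spanD b b' : central_span b -> central_span b' -> central_span (b + b').
Proof.
move=> [z cz ->] [z' cz' ->]; exists (fun f => z f + z' f).
  by move=> f; apply: centralD.
by rewrite -big_split; apply: eq_bigr => f _; rewrite mulrDl.
Qed.

Lemma central_span0 : central_span 0.
Proof.
exists (fun=> 0) => [f|]; first exact: central0.
by rewrite big1 // => f _; rewrite mul0r.
Qed.

Lemma central_spanM c b : central c -> central_span b -> central_span (c * b).
Proof.
move=> cc [z cz ->]; exists (fun f => c * z f) => [f|]; first exact: centralM.
by rewrite mulr_sumr; apply: eq_bigr => f _; rewrite mulrA.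
Qed.

Lemma central_span_gen f : central_span (m f).
Proof.
exists (fun f' => (f' == f)%:R) => [f'|].
  by case: eqP => _; [apply: central1 | apply: central0].
rewrite (bigD1 f) //= eqxx mul1r big1 ?addr0 // => f' /negPf ->.
by rewrite mul0r.
Qed.

Lemma central_span_sum (I : finType) (E : I -> A) :
  (forall i, central_span (E i)) -> central_span (\sum_i E i).
Proof.
move=> sE; apply: (big_ind central_span) => // [|b b']; first exact: central_span0.
exact: central_spanD.
Qed.
End Span.

Lemma power_reduce x p n : (0 < p)%N -> central (x ^+ p) ->
  exists r : 'I_p, central_multiple (x ^+ n) (x ^+ r).
Proof.
move=> p0 cx; exists (Ordinal (ltn_pmod n p0)), ((x ^+ p) ^+ (n %/ p)).
  exact: centralX.
by rewrite /= -exprM -exprD mulnC -divn_eq.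
Qed.

(** A negative power of g is a positive one up to a central factor: gi^(n+1) =
    (gi^p)^(n+1) g^((n+1)(p-1)). *)
Lemma zpow_reduce g gi p i : (0 < p)%N -> g * gi = 1 -> gi * g = 1 ->
  central (g ^+ p) -> exists r : 'I_p, central_multiple (zpow g gi i) (g ^+ r).
Proof.
move=> p0 ggi gig cg; case: i => n /=; first exact: power_reduce.
have [r [c cc gr]] := power_reduce (n.+1 * p.-1) p0 cg.
have cgi : central (gi ^+ p).
  move=> b; apply/esym/(@comm_inverse _ (g ^+ p)); last exact: cg.
    by rewrite -exprMn_comm ?ggi ?expr1n // /GRing.comm ggi gig.
  by rewrite -exprMn_comm ?gig ?expr1n // /GRing.comm ggi gig.
exists r, ((gi ^+ p) ^+ n.+1 * c); first by apply: centralM => //; apply: centralX.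
have inv m : gi ^+ m * g ^+ m = 1.
  by rewrite -exprMn_comm ?gig ?expr1n // /GRing.comm ggi gig.
rewrite -mulrA -gr -exprM; have -> : (p * n.+1 = n.+1 + n.+1 * p.-1)%N.
  by rewrite -{1}(prednK p0) mulSn addnC mulnC addnC.
by rewrite exprD -mulrA inv mulr1.
Qed.

(** Since h^n = (h^p - h) h^(n-p) + h^(n-p+1), high powers of h reduce to
    lower ones over the center, though not to a single one. *)
Lemma artin_schreier_reduce h p n : (1 < p)%N -> central (h ^+ p - h) ->
  central_span (fun r : 'I_p => h ^+ r) (h ^+ n).
Proof.
move=> p1 ch; elim/ltn_ind: n => n IH; case: (ltnP n p) => [np|pn].
  exact: (central_span_gen (fun r : 'I_p => h ^+ r) (Ordinal np)).
have -> : h ^+ n = (h ^+ p - h) * h ^+ (n - p) + h ^+ (n - p).+1.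
  by rewrite mulrBl -exprS subrK -exprD subnKC.
have nE := subnK pn; apply: central_spanD.
  apply: central_spanM => //; apply: IH.
  by rewrite -[X in (_ < X)%N]nE -[X in (X < _)%N]addn0 ltn_add2l (ltnW p1).
by apply: IH; rewrite -[X in (_ < X)%N]nE -addn1 ltn_add2l.
Qed.

End CentralSpan.

Section ReducedMonomials.
Variables (A : pzRingType) (p : nat) (v : letter -> A).
Hypotheses (p_gt1 : (1 < p)%N).
Hypotheses (vgi : v Lg * v Lgi = 1) (vig : v Lgi * v Lg = 1).
Hypothesis v_central : forall l, l \in [:: Lg; Lz; Lw; Ly; Lu] -> central (v l ^+ p).
Hypothesis v_zeta : central (v Lzeta ^+ p - v Lzeta).

Definition reduced_exponent : Type :=
  'I_p * 'I_p * 'I_p * bool * bool * 'I_p * bool * 'I_p * bool * 'I_p.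

Definition of_reduced (f : reduced_exponent) : exponent :=
  let: (i, b, d, a, e, n, r, m, q, j) := f in
  (Posz i, b : nat, d : nat, a, e, n : nat, r, m : nat, q, j : nat).

(** Each factor of a monomial is reduced separately; central factors can be
    collected in front. *)
Lemma mon_central_span t : central_span (fun f => mon v (of_reduced f)) (mon v t).
Proof.
case: t => [[[[[[[[[i b] d] a] e] n] r] m] q] j].
have p0 : (0 < p)%N by apply: ltnW.
have [i' ii'] := zpow_reduce i p0 vgi vig (@v_central Lg isT).
have [b' bb'] := power_reduce b p0 (@v_central Lz isT).
have [d' dd'] := power_reduce d p0 (@v_central Lw isT).
have [n' nn'] := power_reduce n p0 (@v_central Ly isT).
have [m' mm'] := power_reduce m p0 (@v_central Lu isT).
have [z cz zE] := artin_schreier_reduce j p_gt1 v_zeta.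
rewrite /mon zE mulr_sumr; apply: central_span_sum => j'.
set X := (X in X * (_ * _)).
rewrite (central_mulCA X _ (cz j')).
apply: central_spanM => //.
pose f : reduced_exponent := (i', b', d', a, e, n', r, m', q, j').
suff [c cc ->] : central_multiple (X * v Lzeta ^+ j') (mon v (of_reduced f)).
  apply: central_spanM => //.
  exact: (central_span_gen (fun f => mon v (of_reduced f)) f).
rewrite /X /mon /of_reduced /f /=.
by do !apply: central_multipleM => //; apply: central_multiple_refl.
Qed.
End ReducedMonomials.

Section ModuleFinite.
Variables (k : fieldType) (p : nat).
Hypotheses (chark : p \in [pchar k]) (p_gt2 : (2 < p)%N).
Local Notation A := (Dtilde k).
Local Notation R := (Dtilde_rel k).

Let charA : p \in [pchar A].
Proof. by rewrite pchar_lalg. Qed.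

Lemma comm_generators_central (c : A) :
  comm_generators (tx1 k) (tx2 k) (tv1 k) (tv2 k) (tg k) (tzeta k) c -> central c.
Proof.
move=> [cx1 cx2 cv1 cv2 [cg cz]].
apply: (@Dtilde_generated k (GRing.comm c)); [| |exact: cx1|exact: cx2|exact: cv1
  |exact: cv2|exact: cg| |exact: cz].
- exact: comm_subring.
- by move=> a sa; apply/esym/scalar_central.
- exact: comm_inverse (rel_ggi R) (rel_gig R) (esym cg).
Qed.

Local Notation M := (fun f : reduced_exponent p => mon (@tletter k) (of_reduced f)).

Lemma Dtilde_mon_span t : central_span M (mon (@tletter k) t).
Proof.
apply: mon_central_span.
- exact: ltnW p_gt2.
- exact: rel_ggi R.
- exact: rel_gig R.
- move=> l; rewrite !inE => /or4P[|||/orP[]] /eqP ->; apply: comm_generators_central.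
  + exact: (gp_comm charA R).
  + exact: (zp_comm charA R).
  + exact: (wp_comm charA R).
  + exact: (yp_comm charA R).
  + exact: (up_comm charA R).
- exact/comm_generators_central/(zetap_comm charA R).
Qed.

Theorem Dtilde_PI : PI_algebra A.
Proof.
have two : (2%:R : k) != 0.
  rewrite -(dvdn_pcharf chark); apply/negP => /(dvdn_leq (ltn0Sn 1)).
  by rewrite leqNgt p_gt2.
apply: (finite_over_center_PI (m := M) two) => b.
have [n /Dfil_span] := Dfil_exhaustive b.
elim/span_ind => [|c x y sx sy|t _]; last exact: Dtilde_mon_span.
  exact: central_span0.
apply: (central_spanD (m := M) _ sy); rewrite -mulr_algl; apply: (central_spanM (m := M)) sx.
by move=> a; apply: scalar_central; exists c.
Qed.

End ModuleFinite.

Theorem proposition3p8 (k : closedFieldType) (char_k : 2%N \notin [pchar k]) :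
  [/\ exists2 F : filtration (Dtilde k), exhaustive F &
        exists f : gr F -> tensor (laurent k 5) (exterior k 4),
          [/\ linear f, monoid_morphism f & bijective f],
      noetherian (Ddouble k) /\ noetherian (Dtilde k) &
      forall p : nat, p \in [pchar k] -> (2 < p)%N -> PI_algebra (Dtilde k)].
Proof.
have two : (2%:R : k) != 0 by apply: contra char_k => two0; rewrite inE.
split.
- by exists (Dfil k); [apply: Dfil_exhaustive | apply: gr_Dfil_iso two].
- by split; [apply: Ddouble_noetherian | apply: Dtilde_noetherian].
- by move=> p pk p2; apply: Dtilde_PI pk p2.
Qed.
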